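(* Let $d\in\mathbb N$, $d\ge3$, $-d\le\gamma<0$, and $$\max\Big(1,\frac d{d+2+\gamma}\Big)<q<\frac d{d+\gamma}\qquad\Big(\text{with }\tfrac d{d+\gamma}=\infty\text{ if }\gamma=-d\Big).$$ Then there exists $C_0>0$ depending only on $d,\gamma,q$ such that, for every $\varepsilon>0$, every measurable $\phi:\mathbb R^d\to\mathbb R$ with $\langle\cdot\rangle^{\gamma/2}\phi\in H^1(\mathbb R^d)$ and every measurable $g\ge0$ with $g\in L^1(\mathbb R^d)$ and $\langle\cdot\rangle^{|\gamma|}g\in L^q(\mathbb R^d)$, $$\int_{\mathbb R^d}\phi^2\,\boldsymbol c_\gamma[g]\,dv\le\varepsilon\int_{\mathbb R^d}\Big|\nabla\big(\langle v\rangle^{\frac\gamma2}\phi(v)\big)\Big|^2dv+C_0\Big(\|g\|_1+\varepsilon^{-\frac s{1-s}}\big\|\langle\cdot\rangle^{|\gamma|}g\big\|_q^{\frac1{1-s}}\Big)\int_{\mathbb R^d}\phi^2\langle v\rangle^\gamma dv,$$ where $s\in(0,1)$ is given by $s=\dfrac{d-q(d+\gamma)}{2q}$.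
   Context: $\langle v\rangle=\sqrt{1+|v|^2}$ and $\|\cdot\|_p$ is the $L^p(\mathbb R^d)$ norm. For $\gamma\in(-d,0)$, $\boldsymbol c_\gamma[g](v)=(d-1)(\gamma+d)\int_{\mathbb R^d}|v-v_*|^\gamma g(v_* )\,dv_*$; for $\gamma=-d$, $\boldsymbol c_{-d}[g](v)=c_d\,g(v)$ with $c_d=(d-1)(d-2)|\mathbb S^{d-1}|$. *)

(* Defs.v *)
From HB Require Import structures.
From mathcomp Require Import all_boot all_order all_algebra.
From mathcomp Require Import all_classical all_reals all_analysis.

Set Implicit Arguments.
Unset Strict Implicit.
Unset Printing Implicit Defensive.

Import Order.TTheory GRing.Theory Num.Def Num.Theory.
Import numFieldNormedType.Exports.

Local Open Scope classical_set_scope.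
Local Open Scope ring_scope.

(* R^n is 'rV[R]_n with the sigma-algebra generated by the coordinates (the
   one the library puts on n.-tuple R); it is the Borel sigma-algebra. *)
Section measurable_rV.
Context {R : realType} (n : nat).

Let coor (i : 'I_n) (v : 'rV[R]_n) : measurableTypeR R := v ord0 i.

Let rV_set0 : g_sigma_preimage coor set0.
Proof. exact: sigma_algebra0. Qed.

Let rV_setC A : g_sigma_preimage coor A -> g_sigma_preimage coor (~` A).
Proof. exact: sigma_algebraC. Qed.

Let rV_bigcup (F : _^nat) : (forall i, g_sigma_preimage coor (F i)) ->
  g_sigma_preimage coor (\bigcup_i (F i)).
Proof. exact: sigma_algebra_bigcup. Qed.

HB.instance Definition _ := @isMeasurable.Build default_measure_display
  'rV[R]_n (g_sigma_preimage coor) rV_set0 rV_setC rV_bigcup.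

Lemma measurable_coor (i : 'I_n) :
  measurable_fun [set: 'rV[R]_n] (fun v : 'rV[R]_n => v ord0 i).
Proof.
move=> _ Y mY; rewrite setTI; apply: sub_sigma_algebra => /=.
rewrite -bigcup_seq/=; exists i => /=; first by rewrite mem_index_enum.
by exists Y => //; rewrite setTI.
Qed.

Lemma measurable_fun_rVP d (T : measurableType d) (f : T -> 'rV[R]_n) :
  (forall i, measurable_fun [set: T] (fun x => f x ord0 i)) ->
  measurable_fun [set: T] f.
Proof.
move=> mf.
suff H : g_sigma_preimage (fun i => coor i \o f) `<=` measurable.
  move=> _ A mA; apply: H; rewrite g_sigma_preimage_comp.
  by exists A.
apply: smallest_sub; first exact: sigma_algebra_measurable.
rewrite -bigcup_seq; apply: bigcup_sub => i _ A [B mB <-].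
exact: mf.
Qed.

End measurable_rV.

Section consrV.
Context {R : realType} (n : nat).

Definition consrV (p : measurableTypeR R * 'rV[R]_n) : 'rV[R]_n.+1 :=
  \row_i oapp (fun j => p.2 ord0 j) p.1 (unlift ord0 i).

Definition unconsrV (v : 'rV[R]_n.+1) : measurableTypeR R * 'rV[R]_n :=
  (v ord0 ord0, \row_j v ord0 (lift ord0 j)).

Lemma consrVK : cancel consrV unconsrV.
Proof.
move=> [x v]; rewrite /unconsrV /consrV mxE unlift_none/=; congr pair.
by apply/rowP => j; rewrite !mxE liftK.
Qed.

Lemma measurable_consrV : measurable_fun setT consrV.
Proof.
apply: measurable_fun_rVP => i; rewrite /consrV.
case: (unliftP ord0 i) => [j ->|->].
  under eq_fun do rewrite mxE liftK/=.
  exact: measurableT_comp (measurable_coor j) measurable_snd.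
under eq_fun do rewrite mxE unlift_none/=.
exact: measurable_fst.
Qed.

Lemma measurable_unconsrV : measurable_fun setT unconsrV.
Proof.
apply: measurable_fun_pair; first exact: measurable_coor.
apply: measurable_fun_rVP => i /=.
under eq_fun do rewrite mxE.
exact: measurable_coor.
Qed.

Variable mu : {sigma_finite_measure set 'rV[R]_n -> \bar R}.

Definition lebesgue_rV_succ : set 'rV[R]_n.+1 -> \bar R :=
  pushforward (lebesgue_measure \x mu)%E consrV.

Let lebesgue_rV_succ0 : lebesgue_rV_succ set0 = 0%E.
Proof. by rewrite /lebesgue_rV_succ /pushforward preimage_set0 measure0. Qed.

Let lebesgue_rV_succ_ge0 A : (0 <= lebesgue_rV_succ A)%E.
Proof. by rewrite /lebesgue_rV_succ /pushforward; apply: measure_ge0. Qed.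

Let lebesgue_rV_succ_sigma_additive : semi_sigma_additive lebesgue_rV_succ.
Proof.
move=> F mF tF mUF; rewrite /lebesgue_rV_succ /pushforward preimage_bigcup.
apply: measure_semi_sigma_additive.
- by move=> i; rewrite -[X in measurable X]setTI; exact: measurable_consrV.
- by apply/trivIsetP => i j _ _ ij; rewrite -preimage_setI;
    move/trivIsetP : tF => /(_ i j _ _ ij) ->//; rewrite preimage_set0.
- rewrite -preimage_bigcup -[X in measurable X]setTI.
  exact: measurable_consrV.
Qed.

HB.instance Definition _ := isMeasure.Build _ _ _ lebesgue_rV_succ
  lebesgue_rV_succ0 lebesgue_rV_succ_ge0 lebesgue_rV_succ_sigma_additive.

Let lebesgue_rV_succ_sigma_finite : sigma_finite setT lebesgue_rV_succ.
Proof.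
have /sigma_finiteP[F [TF ndF Foo]] :=
  sigma_finiteT (@lebesgue_measure R : {sigma_finite_measure set _ -> \bar R}).
have /sigma_finiteP[G [TG ndG Goo]] := sigma_finiteT mu.
exists (fun k => unconsrV @^-1` (F k `*` G k)).
  apply/seteqP; split => // v _.
  have [j _ Fj] : (\bigcup_i F i) (v ord0 ord0) by rewrite -TF.
  have [k _ Gk] : (\bigcup_i G i) (unconsrV v).2 by rewrite -TG.
  exists (maxn j k) => //; split => /=.
    by move: Fj; exact/subsetPset/ndF/leq_maxl.
  by move: Gk; exact/subsetPset/ndG/leq_maxr.
move=> k; have [mF Fk] := Foo k; have [mG Gk] := Goo k; split.
  rewrite -[X in measurable X]setTI; apply: measurable_unconsrV => //.
  exact: measurableX.
rewrite /lebesgue_rV_succ /pushforward -comp_preimage.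
rewrite (_ : unconsrV \o consrV = id); last first.
  by apply/funext => p; exact: consrVK.
rewrite preimage_id product_measure1E//.
by rewrite lte_mul_pinfty// ge0_fin_numE.
Qed.

HB.instance Definition _ := Measure_isSigmaFinite.Build _ _ _ lebesgue_rV_succ
  lebesgue_rV_succ_sigma_finite.

End consrV.

Fixpoint lebesgue_rV (R : realType) (n : nat) :
    {sigma_finite_measure set 'rV[R]_n -> \bar R} :=
  match n with
  | 0 => \d_ (0 : 'rV[R]_0)
  | n.+1 => lebesgue_rV_succ (lebesgue_rV R n)
  end.

Lemma lebesgue_rV_box (R : realType) (n : nat)
    (A : 'I_n -> set (measurableTypeR R)) : (forall i, measurable (A i)) ->
  lebesgue_rV R n [set v | forall i, A i (v ord0 i)] =
  (\prod_(i < n) lebesgue_measure (A i))%E.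
Proof.
elim: n A => [|n IH] A mA.
  rewrite big_ord0 /= diracE (_ : _ \in _)//.
  by rewrite inE /= => -[].
have mB : measurable
    [set v : 'rV[R]_n | forall i, A (lift ord0 i) (v ord0 i)].
  rewrite (_ : [set _ | _] = \big[setI/setT]_(i < n)
      ((fun v : 'rV[R]_n => v ord0 i) @^-1` A (lift ord0 i))).
    apply: bigsetI_measurable => i _; rewrite -[X in measurable X]setTI.
    apply: measurable_coor => //; exact: mA.
  rewrite -bigcap_seq; apply/seteqP; split => v /=.
    by move=> H i _; exact: H.
  by move=> H i; apply: H; exact: mem_index_enum.
rewrite big_ord_recl -(IH (fun i => A (lift ord0 i)))//=.
rewrite /lebesgue_rV_succ /pushforward -product_measure1E//=.
congr (_ _); apply/seteqP; split => -[x v] /=.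
  move=> H; split => [|i].
    by have := H ord0; rewrite mxE unlift_none.
  by have := H (lift ord0 i); rewrite mxE liftK.
move=> [Ax Av] i; rewrite mxE; case: (unliftP ord0 i) => [j ->|->].
- by rewrite ?liftK; exact: Av.
- by rewrite ?unlift_none.
Qed.

Section euclidean.
Context {R : realType} {n : nat}.
Implicit Types v : 'rV[R]_n.

(* The library's norm on 'rV[R]_n is the sup norm. *)
Definition enorm v : R := Num.sqrt (\sum_i v ord0 i ^+ 2).

Definition bracket v : R := Num.sqrt (1 + enorm v ^+ 2).

(* Surface measure on the unit sphere, normalized by polar coordinates. *)
Definition sphere_measure (E : set 'rV[R]_n) : \bar R :=
  (n%:R%:E * lebesgue_rV R n
    [set v | exists r u, [/\ 0 < r <= 1, E u & v = r *: u]%R])%E.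

Definition unit_sphere : set 'rV[R]_n := [set u | enorm u = 1].

End euclidean.

Section weak_derivative.
Context {R : realType} {n : nat}.
Implicit Types (f h eta : 'rV[R]_n -> R) (i : 'I_n).
Local Notation mu := (lebesgue_rV R n).

Definition partial i f : 'rV[R]_n -> R := 'D_(delta_mx ord0 i) f.

Definition smooth f : Prop := forall l : seq 'I_n,
  let f_l := foldr partial f l in
  continuous f_l /\ forall i v, derivable f_l v (delta_mx ord0 i).

Definition test_function eta : Prop :=
  smooth eta /\ compact (closure [set v | eta v != 0]).

Definition locally_integrable_rV f : Prop :=
  measurable_fun setT f /\
  forall K, compact K -> (\int[mu]_(v in K) `|f v|%:E < +oo)%E.

Definition is_weak_partial i f h : Prop :=
  [/\ locally_integrable_rV f, locally_integrable_rV h &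
    forall eta, test_function eta ->
    (\int[mu]_v (f v * partial i eta v)%:E =
     - \int[mu]_v (h v * eta v)%:E)%E].

(* Determined up to a null set, when it exists. *)
Definition weak_partial i f : 'rV[R]_n -> R :=
  xget (fun=> 0) [set h | is_weak_partial i f h].

Definition weak_grad f v : 'rV[R]_n := \row_i weak_partial i f v.

Definition sobolev_H1 f : Prop :=
  f \in Lfun mu 2%:E /\
  forall i, exists2 h, is_weak_partial i f h & h \in Lfun mu 2%:E.

End weak_derivative.

(* At w = v the library has 0 `^ gamma = 0; this is a null set of w. *)
Definition c_gamma (R : realType) (d : nat) (gamma : R) (g : 'rV[R]_d -> R)
    (v : 'rV[R]_d) : \bar R :=
  if gamma == - d%:R then
    (((d%:R - 1) * (d%:R - 2))%:E * sphere_measure (@unit_sphere R d)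
     * (g v)%:E)%E
  else
    (((d%:R - 1) * (gamma + d%:R))%:E *
     \int[lebesgue_rV R d]_w (enorm (v - w) `^ gamma * g w)%:E)%E.

(* Main.v *)
(* Put psi = <v>^(gamma/2) phi and call V a Morrey potential if its averages over
   cubes of half-side l are at most M l^(-2s). Replacing V by its average at scale l
   changes (int psi^2 V)^(1/2) by at most a constant times l (sup V)^(1/2) |grad psi|_2,
   because translating psi by l moves it by at most l |grad psi|_2 in L^2. Truncate V
   and average it at the scales l 2^(-k), ..., l/2, l: every average keeps the Morrey
   bound, and the errors form a geometric series since s < 1, whence
     int psi^2 V <= C M (l^(-2s) |psi|_2^2 + l^(2-2s) |grad psi|_2^2);
   the choice of l gives the powers of epsilon.
   By Hoelder's inequality, Morrey potentials are G = <.>^|gamma| g in L^q when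
   gamma = -d, and its Riesz potential |.|^gamma * G otherwise; the latter controls
   c_gamma[g] because
     <v>^|gamma| |v-w|^gamma <= 2^|gamma| (1 + |v-w|^gamma <w>^|gamma|).
   For the translation estimate, the Steklov average in direction e of a product of
   smooth bumps is a test function whose derivative along e is a difference of bumps.
   Letting the bumps increase to the indicator of a box and using that boxes
   determine measures yields psi (v + c e) - psi v = int_0^c h (v + t e) dt for
   almost all v, h being the weak derivative of psi along e. *)
From HB Require Import structures.
Require Import Defs.
From mathcomp Require Import all_boot all_order all_algebra.
From mathcomp Require Import all_classical all_reals all_analysis.
From mathcomp Require Import measurable_realfun ring lra.

Set Implicit Arguments.
Unset Strict Implicit.
Unset Printing Implicit Defensive.

Import Order.TTheory GRing.Theory Num.Def Num.Theory.
Import numFieldNormedType.Exports.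

Local Open Scope classical_set_scope.
Local Open Scope ring_scope.

(** * Lebesgue measure on boxes and cubes *)

(** The exponents come from a scaling count, [gamma + d (1 - 1/q) = - 2 s]: the kernel gives
    [gamma], Hoelder's inequality on a cube gives [d (1 - 1/q)]. The upper bound on q says s > 0,
    which makes the large scales of the Riesz potential summable; the bound q > d / (d + 2 + gamma)
    says s < 1, which makes the averaging errors, of order [l^(1-s)] at scale l, summable over small
    scales. Passing from V to its average puts a factor [1 + delta] on the form, and iterating with
    a fixed delta would multiply these factors. Optimizing delta at every step yields a triangle
    inequality for the square root of the form, in which the errors add up. A Morrey bound controls
    averages only; the pointwise bound that starts the iteration comes from truncation. The number
    of scales depends on the truncation level, the sum of the errors does not, so monotone
    convergence removes it. The gradient enters only through translations in L^2, obtained from the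
    definition of a weak derivative, without Sobolev embedding or density of smooth functions. Cubes
    replace balls because their measure is explicit. *)

Section boxes.
Context {R : realType} (n : nat).
Implicit Types (a b : 'I_n -> R) (y z : 'rV[R]_n) (r : R).

Definition obox a b : set 'rV[R]_n := [set v | forall i, a i < v ord0 i < b i].

Definition cube z r : set 'rV[R]_n :=
  [set v | forall i, `|v ord0 i - z ord0 i| <= r].

Definition oboxes : set (set 'rV[R]_n) := [set A | exists a b, A = obox a b].

Lemma measurable_rV_box (A : 'I_n -> set (measurableTypeR R)) :
  (forall i, measurable (A i)) ->
  measurable [set v : 'rV[R]_n | forall i, A i (v ord0 i)].
Proof.
move=> mA; rewrite (_ : [set _ | _] = \big[setI/setT]_(i < n)
      ((fun v : 'rV[R]_n => v ord0 i) @^-1` A i)).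
  apply: bigsetI_measurable => i _; rewrite -[X in measurable X]setTI.
  by apply: measurable_coor => //; exact: mA.
rewrite -bigcap_seq; apply/seteqP; split => v /=.
  by move=> H i _; exact: H.
by move=> H i; apply: H; exact: mem_index_enum.
Qed.

Lemma measurable_obox a b : measurable (obox a b).
Proof.
rewrite (_ : obox a b = [set v | forall i, `]a i, b i[%classic (v ord0 i)]).
  by apply: (@measurable_rV_box (fun i => `]a i, b i[%classic)) => i;
     exact: measurable_itv.
by apply/seteqP; split => v /= H i; have := H i; rewrite /= in_itv.
Qed.

Let cubeE z r : cube z r =
  [set v | forall i, `[z ord0 i - r, z ord0 i + r]%classic (v ord0 i)].
Proof.
by apply/seteqP; split => v /= H i; have := H i; rewrite /= in_itv/= ler_distl.
Qed.

Lemma measurable_cube z r : measurable (cube z r).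
Proof.
rewrite cubeE.
by apply: (@measurable_rV_box (fun i => `[_, _]%classic)) => i;
   exact: measurable_itv.
Qed.

Lemma lebesgue_cube z r : 0 <= r ->
  lebesgue_rV R n (cube z r) = ((r *+ 2) ^+ n)%:E.
Proof.
move=> r0; rewrite cubeE.
rewrite (lebesgue_rV_box (A := fun i => `[z ord0 i - r, z ord0 i + r]%classic));
  last by move=> i; exact: measurable_itv.
under eq_bigr => i _ do rewrite lebesgue_measure_itv/= lte_fin.
rewrite (eq_bigr (fun=> (r *+ 2)%:E)); last first.
  move=> i _; case: ifPn => h; first by rewrite -EFinB; congr EFin; lra.
  congr EFin; apply/eqP; rewrite eq_le; apply/andP; split; lra.
by rewrite -(big_morph EFin EFinM erefl) prodr_const card_ord.
Qed.

Lemma lebesgue_obox a b : (forall i, a i <= b i) ->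
  lebesgue_rV R n (obox a b) = (\prod_(i < n) (b i - a i))%:E.
Proof.
move=> ab.
rewrite (_ : obox a b = [set v | forall i, `]a i, b i[%classic (v ord0 i)]).
  rewrite (lebesgue_rV_box (A := fun i => `]a i, b i[%classic)); last first.
    by move=> i; exact: measurable_itv.
  under eq_bigr => i _ do rewrite lebesgue_measure_itv/= lte_fin.
  rewrite (big_morph EFin EFinM erefl); apply: eq_bigr => i _; case: ifPn => h //.
  congr EFin; apply/eqP; rewrite eq_le; have := ab i; lra.
by apply/seteqP; split => v /= H i; have := H i; rewrite /= in_itv.
Qed.

Lemma oboxes_setI : setI_closed oboxes.
Proof.
move=> _ _ [a [b ->]] [a' [b' ->]].
exists (fun i => Num.max (a i) (a' i)), (fun i => Num.min (b i) (b' i)).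
apply/seteqP; split => v /=.
  by move=> [H H'] i; have := H i; have := H' i; rewrite gt_max lt_min;
     move=> /andP[-> ->] /andP[-> ->].
by move=> H; split => i; have := H i; rewrite gt_max lt_min;
   move=> /andP[/andP[? ?] /andP[? ?]]; apply/andP.
Qed.

Lemma exists_nat_gt (f : 'I_n -> R) : exists k : nat, forall i, f i < k%:R.
Proof.
exists (\max_(i < n) (truncn (f i)).+1)%N => i.
apply: (lt_le_trans (truncnS_gt (f i))); rewrite ler_nat.
exact: (leq_bigmax i).
Qed.

(** The preimage of an open interval under one coordinate is the union over k of the boxes whose
    other sides are ]-k, k[, so the boxes generate the coordinate sigma-algebra. *)
Lemma measurable_rVE : @measurable _ 'rV[R]_n = <<s oboxes >>.
Proof.
apply/seteqP; split; last first.
  apply: smallest_sub; first exact: sigma_algebra_measurable.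
  by move=> _ [a [b ->]]; exact: measurable_obox.
apply: smallest_sub; first exact: smallest_sigma_algebra.
rewrite -bigcup_seq; apply: bigcup_sub => i _ A [B mB <-].
rewrite setTI.
have {}mB : (@RGenOpens.G R).-sigma.-measurable B.
  by rewrite -RGenOpens.measurableE.
suff : (@RGenOpens.G R).-sigma.-measurable `<=`
   [set C | <<s oboxes >> ((fun v : 'rV[R]_n => v ord0 i) @^-1` C)] by exact.
have [sA0 sAC sAU] := @smallest_sigma_algebra _ setT oboxes.
apply: smallest_sub.
  split => //=.
  - by move=> C /sAC; rewrite !setTD.
  - by move=> F HF; rewrite preimage_bigcup; exact: sAU.
move=> _ [x [y ->]] /=.
rewrite (_ : _ @^-1` _ = \bigcup_k
  obox (fun j => if j == i then x else - k%:R)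
       (fun j => if j == i then y else k%:R)).
  by apply: sAU => k; apply: sub_sigma_algebra; eexists; eexists.
apply/seteqP; split => v /=.
  rewrite in_itv/= => xy; have [k Hk] := exists_nat_gt (fun i => `|v ord0 i|).
  exists k => //= j; case: eqVneq => [->//|_].
  by have := Hk j; rewrite ltr_norml.
by move=> [k _ /(_ i)]; rewrite eqxx in_itv.
Qed.

(** Boxes form a pi-system exhausted by the boxes ]-k, k[^n. Equality is asked for ordered corners
    only, where the product formula for the volume is valid; all other boxes are empty. *)
Lemma oboxes_measure_unique (m1 m2 : {measure set 'rV[R]_n -> \bar R}) :
  (forall a b, (forall i, a i <= b i) -> m1 (obox a b) = m2 (obox a b)) ->
  (forall a b, (m1 (obox a b) < +oo)%E) ->
  forall A, measurable A -> m1 A = m2 A.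
Proof.
move=> m12 m1oo A mA.
pose g k : set 'rV[R]_n := obox (fun=> - k%:R) (fun=> k%:R).
apply: (measure_unique oboxes g) => //.
- exact: measurable_rVE.
- exact: oboxes_setI.
- by move=> k; eexists; eexists.
- apply/seteqP; split => // v _.
  have [k Hk] := exists_nat_gt (fun i => `|v ord0 i|).
  by exists k => //= j; have := Hk j; rewrite ltr_norml.
- move=> _ [a [b ->]].
  have [/forallP ab|] := boolP [forall i, a i <= b i]; first exact: m12.
  rewrite negb_forall => /existsP[i abi].
  suff -> : obox a b = set0 by rewrite !measure0.
  apply/seteqP; split => // v /(_ i) /andP[h1 h2].
  by move: abi; rewrite (ltW (lt_trans h1 h2)).
- by move=> k; exact: m1oo.
Qed.

Lemma measurable_addrV d (T : measurableType d) (f g : T -> 'rV[R]_n) :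
  measurable_fun setT f -> measurable_fun setT g ->
  measurable_fun setT (fun x => f x + g x).
Proof.
move=> mf mg; apply: measurable_fun_rVP => i.
under eq_fun do rewrite mxE.
by apply: measurable_funD; exact: (measurableT_comp (measurable_coor i)).
Qed.

Lemma measurable_opprV d (T : measurableType d) (f : T -> 'rV[R]_n) :
  measurable_fun setT f -> measurable_fun setT (fun x => - f x).
Proof.
move=> mf; apply: measurable_fun_rVP => i.
under eq_fun do rewrite mxE.
by apply: measurableT_comp => //; exact: (measurableT_comp (measurable_coor i)).
Qed.

Lemma measurable_subrV d (T : measurableType d) (f g : T -> 'rV[R]_n) :
  measurable_fun setT f -> measurable_fun setT g ->
  measurable_fun setT (fun x => f x - g x).
Proof. by move=> mf mg; apply: measurable_addrV => //; exact: measurable_opprV. Qed.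

Lemma measurable_scalerV d (T : measurableType d) (f : T -> R)
    (g : T -> 'rV[R]_n) :
  measurable_fun setT f -> measurable_fun setT g ->
  measurable_fun setT (fun x => f x *: g x).
Proof.
move=> mf mg; apply: measurable_fun_rVP => i.
under eq_fun do rewrite mxE.
by apply: measurable_funM => //; exact: (measurableT_comp (measurable_coor i)).
Qed.

(** A translate of a box is a box with the same side lengths, and boxes determine measures. *)
Lemma lebesgue_rV_translation y (A : set 'rV[R]_n) : measurable A ->
  pushforward (lebesgue_rV R n) (fun v => v + y) A = lebesgue_rV R n A.
Proof.
move=> mA.
have mt : measurable_fun setT (fun v : 'rV[R]_n => v + y).
  by apply: measurable_addrV => //; exact: measurable_cst.
pose mt_mixin := isMeasurableFun.Build _ _ _ _ _ mt.
pose mt_pack : {mfun _ >-> _} := HB.pack (fun v : 'rV[R]_n => v + y) mt_mixin.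
have pE a b : (fun v : 'rV[R]_n => v + y) @^-1` obox a b =
    obox (fun i => a i - y ord0 i) (fun i => b i - y ord0 i).
  apply/seteqP; split => v /= H i; have := H i;
  by rewrite mxE ltrBlDr ltrBrDr.
apply: (@oboxes_measure_unique (pushforward (lebesgue_rV R n) mt_pack)) => //.
- move=> a b ab; rewrite [LHS](_ : _ = lebesgue_rV R n (obox (fun i => a i - y ord0 i)
     (fun i => b i - y ord0 i))) ?pE//; last by rewrite -pE.
  rewrite [RHS]lebesgue_obox// lebesgue_obox.
    by congr EFin; apply: eq_bigr => i _; rewrite opprB addrA subrK.
  by move=> i; rewrite lerB.
- move=> a b; rewrite [ltLHS](_ : _ = lebesgue_rV R n (obox (fun i => a i - y ord0 i)
     (fun i => b i - y ord0 i))); last by rewrite -pE.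
  set a' := fun _ => _; set b' := fun _ => _.
  (* The corners need not be ordered here; raising b' to the maximum of a' and b' gives an ordered
     box that contains the given one. *)
  apply: (@le_lt_trans _ _ (lebesgue_rV R n (obox a' (fun i => Num.max (a' i) (b' i))))).
    apply: le_measure; rewrite ?inE; [exact: measurable_obox..|].
    by move=> v /= H i; have := H i; rewrite lt_max => /andP[-> ->]; rewrite orbT.
  by rewrite lebesgue_obox ?ltry// => i; rewrite le_max lexx.
Qed.

Lemma ge0_integral_translation y (f : 'rV[R]_n -> \bar R) :
  measurable_fun setT f -> (forall v, 0 <= f v)%E ->
  (\int[lebesgue_rV R n]_v f (v + y)%R = \int[lebesgue_rV R n]_v f v)%E.
Proof.
move=> mf f0.
have mt : measurable_fun setT (fun v : 'rV[R]_n => v + y).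
  by apply: measurable_addrV => //; exact: measurable_cst.
have := @ge0_integral_pushforward _ _ _ _ _ _ mt (lebesgue_rV R n) setT f
  measurableT mf (fun v _ => f0 v).
rewrite preimage_setT => <-.
by apply: eq_measure_integral => A mA _; exact: lebesgue_rV_translation.
Qed.

End boxes.

(** * Tonelli's theorem for integrals restricted to measurable sets *)

Section tonelli_on.
Context d1 d2 (T1 : measurableType d1) (T2 : measurableType d2) (R : realType).
Variables (m1 : {sigma_finite_measure set T1 -> \bar R}).
Variables (m2 : {sigma_finite_measure set T2 -> \bar R}).
Variables (D : set T2) (mD : measurable D) (f : T1 * T2 -> \bar R).
Hypotheses (mf : measurable_fun setT f) (f0 : forall x, (0 <= f x)%E).

Let g x := (f x * (\1_D x.2)%:E)%E.

Let mg : measurable_fun setT g.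
Proof.
apply: emeasurable_funM => //; apply/measurable_EFinP.
by apply: (measurableT_comp (measurable_indic _)) => //; exact: measurable_snd.
Qed.

Let g0 x : (0 <= g x)%E. Proof. by rewrite mule_ge0// lee_fin. Qed.

Let intg x : (\int[m2]_(y in D) f (x, y) = \int[m2]_y g (x, y))%E.
Proof. by rewrite integral_mkcond epatch_indic. Qed.

Lemma measurable_integral_on :
  measurable_fun setT (fun x => \int[m2]_(y in D) f (x, y))%E.
Proof.
rewrite (_ : (fun _ => _) = fubini_F m2 g); last by apply/funext => x; exact: intg.
exact: measurable_fun_fubini_tonelli_F.
Qed.

Lemma tonelli_on : (\int[m1]_x \int[m2]_(y in D) f (x, y) =
  \int[m2]_(y in D) \int[m1]_x f (x, y))%E.
Proof.
under eq_integral => x _ do rewrite intg.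
rewrite (fubini_tonelli g)// [RHS]integral_mkcond epatch_indic.
apply: eq_integral => y _ /=; rewrite /g/=.
by rewrite ge0_integralZr//; exact: measurable_fun_pair1.
Qed.

End tonelli_on.

Lemma tonelli_on2 d1 d2 (T1 : measurableType d1) (T2 : measurableType d2)
    (R : realType) (m1 : {sigma_finite_measure set T1 -> \bar R})
    (m2 : {sigma_finite_measure set T2 -> \bar R}) (C : set T1) (D : set T2)
    (f : T1 * T2 -> \bar R) : measurable C -> measurable D ->
  measurable_fun setT f -> (forall x, (0 <= f x)%E) ->
  (\int[m1]_(x in C) \int[m2]_(y in D) f (x, y) =
   \int[m2]_(y in D) \int[m1]_(x in C) f (x, y))%E.
Proof.
move=> mC mD mf f0; rewrite integral_mkcond epatch_indic.
pose h x := (f x * (\1_C x.1)%:E)%E.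
have mh : measurable_fun setT h.
  apply: emeasurable_funM => //; apply/measurable_EFinP.
  by apply: (measurableT_comp (measurable_indic _)) => //; exact: measurable_fst.
transitivity (\int[m1]_x \int[m2]_(y in D) h (x, y))%E.
  apply: eq_integral => x _ /=; rewrite /h/= ge0_integralZr//.
  by apply: measurable_funTS; exact: measurable_fun_pair2.
rewrite tonelli_on//; last by move=> x; rewrite mule_ge0// lee_fin.
by apply: eq_integral => y _; rewrite [RHS]integral_mkcond epatch_indic.
Qed.

(** * Elementary inequalities and geometric sums *)

Section real_lemmas.
Context {R : realType}.

(* The infimum over delta of the bound on a is (sqrt b + sqrt c)^2. *)
Lemma sqrt_le_add (a b c : R) : 0 <= a -> 0 <= b -> 0 <= c ->
  (forall delta, 0 < delta -> a <= (1 + delta) * b + (1 + delta^-1) * c) ->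
  Num.sqrt a <= Num.sqrt b + Num.sqrt c.
Proof.
move=> a0 b0 c0 H.
have sb := sqrtr_ge0 b; have sc := sqrtr_ge0 c.
set s := Num.sqrt b in sb *; set t := Num.sqrt c in sc *.
have bE : b = s ^+ 2 by rewrite sqr_sqrtr.
have cE : c = t ^+ 2 by rewrite sqr_sqrtr.
suff : a <= (s + t) ^+ 2.
  by move=> /ler_wsqrtr; rewrite sqrtr_sqr ger0_norm ?addr_ge0.
suff H' e : 0 < e -> a <= (s + t) ^+ 2 + e * (s + t).
  apply/ler_addgt0Pr => e e0.
  have st : 0 < s + t + 1 by rewrite ltr_wpDl// addr_ge0.
  have := H' (e / (s + t + 1)) (divr_gt0 e0 st).
  move=> /le_trans; apply; rewrite lerD2l.
  rewrite mulrAC -mulrA ler_piMr ?(ltW e0)//.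
  by rewrite ler_pdivrMr// mul1r lerDl.
move=> e0.
have se : 0 < s + e by rewrite ltr_wpDl.
have te : 0 < t + e by rewrite ltr_wpDl.
(* The optimal delta is t / s; adding e to both terms keeps it positive when s or t vanishes. *)
have := H ((t + e) / (s + e)) (divr_gt0 te se).
move=> /le_trans; apply; rewrite bE cE invf_div.
have h1 : (t + e) / (s + e) * s ^+ 2 <= (t + e) * s.
  rewrite mulrAC ler_pdivrMr// -mulrA ler_wpM2l ?(ltW te)//.
  by rewrite expr2 ler_wpM2l// lerDl ltW.
have h2 : (s + e) / (t + e) * t ^+ 2 <= (s + e) * t.
  rewrite mulrAC ler_pdivrMr// -mulrA ler_wpM2l ?(ltW se)//.
  by rewrite expr2 ler_wpM2l// lerDl ltW.
nra.
Qed.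

Lemma sqr_le_young (a b delta : R) : 0 < delta ->
  a ^+ 2 <= (1 + delta) * b ^+ 2 + (1 + delta^-1) * (b - a) ^+ 2.
Proof.
move=> d0; rewrite -subr_ge0.
have -> : (1 + delta) * b ^+ 2 + (1 + delta^-1) * (b - a) ^+ 2 - a ^+ 2 =
  delta^-1 * ((1 + delta) * b - a) ^+ 2.
  by field; rewrite gt_eqF.
by rewrite mulr_ge0 ?sqr_ge0// invr_ge0 ltW.
Qed.

Lemma powR2_gt1 (x : R) : 0 < x -> 1 < 2 `^ x.
Proof.
move=> x0; have := @gt0_ltr_powR _ _ x0 1 2; rewrite powR1.
by apply; rewrite ?nnegrE ?ltr1n.
Qed.

Lemma exists_le_expr (r c : R) : 1 < r -> exists k, c <= r ^+ k.
Proof.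
move=> r1; have h0 : 0 < r - 1 by rewrite subr_gt0.
have bern k : 1 + k%:R * (r - 1) <= r ^+ k.
  elim: k => [|k IH]; first by rewrite mul0r addr0 expr0.
  rewrite exprSr; apply: le_trans (ler_wpM2r (ltW (lt_trans ltr01 r1)) IH).
  rewrite -subr_ge0 [X in 0 <= X](_ : _ = k%:R * (r - 1) ^+ 2).
    by rewrite mulr_ge0// sqr_ge0.
  by rewrite mulrSr; ring.
exists (truncn (c / (r - 1))).+1; apply: le_trans (bern _).
have := truncnS_gt (c / (r - 1)); rewrite ltr_pdivrMr// => /ltW /le_trans; apply.
by rewrite lerDr.
Qed.

Lemma powRD_gt0 (x a b : R) : 0 < x ->
  x `^ (a + b) = x `^ a * x `^ b.
Proof. by move=> x0; apply: powRD; apply/implyP => _; rewrite gt_eqF. Qed.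

Lemma geometric_partial_le (a : R) k : 0 <= a < 1 ->
  \sum_(0 <= i < k) a ^+ i <= (1 - a)^-1.
Proof.
move=> /andP[a0 a1]; rewrite big_mkord -[leRHS]mul1r ler_pdivlMr ?subr_gt0//.
have -> : 1 - a = - (a - 1) by rewrite opprB.
by rewrite mulrC mulNr -subrX1 opprB lerBlDr lerDl exprn_ge0.
Qed.

Lemma nneseries_le (u : nat -> R) (B : R) : (forall k, 0 <= u k) ->
  (forall k, \sum_(0 <= i < k) u i <= B) -> (\sum_(0 <= i <oo) (u i)%:E <= B%:E)%E.
Proof.
move=> u0 uB; apply: lime_le; first by apply: is_cvg_nneseries => k _ _; rewrite lee_fin.
by apply: nearW => k; rewrite sumEFin lee_fin.
Qed.

End real_lemmas.

(** * Forms of Morrey potentials *)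

Section morrey.
Context {R : realType} (n : nat).
Local Notation mu := (lebesgue_rV R n).
Implicit Types (V : 'rV[R]_n -> \bar R) (l M s : R).

(** Written as a convolution with the normalized indicator of [cube 0 l]: averages at two scales
    then commute by Tonelli, and the averaging can be moved from V to psi by translation.
    [cube_avgE] recovers the mean over [cube x l]. *)
Definition cube_avg l V (x : 'rV[R]_n) : \bar R :=
  (((l *+ 2) ^+ n)^-1%:E * \int[mu]_(y in cube 0 l) V (x - y)%R)%E.

Definition morrey M s V := [/\ measurable_fun setT V, forall x, (0 <= V x)%E &
  forall l x, 0 < l -> (cube_avg l V x <= (M * l `^ (- (2 * s)))%:E)%E].

Lemma measurable_shift V y : measurable_fun setT V ->
  measurable_fun setT (fun x : 'rV[R]_n => V (x - y)%R).
Proof.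
move=> mV; apply: (measurableT_comp mV).
by apply: measurable_subrV => //; exact: measurable_cst.
Qed.

Lemma measurable_sub_cst V x : measurable_fun setT V ->
  measurable_fun setT (fun y : 'rV[R]_n => V (x - y)%R).
Proof.
move=> mV; apply: (measurableT_comp mV).
by apply: measurable_subrV; [exact: measurable_cst|exact: measurable_id].
Qed.

Lemma measurable_sub_pair V : measurable_fun setT V ->
  measurable_fun setT (fun z : 'rV[R]_n * 'rV[R]_n => V (z.1 - z.2)%R).
Proof.
move=> mV; apply: (measurableT_comp mV).
by apply: measurable_subrV; [exact: measurable_fst|exact: measurable_snd].
Qed.

Lemma measurable_cube_avg l V : measurable_fun setT V ->
  (forall x, 0 <= V x)%E -> measurable_fun setT (cube_avg l V).
Proof.
move=> mV V0; apply: emeasurable_funM => //.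
have := @measurable_integral_on _ _ _ _ _ mu (cube (0 : 'rV[R]_n) l)
   (@measurable_cube _ _ _ _) _ (measurable_sub_pair mV) (fun z => V0 _).
exact.
Qed.

Lemma cube_avg_ge0 l V x : 0 <= l -> (forall x, 0 <= V x)%E ->
  (0 <= cube_avg l V x)%E.
Proof.
move=> l0 V0; rewrite mule_ge0 ?integral_ge0// lee_fin invr_ge0 exprn_ge0//.
by rewrite mulrn_wge0.
Qed.

Lemma cube_avg_le l V (B : R) x : 0 < l -> measurable_fun setT V ->
  (forall x, 0 <= V x)%E -> (forall x, V x <= B%:E)%E ->
  (cube_avg l V x <= B%:E)%E.
Proof.
move=> l0 mV V0 VB; rewrite /cube_avg.
have c0 : 0 < (l *+ 2) ^+ n by rewrite exprn_gt0// mulrn_wgt0.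
rewrite lee_pdivrMl// muleC -(lebesgue_cube (0 : 'rV[R]_n) (ltW l0)).
rewrite -integral_cst; last exact: measurable_cube.
apply: ge0_le_integral => //; first exact: measurable_cube.
apply: measurable_funTS.
exact: measurable_sub_cst.
Qed.

Lemma cube_avgC l l' V x : 0 < l -> 0 < l' -> measurable_fun setT V ->
  (forall x, 0 <= V x)%E ->
  cube_avg l (cube_avg l' V) x = cube_avg l' (cube_avg l V) x.
Proof.
move=> l0 l'0 mV V0.
have mc r : measurable (cube (0 : 'rV[R]_n) r) by exact: measurable_cube.
have mint r r' : measurable_fun (cube (0 : 'rV[R]_n) r')
    (fun y => \int[mu]_(z in cube 0 r) V (x - y - z)%R)%E.
  apply: measurable_funTS.
  apply: (@measurable_integral_on _ _ _ _ _ mu _ (mc r)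
    (fun p : 'rV[R]_n * 'rV[R]_n => V (x - p.1 - p.2)%R)) => //.
  apply: (measurableT_comp mV); apply: measurable_subrV.
    by apply: measurable_subrV; [exact: measurable_cst|exact: measurable_fst].
  exact: measurable_snd.
have e0 r : 0 < r -> 0 <= ((r *+ 2) ^+ n)^-1 :> R.
  by move=> r0; rewrite invr_ge0 exprn_ge0// mulrn_wge0// ltW.
have E r r' : 0 < r -> 0 < r' -> cube_avg r (cube_avg r' V) x =
   (((r *+ 2) ^+ n)^-1%:E * (((r' *+ 2) ^+ n)^-1%:E *
    \int[mu]_(y in cube 0 r) \int[mu]_(z in cube 0 r') V (x - y - z)%R))%E.
  move=> r0 r'0; rewrite /cube_avg ge0_integralZl_EFin//; last exact: e0.
  by move=> y _; exact: integral_ge0.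
have T : (\int[mu]_(y in cube 0 l) \int[mu]_(z in cube 0 l') V (x - y - z)%R =
    \int[mu]_(z in cube 0 l') \int[mu]_(y in cube 0 l) V (x - z - y)%R)%E.
  transitivity (\int[mu]_(z in cube 0 l') \int[mu]_(y in cube 0 l) V (x - y - z)%R)%E.
    apply: (@tonelli_on2 _ _ _ _ _ mu mu (cube 0 l) (cube 0 l')
      (fun p : 'rV[R]_n * 'rV[R]_n => V (x - p.1 - p.2)%R)) => //.
    apply: (measurableT_comp mV); apply: measurable_subrV.
      by apply: measurable_subrV; [exact: measurable_cst|exact: measurable_fst].
    exact: measurable_snd.
  by apply: eq_integral => z _; apply: eq_integral => y _; rewrite addrAC.
by rewrite (E l l')// (E l' l)// T muleCA.
Qed.

(** After the two averages are exchanged, the inner one is bounded by [M l'^(-2s)], and averaging a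
    bounded function preserves its bound. *)
Lemma morrey_avg M s l V : 0 < l -> morrey M s V -> morrey M s (cube_avg l V).
Proof.
move=> l0 [mV V0 VM]; split.
- exact: measurable_cube_avg.
- by move=> x; apply: cube_avg_ge0 => //; exact: ltW.
- move=> l' x l'0; rewrite cube_avgC//.
  apply: cube_avg_le => //.
  + exact: measurable_cube_avg.
  + by move=> y; apply: cube_avg_ge0 => //; exact: ltW.
  + by move=> y; exact: VM.
Qed.

Lemma morreyW M M' s V : M <= M' -> morrey M s V -> morrey M' s V.
Proof.
move=> MM [mV V0 VM]; split => // l x l0; apply: (le_trans (VM l x l0)).
by rewrite lee_fin ler_wpM2r// powR_ge0.
Qed.

Lemma morrey_min M s V (B : R) : 0 <= B -> morrey M s V ->
  morrey M s (fun x => mine (V x) B%:E).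
Proof.
move=> B0 [mV V0 VM]; split.
- by apply: measurable_mine => //; exact: measurable_cst.
- by move=> x; rewrite le_min V0.
- move=> l x l0; apply: (le_trans _ (VM l x l0)).
  rewrite lee_wpmul2l//; first by rewrite lee_fin invr_ge0 exprn_ge0// mulrn_wge0// ltW.
  apply: ge0_le_integral => //.
  + exact: measurable_cube.
  + by move=> y _; rewrite le_min V0.
  + apply: measurable_funTS.
    apply: (@measurable_sub_cst (fun x => mine (V x) B%:E)).
    by apply: measurable_mine => //; exact: measurable_cst.
  + by apply: measurable_funTS; exact: measurable_sub_cst.
  + by move=> y _; rewrite ge_min lexx.
Qed.

(** * The form of a Morrey potential under an L^2 translation bound *)

Section form_bound.
Variables (psi : 'rV[R]_n -> R) (F2 Gamma : R).
Hypotheses (mpsi : measurable_fun setT psi) (Gamma0 : 0 <= Gamma).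
Hypothesis psi2 : (\int[mu]_x (psi x ^+ 2)%:E = F2%:E)%E.
Hypothesis psi_trans : forall l (y : 'rV[R]_n), 0 < l -> cube 0 l y ->
  (\int[mu]_x ((psi (x + y)%R - psi x) ^+ 2)%:E <= (l ^+ 2 * Gamma)%:E)%E.

Local Notation Q V := (\int[mu]_x ((psi x ^+ 2)%:E * V x))%E.

Let mpsi2 : measurable_fun setT (fun x => (psi x ^+ 2)%:E).
Proof. by apply/measurable_EFinP; exact: measurable_funX. Qed.

Let mpsiV V : measurable_fun setT V ->
  measurable_fun setT (fun x => (psi x ^+ 2)%:E * V x)%E.
Proof. by move=> mV; exact: emeasurable_funM. Qed.

Let psi20 x : (0 <= (psi x ^+ 2)%:E)%E. Proof. by rewrite lee_fin sqr_ge0. Qed.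

Lemma form_bounded V B : measurable_fun setT V -> (forall x, 0 <= V x <= B%:E)%E ->
  (0 <= Q V <= (B * F2)%:E)%E.
Proof.
move=> mV VB; apply/andP; split.
  by apply: integral_ge0 => x _; rewrite mule_ge0//; have /andP[] := VB x.
have B0 : 0 <= B by have /andP[] := VB 0; rewrite -lee_fin; exact: le_trans.
rewrite EFinM -psi2 -ge0_integralZl_EFin//.
apply: ge0_le_integral => //.
- by move=> x _; rewrite mule_ge0//; have /andP[] := VB x.
- exact: mpsiV.
- by apply: emeasurable_funM.
- by move=> x _; rewrite muleC lee_wpmul2r//; have /andP[] := VB x.
Qed.

(** By Tonelli and the substitution x -> x + y, averaging V amounts to averaging the form over
    translates of psi. *)
Lemma form_cube_avg l V : 0 < l -> measurable_fun setT V ->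
  (forall x, 0 <= V x)%E ->
  Q (cube_avg l V) = (((l *+ 2) ^+ n)^-1%:E *
    \int[mu]_(y in cube 0 l) \int[mu]_x ((psi (x + y)%R ^+ 2)%:E * V x))%E.
Proof.
move=> l0 mV V0.
have c0 : 0 <= ((l *+ 2) ^+ n)^-1 :> R.
  by rewrite invr_ge0 exprn_ge0// mulrn_wge0// ltW.
have mk : measurable_fun setT (fun z : 'rV[R]_n * 'rV[R]_n =>
    (psi z.1 ^+ 2)%:E * V (z.1 - z.2)%R)%E.
  apply: emeasurable_funM; last exact: measurable_sub_pair.
  exact: (measurableT_comp mpsi2 measurable_fst).
have mc : measurable (cube (0 : 'rV[R]_n) l) by exact: measurable_cube.
transitivity (((l *+ 2) ^+ n)^-1%:E * \int[mu]_x \int[mu]_(y in cube 0 l)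
    ((psi x ^+ 2)%:E * V (x - y)%R))%E.
  rewrite -ge0_integralZl_EFin//.
  - apply: eq_integral => x _; rewrite /cube_avg muleCA ge0_integralZl_EFin//.
      by apply: measurable_funTS; exact: measurable_sub_cst.
    exact: sqr_ge0.
  - by move=> x _; apply: integral_ge0 => y _; rewrite mule_ge0.
  - exact: (@measurable_integral_on _ _ _ _ _ mu _ mc _ mk
      (fun z => mule_ge0 (psi20 _) (V0 _))).
apply: (congr1 (mule _)).
rewrite (@tonelli_on _ _ _ _ _ mu mu _ mc _ mk
      (fun z => mule_ge0 (psi20 _) (V0 _))).
apply: eq_integral => y _ /=.
rewrite -(ge0_integral_translation y)/=.
- by apply: eq_integral => x _; rewrite addrK.
- apply: emeasurable_funM => //; exact: measurable_shift.
- by move=> x; rewrite mule_ge0.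
Qed.

(** For each y in [cube 0 l], Young's inequality bounds [psi x ^+ 2] by [psi (x + y) ^+ 2] and the
    squared difference. On the difference V is replaced by its bound B, so that the translation
    estimate applies; the mean over y then turns the first term into the form of the average. *)
Lemma form_step l V B delta : 0 < l -> 0 < delta -> measurable_fun setT V ->
  (forall x, 0 <= V x <= B%:E)%E ->
  (Q V <= (1 + delta)%:E * Q (cube_avg l V) +
          ((1 + delta^-1) * (B * (l ^+ 2 * Gamma)))%:E)%E.
Proof.
move=> l0 d0 mV VB.
have V0 x : (0 <= V x)%E by have /andP[] := VB x.
have VleB x : (V x <= B%:E)%E by have /andP[] := VB x.
have B0 : 0 <= B by rewrite -lee_fin; exact: le_trans (V0 0) (VleB 0).
have mc : measurable (cube (0 : 'rV[R]_n) l) by exact: measurable_cube.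
have c0 : 0 < (l *+ 2) ^+ n by rewrite exprn_gt0// mulrn_wgt0.
have ci0 : 0 <= ((l *+ 2) ^+ n)^-1 by rewrite invr_ge0 ltW.
have d1 : 0 <= 1 + delta by rewrite addr_ge0// ltW.
have d2 : 0 <= 1 + delta^-1 by rewrite addr_ge0// invr_ge0 ltW.
set K := (1 + delta^-1) * _.
have mshift y : measurable_fun setT (fun x : 'rV[R]_n => psi (x + y)%R).
  apply: (measurableT_comp mpsi); apply: measurable_addrV => //.
(* Constants are written as their own means over the cube, which reduces the claim to a comparison
   of integrands in y. *)
have avg_cst (k : R) : (k%:E = ((l *+ 2) ^+ n)^-1%:E *
    \int[mu]_(y in cube (0 : 'rV[R]_n) l) (cst k%:E) y)%E.
  transitivity (((l *+ 2) ^+ n)^-1%:E * (k%:E * ((l *+ 2) ^+ n)%:E))%E.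
    by rewrite -!EFinM mulrCA mulVf ?mulr1 ?gt_eqF.
  apply: (congr1 (mule _)).
  by rewrite -(lebesgue_cube (0 : 'rV[R]_n) (ltW l0)) -integral_cst.
have [q qE] : exists q, Q V = q%:E.
  have /andP[h1 h2] := form_bounded mV VB.
  exists (fine (Q V)); rewrite fineK// ge0_fin_numE//.
  exact: le_lt_trans h2 (ltry _).
have mI : measurable_fun (cube (0 : 'rV[R]_n) l)
    (fun y => \int[mu]_x ((psi (x + y)%R ^+ 2)%:E * V x))%E.
  apply: measurable_funTS.
  apply: (measurable_fun_fubini_tonelli_G (m1 := mu)
    (fun z : 'rV[R]_n * 'rV[R]_n => (psi (z.1 + z.2)%R ^+ 2)%:E * V z.1)%E).
    apply: emeasurable_funM; last exact: (measurableT_comp mV measurable_fst).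
    apply: (measurableT_comp mpsi2).
    by apply: measurable_addrV; [exact: measurable_fst|exact: measurable_snd].
  by move=> z; rewrite mule_ge0.
have I0 y : (0 <= \int[mu]_x ((psi (x + y)%R ^+ 2)%:E * V x))%E.
  by apply: integral_ge0 => x _; rewrite mule_ge0.
have main y : cube 0 l y -> (Q V <=
    (1 + delta)%:E * \int[mu]_x ((psi (x + y)%R ^+ 2)%:E * V x) + K%:E)%E.
  move=> yl.
  apply: (@le_trans _ _ (\int[mu]_x ((1 + delta)%:E *
       ((psi (x + y)%R ^+ 2)%:E * V x) +
       ((1 + delta^-1) * B)%:E * ((psi (x + y)%R - psi x) ^+ 2)%:E)))%E.
    have m1 : measurable_fun setT (fun x : 'rV[R]_n =>
        (1 + delta)%:E * ((psi (x + y)%R ^+ 2)%:E * V x))%E.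
      apply: emeasurable_funM => //; apply: emeasurable_funM => //.
      by apply/measurable_EFinP; apply: measurable_funX.
    have m2 : measurable_fun setT (fun x : 'rV[R]_n =>
        ((1 + delta^-1) * B)%:E * ((psi (x + y)%R - psi x) ^+ 2)%:E)%E.
      apply: emeasurable_funM => //; apply/measurable_EFinP.
      by apply: measurable_funX; apply: measurable_funB.
    apply: ge0_le_integral => //.
    - by move=> x _; rewrite mule_ge0.
    - exact: mpsiV.
    - exact: emeasurable_funD.
    - move=> x _.
      have [r rE] : exists r, V x = r%:E.
        exists (fine (V x)); rewrite fineK// ge0_fin_numE//.
        exact: le_lt_trans (VleB x) (ltry _).
      have := V0 x; have := VleB x; rewrite rE !lee_fin => rB r0.
      suff : psi x ^+ 2 * r <= (1 + delta) * (psi (x + y) ^+ 2 * r) +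
        (1 + delta^-1) * B * (psi (x + y) - psi x) ^+ 2 by exact.
      apply: (@le_trans _ _ (((1 + delta) * psi (x + y) ^+ 2 +
         (1 + delta^-1) * (psi (x + y) - psi x) ^+ 2) * r)).
        by rewrite ler_wpM2r//; exact: sqr_le_young.
      rewrite mulrDl -mulrA lerD2l mulrAC ler_wpM2r ?sqr_ge0//.
      by rewrite ler_wpM2l.
  rewrite ge0_integralD//.
  - rewrite leeD//.
      rewrite ge0_integralZl_EFin//.
      - by move=> x _; rewrite mule_ge0.
      - apply: emeasurable_funM => //.
        by apply/measurable_EFinP; apply: measurable_funX.
    rewrite ge0_integralZl_EFin//.
    + have -> : (K%:E = ((1 + delta^-1) * B)%:E * (l ^+ 2 * Gamma)%:E)%E.
        by rewrite -EFinM -mulrA.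
      apply: lee_wpmul2l; first by rewrite lee_fin mulr_ge0.
      exact: psi_trans.
    + by move=> x _; rewrite lee_fin sqr_ge0.
    + apply/measurable_EFinP.
      by apply: measurable_funX; apply: measurable_funB.
    + by rewrite mulr_ge0.
  - by move=> x _; rewrite mule_ge0// mule_ge0.
  - apply: emeasurable_funM => //; apply: emeasurable_funM => //.
    by apply/measurable_EFinP; apply: measurable_funX.
  - by move=> x _; apply: mule_ge0; rewrite lee_fin ?sqr_ge0// mulr_ge0.
  - apply: emeasurable_funM => //; apply/measurable_EFinP.
    by apply: measurable_funX; apply: measurable_funB.
rewrite form_cube_avg// [leLHS]qE (avg_cst q) (avg_cst K).
rewrite muleCA -ge0_muleDr; last 2 first.
- by rewrite mule_ge0// integral_ge0.
- apply: integral_ge0 => y _; rewrite lee_fin /K mulr_ge0// mulr_ge0// mulr_ge0//.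
  exact: sqr_ge0.
rewrite lee_wpmul2l// -ge0_integralZl_EFin// -ge0_integralD//.
- apply: ge0_le_integral => //.
  + by move=> y _; have /andP[] := form_bounded mV VB; rewrite qE.
  + apply: emeasurable_funD => //; exact: emeasurable_funM.
  + by move=> y /main; rewrite qE.
- by move=> y _; rewrite mule_ge0.
- exact: emeasurable_funM.
- move=> y _; rewrite lee_fin /K mulr_ge0// mulr_ge0// mulr_ge0//.
  exact: sqr_ge0.
Qed.

Local Notation N V := (Num.sqrt (fine (Q V))).

(** The infimum over delta in [form_step]. In this form successive errors add, with no factor
    accumulating on the main term. *)
Lemma form_sqrt_step l V B : 0 < l -> measurable_fun setT V ->
  (forall x, 0 <= V x <= B%:E)%E ->
  N V <= N (cube_avg l V) + l * Num.sqrt (B * Gamma).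
Proof.
move=> l0 mV VB.
have V0 x : (0 <= V x)%E by have /andP[] := VB x.
have VleB x : (V x <= B%:E)%E by have /andP[] := VB x.
have B0 : 0 <= B by rewrite -lee_fin; exact: le_trans (V0 0) (VleB 0).
have mA := measurable_cube_avg l mV V0.
have AB x : (0 <= cube_avg l V x <= B%:E)%E.
  by rewrite cube_avg_ge0 ?(ltW l0)//=; exact: cube_avg_le.
have finQ W : measurable_fun setT W -> (forall x, 0 <= W x <= B%:E)%E ->
    Q W \is a fin_num.
  move=> mW WB; have /andP[h1 h2] := form_bounded mW WB.
  by rewrite ge0_fin_numE//; exact: le_lt_trans h2 (ltry _).
rewrite (_ : l * _ = Num.sqrt (B * (l ^+ 2 * Gamma))); last first.
  by rewrite mulrCA [in RHS]sqrtrM ?sqr_ge0// sqrtr_sqr gtr0_norm.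
apply: sqrt_le_add.
- by apply: fine_ge0; have /andP[] := form_bounded mV VB.
- by apply: fine_ge0; have /andP[] := form_bounded mA AB.
- by rewrite mulr_ge0// mulr_ge0// sqr_ge0.
- move=> delta d0; have := form_step l0 d0 mV VB.
  rewrite -{1}(fineK (finQ _ mV VB)) -{1}(fineK (finQ _ mA AB)).
  by rewrite -EFinM -EFinD lee_fin.
Qed.

(** The error at scale x is proportional to [x^(1-s)], so halving the scale multiplies it by
    [rho s], which is below 1 because s < 1. *)
Let rho s : R := 2 `^ (- (1 - s)).

(* V is averaged successively at the scales l / 2^(k-1), ..., l / 2, l; after the
   average at scale r it is bounded by M r^(-2s). *)
Lemma form_iter M s l k V : 0 <= M -> 0 < s < 1 -> 0 < l -> morrey M s V ->
  (forall x, V x <= (M * (l / 2 ^+ k) `^ (- (2 * s)))%:E)%E ->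
  N V <= Num.sqrt M * (l `^ (- s) * Num.sqrt F2 +
    Num.sqrt Gamma * l `^ (1 - s) * 2 `^ s * \sum_(j < k) rho s ^+ j).
Proof.
move=> M0 /andP[s0 s1] l0.
have sq2 x : 0 < x -> x `^ (- (2 * s)) = (x `^ (- s)) ^+ 2.
  by move=> x0; rewrite -mulrN mulrC powRrM powR_mulrn ?powR_ge0.
elim: k V => [|k IH] V [mV V0 VM] VB.
  rewrite big_ord0 mulr0 addr0.
  have /andP[h1 h2] := form_bounded mV (fun x => introT andP (conj (V0 x) (VB x))).
  apply: (@le_trans _ _ (Num.sqrt (M * (l `^ (- (2 * s))) * F2))).
    apply: ler_wsqrtr; rewrite -lee_fin fineK.
      by apply: (le_trans h2); rewrite expr0 divr1.
    by rewrite ge0_fin_numE//; exact: le_lt_trans h2 (ltry _).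
  rewrite sq2// -mulrA sqrtrM// sqrtrM ?sqr_ge0// sqrtr_sqr ger0_norm//.
  exact: powR_ge0.
set x := l / 2 ^+ k.
have x0 : 0 < x by rewrite divr_gt0// exprn_gt0.
have xS : l / 2 ^+ k.+1 = x / 2 by rewrite exprS invfM mulrCA mulrC.
have VB' y : (0 <= V y <= (M * (x / 2) `^ (- (2 * s)))%:E)%E by rewrite V0 -xS VB.
(* V is bounded at scale x / 2, which fixes the error [x sqrt (M (x/2)^(-2s) Gamma)]. Its average at
   scale x satisfies the Morrey bound at x pointwise, as the induction hypothesis requires. *)
apply: (le_trans (form_sqrt_step x0 mV VB')).
have HA : morrey M s (cube_avg x V) by apply: morrey_avg.
apply: (le_trans (lerD (IH _ HA _) (lexx _))).
  by move=> y; exact: VM.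
rewrite big_ord_recr/= [X in _ <= _ * (_ + X)]mulrDr addrA [leRHS]mulrDr lerD2l.
rewrite sq2 ?divr_gt0//.
rewrite -[M * _ * Gamma]mulrA (sqrtrM _ M0) sqrtrM ?sqr_ge0// sqrtr_sqr ger0_norm ?powR_ge0//.
have -> : (x / 2) `^ (- s) = x `^ (- s) * 2 `^ s.
  by rewrite powRM ?(ltW x0)// -[2^-1]powR_inv1// -powRrM mulrNN mul1r.
have -> : rho s ^+ k = x `^ (1 - s) / l `^ (1 - s).
  rewrite /x powRM ?(ltW l0) ?invr_ge0 ?exprn_ge0//.
  rewrite mulrAC mulfV ?mul1r; last by rewrite gt_eqF// powR_gt0.
  rewrite /rho -powR_mulrn ?powR_ge0// -powRrM -powR_inv1 ?exprn_ge0//.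
  by rewrite -powR_mulrn// -!powRrM; congr (_ `^ _); ring.
have -> : x `^ (1 - s) = x * x `^ (- s).
  rewrite powRD; first by rewrite powRr1 // ltW.
  by apply/implyP => _; rewrite gt_eqF.
have ln0 : l `^ (1 - s) != 0 by rewrite gt_eqF// powR_gt0.
rewrite le_eqVlt; apply/orP; left; apply/eqP.
by field.
Qed.

(** Since s > 0, B lies below [M (l / 2^k)^(-2s)] for large k and the iteration starts there.
    Bounding the partial geometric sum by [1 / (1 - rho s)] makes the result independent of k, hence
    of B. The leading 2 comes from [(a + b)^2 <= 2 (a^2 + b^2)]. *)
Lemma form_morrey_bounded M s l V B : 0 < M -> 0 < s < 1 -> 0 < l ->
  morrey M s V -> (forall x, V x <= B%:E)%E ->
  (Q V <= (2 * (1 + 2 `^ s / (1 - rho s)) ^+ 2 * M *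
    (l `^ (- (2 * s)) * F2 + l `^ (2 - 2 * s) * Gamma))%:E)%E.
Proof.
move=> M0 /[dup] s01 /andP[s0 s1] l0 HV VB; have [mV V0 VM] := HV.
have rho1 : rho s < 1.
  by rewrite /rho powRN invf_lt1 ?powR_gt0// powR2_gt1// subr_gt0.
have rho0 : 0 <= rho s by exact: powR_ge0.
have F20 : 0 <= F2.
  by rewrite -lee_fin -psi2; apply: integral_ge0 => x _; rewrite lee_fin sqr_ge0.
have [k Hk] : exists k, B <= M * (l / 2 ^+ k) `^ (- (2 * s)).
  have r1 : 1 < 2 `^ (2 * s) :> R.
    by rewrite powR2_gt1// mulr_gt0.
  have [k Hk] := exists_le_expr (B / (M * l `^ (- (2 * s)))) r1.
  exists k; move: Hk; rewrite ler_pdivrMr; last by rewrite mulr_gt0// powR_gt0.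
  move=> /le_trans; apply; rewrite powRM ?(ltW l0) ?invr_ge0 ?exprn_ge0//.
  rewrite mulrC -mulrA ler_wpM2l ?(ltW M0)// ler_wpM2l ?powR_ge0//.
  rewrite -powR_mulrn ?powR_ge0// -powRrM -powR_inv1 ?exprn_ge0//.
  rewrite -powR_mulrn// -!powRrM le_eqVlt; apply/orP; left; apply/eqP.
  by congr (_ `^ _); ring.
have VB' x : (V x <= (M * (l / 2 ^+ k) `^ (- (2 * s)))%:E)%E.
  by apply: (le_trans (VB x)); rewrite lee_fin.
have := form_iter (ltW M0) s01 l0 HV VB'.
have sumle : \sum_(j < k) rho s ^+ j <= (1 - rho s)^-1.
  by rewrite -(big_mkord xpredT) geometric_partial_le// rho0.
have finQ : Q V \is a fin_num.
  have /andP[h1 h2] := form_bounded mV (fun x => introT andP (conj (V0 x) (VB x))).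
  by rewrite ge0_fin_numE//; exact: le_lt_trans h2 (ltry _).
have Q0 : 0 <= fine (Q V).
  apply: fine_ge0; apply: integral_ge0 => x _; rewrite mule_ge0//.
rewrite -(fineK finQ) lee_fin => H.
rewrite -[leLHS](sqr_sqrtr Q0).
set K := 2 `^ s / (1 - rho s).
have K0 : 0 <= K by rewrite divr_ge0 ?powR_ge0// subr_ge0 ltW.
pose a := l `^ (- s) * Num.sqrt F2; pose b := l `^ (1 - s) * Num.sqrt Gamma.
have a0 : 0 <= a by rewrite mulr_ge0 ?powR_ge0 ?sqrtr_ge0.
have b0 : 0 <= b by rewrite mulr_ge0 ?powR_ge0 ?sqrtr_ge0.
have HN : N V <= Num.sqrt M * ((1 + K) * (a + b)).
  apply: (le_trans H); rewrite ler_wpM2l ?sqrtr_ge0//.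
  apply: (@le_trans _ _ (a + b * K)).
    rewrite lerD2l /b /K mulrA (mulrC (Num.sqrt Gamma)) ler_wpM2l//.
    by rewrite mulr_ge0 ?powR_ge0// mulr_ge0 ?powR_ge0 ?sqrtr_ge0.
  nra.
have /(_ _ _) := lerXn2r 2 _ _ HN.
rewrite !nnegrE sqrtr_ge0 !mulr_ge0 ?sqrtr_ge0 ?addr_ge0// => /(_ isT isT) /le_trans; apply.
rewrite !exprMn sqr_sqrtr ?(ltW M0)//.
have -> : l `^ (- (2 * s)) * F2 = a ^+ 2.
  rewrite exprMn sqr_sqrtr// -powR_mulrn ?powR_ge0// -powRrM.
  by congr (_ `^ _ * _); lra.
have -> : l `^ (2 - 2 * s) * Gamma = b ^+ 2.
  rewrite exprMn sqr_sqrtr// -powR_mulrn ?powR_ge0// -powRrM.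
  by congr (_ `^ _ * _); lra.
have h : (a + b) ^+ 2 <= 2 * (a ^+ 2 + b ^+ 2).
  by rewrite -subr_ge0 (_ : _ - _ = (a - b) ^+ 2) ?sqr_ge0//; ring.
rewrite [leRHS](_ : _ = M * ((1 + K) ^+ 2 * (2 * (a ^+ 2 + b ^+ 2)))); last ring.
by rewrite ler_wpM2l ?(ltW M0)// ler_wpM2l// sqr_ge0.
Qed.

(** The truncations [mine (V x) k] inherit the Morrey bound and increase to V, and their bounds do
    not involve k. *)
Lemma form_morrey M s l V : 0 <= M -> 0 < s < 1 -> 0 < l -> morrey M s V ->
  (Q V <= (2 * (1 + 2 `^ s / (1 - rho s)) ^+ 2 * M *
    (l `^ (- (2 * s)) * F2 + l `^ (2 - 2 * s) * Gamma))%:E)%E.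
Proof.
move=> M0 s01 l0 HV; have [mV V0 VM] := HV.
set C := 2 * _ ^+ 2; set Y := _ + _.
have F20 : 0 <= F2.
  by rewrite -lee_fin -psi2; apply: integral_ge0 => x _; rewrite lee_fin sqr_ge0.
have CY0 : 0 <= C * Y.
  apply: mulr_ge0; first by rewrite mulr_ge0// sqr_ge0.
  by apply: addr_ge0; apply: mulr_ge0 => //; exact: powR_ge0.
apply/lee_addgt0Pr => e e0.
(* M may vanish, while the bounded case asks for a positive constant. This enlargement raises the
   bound by [e C Y / (C Y + 1)], at most e. *)
pose M' := M + e / (C * Y + 1).
have e1 : 0 < e / (C * Y + 1) by rewrite divr_gt0// ltr_wpDl.
have MM' : M <= M' by rewrite lerDl ltW.
have M'0 : 0 < M' by rewrite ltr_wpDl.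
have bndn (k : nat) : (Q (fun x => mine (V x) k%:R%:E) <= (C * M' * Y)%:E)%E.
  apply: (form_morrey_bounded (B := k%:R)) => //.
    by apply: morrey_min => //; exact: morreyW HV.
  by move=> x; rewrite ge_min lexx orbT.
apply: (@le_trans _ _ (C * M' * Y)%:E); last first.
  suff : C * M' * Y <= C * M * Y + e by exact.
  have -> : C * M' * Y = C * M * Y + e * (C * Y) / (C * Y + 1).
    by rewrite /M'; move: C Y CY0 {e1 M' MM' M'0 bndn} => C Y _; ring.
  rewrite lerD2l.
  by rewrite ler_pdivrMr ?ltr_wpDl// ler_wpM2l ?(ltW e0)// lerDl.
pose g (k : nat) x := ((psi x ^+ 2)%:E * mine (V x) k%:R%:E)%E.
have limg x : limn (g ^~ x) = ((psi x ^+ 2)%:E * V x)%E.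
  apply/cvg_lim => //; apply: cvgeZl => //.
  have := V0 x; case: (V x) => [r|_|//].
    rewrite lee_fin => r0; apply: cvg_near_cst.
    exists (truncn r).+1 => // k /= kr; apply: min_l; rewrite lee_fin.
    by apply/ltW/(lt_le_trans (truncnS_gt r)); rewrite ler_nat.
  under eq_fun do rewrite min_r ?leey//.
  exact/cvgeryP/cvgr_idn.
under eq_integral => x _ do rewrite -limg.
have mg k : measurable_fun setT (g k).
  by apply: mpsiV; apply: measurable_mine.
rewrite monotone_convergence//.
- apply: lime_le; last by apply: nearW => k; exact: bndn.
  apply: ereal_nondecreasing_is_cvgn => i j ij; apply: ge0_le_integral => //.
  + by move=> x _; apply: mule_ge0 => //; rewrite le_min V0/= lee_fin ler0n.
  + move=> x _; rewrite lee_wpmul2l// le_min ge_min lexx/=.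
    by rewrite ge_min lee_fin ler_nat ij orbT.
- by move=> k x _; apply: mule_ge0 => //; rewrite le_min V0/= lee_fin ler0n.
- move=> x _ i j ij; rewrite lee_wpmul2l// le_min ge_min lexx/=.
  by rewrite ge_min lee_fin ler_nat ij orbT.
Qed.

End form_bound.

End morrey.

(** * Bumps and Steklov averages on the line *)

Section smooth_line.
Context {R : realType}.
Implicit Types (f g : R -> R) (x a b : R) (p : {poly R}).

Lemma is_derive_comp1 f g x (df dg : R) : is_derive x 1 f df ->
  is_derive (f x) 1 g dg -> is_derive x 1 (g \o f) (dg * df).
Proof.
move=> [f1 fE] [g1 gE].
have d1 : derivable (g \o f) x 1.
  by apply/derivable1_diffP/differentiable_comp; exact/derivable1_diffP.
by apply: DeriveDef => //; rewrite -derive1E derive1_comp// !derive1E fE gE.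
Qed.

(** k-fold differentiability, with no continuity imposed on the last derivative; quantifying over
    all k in [smooth1] supplies it. *)
Fixpoint Ck k f : Prop :=
  if k is k'.+1 then (forall x, derivable f x 1) /\ Ck k' (derive1 f) else True.

Definition smooth1 f := forall k, Ck k f.

Lemma Ck_is_derive k f g : (forall x, is_derive x 1 f (g x)) -> Ck k g ->
  Ck k.+1 f.
Proof.
move=> fg Ckg; split=> [x|]; first by have [] := fg x.
suff -> : derive1 f = g by [].
by apply/funext => x; rewrite derive1E; have [] := fg x.
Qed.

Lemma Ck_derive k f : Ck k.+1 f -> forall x, is_derive x 1 f (derive1 f x).
Proof. by move=> [fd _] x; rewrite derive1E; exact: derivableP. Qed.

Lemma Ck_pred k f : Ck k.+1 f -> Ck k f.
Proof.
elim: k f => [//|k IH] f H; have fd := Ck_derive H; exact: (Ck_is_derive fd (IH _ H.2)).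
Qed.

Lemma Ck_cst k (c : R) : Ck k (cst c).
Proof.
elim: k c => [//|k IH] c.
exact: (Ck_is_derive (fun x => is_derive_cst c x 1) (IH 0)).
Qed.

Lemma CkD k f g : Ck k f -> Ck k g -> Ck k (fun x => f x + g x).
Proof.
elim: k f g => [//|k IH] f g Hf Hg.
have fd := Ck_derive Hf; have gd := Ck_derive Hg.
apply: (Ck_is_derive (fun x => is_deriveD (fd x) (gd x))).
exact: (IH _ _ Hf.2 Hg.2).
Qed.

Lemma CkM k f g : Ck k f -> Ck k g -> Ck k (fun x => f x * g x).
Proof.
elim: k f g => [//|k IH] f g Hf Hg.
have fd := Ck_derive Hf; have gd := Ck_derive Hg.
apply: (Ck_is_derive (fun x => is_deriveM (fd x) (gd x))).
apply: CkD.
  exact: (IH _ _ (Ck_pred Hf) Hg.2).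
exact: (IH _ _ (Ck_pred Hg) Hf.2).
Qed.

Lemma Ck_affine k f (c e : R) : Ck k f -> Ck k (fun x => f (c * x + e)).
Proof.
elim: k f => [//|k IH] f Hf; have fd := Ck_derive Hf.
have gd x : is_derive x 1 (fun y => c * y + e) c.
  have -> : (fun y => c * y + e) = (c \*: id) + cst e by [].
  by apply: is_derive_eq; rewrite addr0 /GRing.scale/= mulr1.
apply: (Ck_is_derive (fun x => is_derive_comp1 (gd x) (fd _))).
exact: (CkM (IH _ Hf.2) (Ck_cst _ _)).
Qed.

(* The functions p(1/x) e^(-1/x), extended by 0, are closed under derivation. *)
Definition exp_inv p x := if 0 < x then p.[x^-1] * expR (- x^-1) else 0.

(** Coefficient by coefficient, [t^i e^(-t) <= i!], from the exponential series. *)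
Lemma horner_expRN_bounded p : exists2 C, 0 <= C &
  forall t, 0 <= t -> `|p.[t] * expR (- t)| <= C.
Proof.
exists (\sum_(i < size p) `|p`_i| * i`!%:R).
  by apply: sumr_ge0 => i _; rewrite mulr_ge0.
move=> t t0; rewrite horner_coef mulr_suml; apply: (le_trans (ler_norm_sum _ _ _)).
apply: ler_sum => i _; rewrite -mulrA normrM ler_wpM2l//.
rewrite ger0_norm ?mulr_ge0 ?exprn_ge0 ?expR_ge0// expRN ler_pdivrMr ?expR_gt0//.
case: (i : nat) => [|k].
  by rewrite expr0 mul1r -[leLHS]expR0 ler_expR.
rewrite mulrC -ler_pdivrMr ?ltr0n ?fact_gt0//.
by apply: le_trans (expR_ge1Dxn k t0); rewrite lerDr.
Qed.

(** The preceding bound for ['X^2 * p] at t = 1/x. Vanishing to second order at 0 makes the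
    difference quotient there tend to 0, whatever p is. *)
Lemma exp_inv_le_sqr p : exists2 C, 0 <= C &
  forall x, `|exp_inv p x| <= C * x ^+ 2.
Proof.
have [C C0 HC] := horner_expRN_bounded ('X^2 * p).
exists C => // x; rewrite /exp_inv; case: ifPn => [x0|_]; last first.
  by rewrite normr0 mulr_ge0// sqr_ge0.
have xi0 : 0 <= x^-1 by rewrite invr_ge0 ltW.
have := HC _ xi0; rewrite hornerM hornerXn -mulrA normrM.
rewrite ger0_norm ?exprn_ge0// exprVn mulrC ler_pdivrMr// exprn_gt0//.
Qed.

(** For x > 0 the chain rule gives [x^(-2) (p - p')(1/x) e^(-1/x)], and [x^(-2)] is the factor
    ['X^2] evaluated at 1/x. At 0 the quadratic bound gives derivative 0. *)
Lemma is_derive_exp_inv p x :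
  is_derive x 1 (exp_inv p) (exp_inv ('X^2 * (p - p^`())) x).
Proof.
have [x0|x0|<-] := ltgtP 0 x.
- have nE : \near x, p.[x^-1] * expR (- x^-1) = exp_inv p x.
    near=> y; rewrite /exp_inv ifT//; near: y; exact: lt_nbhsr.
  have dV : is_derive x 1 (@GRing.inv R) (- x ^- 2).
    have xn0 : x != 0 by rewrite gt_eqF.
    apply: DeriveDef; first exact: (derivableV (f := id)).
    by rewrite (deriveV (f := id))// derive_id /GRing.scale/= mulr1.
  have d1 := is_derive_comp1 dV (is_derive_poly p _).
  have d2 := is_derive_comp1 dV (@is_deriveNid _ _ (x^-1) 1).
  have d3 := is_derive_comp1 d2 (is_derive_expR _).
  rewrite /exp_inv x0.
  apply: is_derive_eq (near_eq_is_derive nE (is_deriveM d1 d3)) _.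
  rewrite /= /GRing.scale/= hornerM hornerXn hornerD hornerN exprVn.
  ring.
- have nE : \near x, cst 0 x = exp_inv p x.
    near=> y; rewrite /exp_inv ifF//; apply/negbTE; rewrite -leNgt.
    by apply/ltW; near: y; exact: lt_nbhsl.
  rewrite [X in is_derive _ _ _ X]/exp_inv ltNge (ltW x0)/=.
  exact: near_eq_is_derive nE (is_derive_cst _ _ _).
- rewrite {2}/exp_inv ltxx.
  have [C C0 HC] := exp_inv_le_sqr p.
  have H : (fun h => h^-1 *: (exp_inv p (h *: 1 + 0) - exp_inv p 0)) @ 0^' --> (0 : R).
    apply/cvgrPdist_lt => e e0; near=> h.
    rewrite sub0r normrN [X in _ - X]/exp_inv ltxx subr0 addr0.
    have h0 : h != 0 by near: h; exact: nbhs_dnbhs_neq.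
    rewrite [h *: 1]mulr1 normrM normfV mulrC ltr_pdivrMr ?normr_gt0//.
    apply: (le_lt_trans (HC h)).
    have -> : h ^+ 2 = `|h| * `|h| by rewrite -normrM -expr2 ger0_norm ?sqr_ge0.
    rewrite mulrA ltr_pM2r ?normr_gt0//.
    apply: (@le_lt_trans _ _ ((C + 1) * `|h|)).
      by rewrite ler_wpM2r// lerDl.
    rewrite mulrC -ltr_pdivlMr ?ltr_wpDl//.
    near: h; apply: dnbhs0_lt; rewrite divr_gt0// ltr_wpDl//.
  apply: DeriveDef.
    by apply/cvg_ex; exists 0.
  exact/cvg_lim.
Unshelve. all: by end_near.
Qed.

Lemma Ck_exp_inv k p : Ck k (exp_inv p).
Proof.
elim: k p => [//|k IH] p.
exact: (Ck_is_derive (is_derive_exp_inv p) (IH _)).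
Qed.

Lemma smooth1_derive1 f : smooth1 f -> smooth1 (derive1 f).
Proof. by move=> fs k; have [] := fs k.+1. Qed.

Lemma smooth1_is_derive f : smooth1 f -> forall x, is_derive x 1 f (derive1 f x).
Proof. by move=> fs; exact: (@Ck_derive 0). Qed.

Lemma smooth1_continuous f : smooth1 f -> continuous f.
Proof.
move=> fs x; have [fd _] := smooth1_is_derive fs x.
exact/differentiable_continuous/derivable1_diffP.
Qed.

Lemma smooth1_of_derive f g : (forall x, is_derive x 1 f (g x)) -> smooth1 g ->
  smooth1 f.
Proof. by move=> fg gs [//|k]; exact: (Ck_is_derive fg (gs k)). Qed.

(** The factor [m.+1] sharpens the edges: the function vanishes outside ]a, b[ for every m, while
    [exp (- 1 / ((m+1) c))] tends to 1 for each c > 0, so the limit is the indicator of ]a, b[. *)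
Definition sbump (m : nat) a b x : R :=
  exp_inv 1 (m.+1%:R * (x - a)) * exp_inv 1 (m.+1%:R * (b - x)).

Lemma smooth1_sbump m a b : smooth1 (sbump m a b).
Proof.
move=> k; apply: CkM.
  rewrite (_ : (fun _ => _) = fun x => exp_inv 1 (m.+1%:R * x + - (m.+1%:R * a))).
    exact: (Ck_affine _ _ (Ck_exp_inv k 1)).
  by apply/funext => x; rewrite mulrBr.
rewrite (_ : (fun _ => _) = fun x => exp_inv 1 (- m.+1%:R * x + (m.+1%:R * b))).
  exact: (Ck_affine _ _ (Ck_exp_inv k 1)).
by apply/funext => x; rewrite mulrBr mulNr addrC.
Qed.

Lemma exp_inv1_itv x : 0 <= exp_inv 1 x <= 1.
Proof.
rewrite /exp_inv; case: ifPn => [x0|_]; last by rewrite lexx ler01.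
by rewrite hornerC mul1r expR_ge0/= -[leRHS]expR0 ler_expR oppr_le0 invr_ge0 ltW.
Qed.

Lemma sbump_itv m a b x : 0 <= sbump m a b x <= 1.
Proof.
rewrite /sbump; have /andP[h1 h2] := exp_inv1_itv (m.+1%:R * (x - a)).
have /andP[h3 h4] := exp_inv1_itv (m.+1%:R * (b - x)).
by rewrite mulr_ge0//= mulr_ile1.
Qed.

Lemma sbump_out m a b x : ~~ (a < x < b) -> sbump m a b x = 0.
Proof.
rewrite negb_and -!leNgt => /orP[xa|bx]; rewrite /sbump /exp_inv.
  by rewrite ifF ?mul0r//; apply/negbTE; rewrite -leNgt pmulr_rle0// subr_le0.
by rewrite [X in _ * X]ifF ?mulr0//; apply/negbTE; rewrite -leNgt pmulr_rle0// subr_le0.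
Qed.

Lemma cvg_expRN_inv (x : R) : expR (- (m.+1%:R * x)^-1) @[m --> \oo] --> (1 : R).
Proof.
have H : - (m.+1%:R * x)^-1 @[m --> \oo] --> (0 : R).
  under eq_fun do rewrite invfM -mulNr.
  rewrite -(mul0r x^-1); apply: cvgMl.
  by rewrite -oppr0; apply: cvgN; exact: cvg_harmonic.
have := continuous_cvg _ (@continuous_expR R 0) H; rewrite expR0; apply.
Qed.

Lemma cvg_sbump a b x :
  sbump m a b x @[m --> \oo] --> (\1_(`]a, b[%classic) x : R).
Proof.
rewrite indicE mem_setE in_itv/=; case: (boolP (a < x < b)) => [|xab]; last first.
  by under eq_fun do rewrite sbump_out//; exact: cvg_cst.
move=> /andP[ax xb]; rewrite (_ : true%:R = 1)//.
have E c : 0 < c -> (fun m => exp_inv 1 (m.+1%:R * c)) =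
   (fun m => expR (- (m.+1%:R * c)^-1)).
  by move=> c0; apply/funext => m; rewrite /exp_inv mulr_gt0// hornerC mul1r.
have H c : 0 < c -> exp_inv 1 (m.+1%:R * c) @[m --> \oo] --> (1 : R).
  by move=> c0; rewrite E//; exact: cvg_expRN_inv.
have h1 := H (x - a); have h2 := H (b - x).
rewrite !subr_gt0 in h1 h2.
by have := cvgM (h1 ax) (h2 xb); rewrite mulr1; apply.
Qed.

(** The primitive is the integral from minus infinity, which converges because f is continuous and
    vanishes outside ]a, b[. *)
Lemma smooth1_antiderivative f a b : smooth1 f ->
  (forall x, ~~ (a < x < b) -> f x = 0) ->
  exists P : R -> R, forall x : R, is_derive x 1 P (f x).
Proof.
move=> fs f0; have fc := smooth1_continuous fs.
have mf : measurable_fun setT f by exact: continuous_measurable_fun.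
have intf u : lebesgue_measure.-integrable [set` Interval -oo%O (BRight u)] (EFin \o f).
  have intab : lebesgue_measure.-integrable `[a, b] (EFin \o f).
    apply: continuous_compact_integrable; first exact: segment_compact.
    exact: continuous_subspaceT.
  have fE : EFin \o f = (EFin \o f) \_ `[a, b].
    apply/funext => y; rewrite patchE; case: ifPn => //=.
    rewrite mem_setE in_itv/= => yab; rewrite f0//.
    by apply: contra yab => /andP[/ltW-> /ltW->].
  apply: (@integrableS _ _ _ _ setT) => //.
  have /integrable_mkcond H := intab.
  by rewrite fE; apply: H.
exists (fun x => \int[lebesgue_measure]_(t in [set` Interval -oo%O (BRight x)]) f t) => x.
have xx1 : x < x + 1 by rewrite ltrDl.
have := continuous_FTC1 xx1 (intf _).
move=> /(_ (ltNyr _) (fc x))[h1 h2].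
by apply: DeriveDef => //; rewrite -derive1E.
Qed.

(** Not divided by c, and taken over the window to the left of x, so that the derivative is exactly
    [f x - f (x - c)]. *)
Definition steklov c f x : R := \int[lebesgue_measure]_(t in `[0, c]) f (x - t).

Lemma steklovE c f x : continuous f ->
  ((steklov c f x)%:E = \int[lebesgue_measure]_(t in `[0%R, c]) (f (x - t)%R)%:E)%E.
Proof.
move=> fc; rewrite /steklov /Rintegral fineK//.
apply: integrable_fin_num => //; apply: continuous_compact_integrable.
  exact: segment_compact.
apply: continuous_subspaceT => t.
apply: (continuous_comp (f := fun t => x - t) (g := f)); last exact: fc.
by apply: cvgB; [exact: cvg_cst|exact: cvg_id].
Qed.

(** With a primitive P of f, the average is [P x - P (x - c)]. *)
Lemma is_derive_steklov c f a b : 0 < c -> smooth1 f ->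
  (forall x, ~~ (a < x < b) -> f x = 0) ->
  forall x, is_derive x 1 (steklov c f) (f x - f (x - c)).
Proof.
move=> c0 fs f0 x; have [P HP] := smooth1_antiderivative fs f0.
have fc := smooth1_continuous fs.
have Pc (y : R) : {for y, continuous P}.
  by have [Pd _] := HP y; exact/differentiable_continuous/derivable1_diffP.
have sub_derive (y t : R) : is_derive t 1 (fun t : R => y - t) (-1 : R).
  have -> : (fun t : R => y - t) = cst y - id by [].
  by apply: is_derive_eq; rewrite sub0r.
have add_derive (t : R) : is_derive t 1 (fun t : R => t - c) (1 : R).
  have -> : (fun t : R => t - c) = id - cst c by [].
  by apply: is_derive_eq; rewrite subr0.
have -> : steklov c f = P - (fun y => P (y - c)).
  apply/funext => y; apply: EFin_inj; rewrite steklovE//.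
  pose F (t : R) : R := - P (y - t).
  have FD (t : R) : is_derive t 1 F (f (y - t)).
    apply: is_derive_eq (is_deriveN (is_derive_comp1 (sub_derive y t) (HP _))) _.
    by rewrite mulrN1 opprK.
  have Fc (t : R) : {for t, continuous F}.
    by have [Fd _] := FD t; exact/differentiable_continuous/derivable1_diffP.
  rewrite (@continuous_FTC2 _ (fun t => f (y - t)) F)//.
  - by rewrite /F subr0 -EFinB opprK addrC.
  - apply: continuous_subspaceT => t.
    apply: (continuous_comp (f := fun t => y - t) (g := f)); last exact: fc.
    by apply: cvgB; [exact: cvg_cst|exact: cvg_id].
  - split.
    + by move=> t _; have [] := FD t.
    + by apply: cvg_at_right_filter; exact: Fc.
    + by apply: cvg_at_left_filter; exact: Fc.
  - by move=> t _; rewrite derive1E; have [] := FD t.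
apply: is_derive_eq (is_deriveB (HP x) (is_derive_comp1 (add_derive x) (HP _))) _.
by rewrite mulr1.
Qed.

Lemma smooth1_steklov c f a b : 0 < c -> smooth1 f ->
  (forall x, ~~ (a < x < b) -> f x = 0) -> smooth1 (steklov c f).
Proof.
move=> c0 fs f0; apply: (smooth1_of_derive (is_derive_steklov c0 fs f0)) => k.
apply: CkD; first exact: fs.
rewrite (_ : (fun _ => _) = fun x => -1 * f (1 * x + - c)).
  by apply: CkM; [exact: Ck_cst|exact: Ck_affine].
by apply/funext => x; rewrite mulN1r mul1r.
Qed.

Lemma steklov_out c f a b x :
  (forall x, ~~ (a < x < b) -> f x = 0) ->
  ~~ (a < x < b + c) -> steklov c f x = 0.
Proof.
move=> f0 xab; rewrite /steklov /Rintegral integral0_eq// => t.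
rewrite /= in_itv/= => /andP[t0 tc]; rewrite f0//.
apply: contra xab => /andP[h1 h2]; apply/andP; split; lra.
Qed.

End smooth_line.

(** * Tensor products of functions on the line as test functions *)

Section tensor.
Context {R : realType} {n : nat}.
Implicit Types (f : 'I_n -> R -> R) (i j : 'I_n) (v : 'rV[R]_n).

Definition tensor f v : R := \prod_(j < n) f j (v ord0 j).

Definition upd f i (g : R -> R) j : R -> R := if j == i then g else f j.

Lemma tensor_upd f i g v :
  tensor (upd f i g) v = g (v ord0 i) * \prod_(j < n | j != i) f j (v ord0 j).
Proof.
rewrite /tensor (bigD1 i)//= {1}/upd eqxx; congr (_ * _).
by apply: eq_bigr => j /negPf ji; rewrite /upd ji.
Qed.

Lemma updE f i : upd f i (f i) = f.
Proof. by apply/funext => j; rewrite /upd; case: eqP => // ->. Qed.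

Lemma is_derive_tensor f i v (df : R) : is_derive (v ord0 i) (1:R) (f i) df ->
  is_derive v (delta_mx ord0 i) (tensor f)
    (df * \prod_(j < n | j != i) f j (v ord0 j)).
Proof.
move=> [fd fE]; set c := \prod_(j < n | j != i) _.
have q h : tensor f (h *: delta_mx ord0 i + v) = f i (h *: 1 + v ord0 i) * c.
  rewrite -[in LHS](updE f i) tensor_upd; congr (f i _ * _).
    by rewrite !mxE !eqxx.
  by apply: eq_bigr => j ji; rewrite !mxE (negPf ji) andbF mulr0 add0r.
have q0 : tensor f v = f i (v ord0 i) * c by rewrite -[in LHS](updE f i) tensor_upd.
have H : (fun h : R => h^-1 *: (tensor f (h *: delta_mx ord0 i + v) - tensor f v))
    @ 0^' --> df * c.
  rewrite (_ : (fun _ => _) = (fun h : R => (h^-1 *: (f i (h *: 1 + v ord0 i) -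
      f i (v ord0 i))) * c)); last first.
    by apply/funext => h; rewrite q q0 -mulrBl scalerAl.
  apply: cvgMl; rewrite -fE; exact: fd.
apply: DeriveDef; last exact/cvg_lim.
by apply/cvg_ex; exists (df * c).
Qed.

Lemma continuous_tensor f : (forall j, continuous (f j)) -> continuous (tensor f).
Proof.
move=> fc; apply: continuous_big => //.
  exact: mul_continuous.
move=> j _ v; apply: (continuous_comp (g := f j)); last exact: fc.
exact: coord_continuous.
Qed.

Lemma partial_tensor f i : smooth1 (f i) ->
  partial i (tensor f) = tensor (upd f i (derive1 (f i))).
Proof.
move=> fs; apply/funext => v; rewrite tensor_upd /partial.
by have [] := is_derive_tensor (smooth1_is_derive fs (v ord0 i)).
Qed.

(** Tensor products of smooth factors are stable under partial derivatives: each one replaces a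
    single factor by its derivative. Continuity and differentiability thus need checking for tensor
    products only. *)
Lemma smooth_tensor f : (forall j, smooth1 (f j)) -> smooth (tensor f).
Proof.
move=> fs l.
have [g [gs ->]] : exists g, (forall j, smooth1 (g j)) /\
    foldr partial (tensor f) l = tensor g.
  elim: l => [|i l [g [gs /= ->]]]; first by exists f.
  exists (upd g i (derive1 (g i))); split; last exact: partial_tensor.
  move=> j; rewrite /upd; case: eqP => _; last exact: gs.
  exact: smooth1_derive1.
split; first by apply: continuous_tensor => j; exact: smooth1_continuous.
by move=> i v; have [] := is_derive_tensor (smooth1_is_derive (gs i) (v ord0 i)).
Qed.

Lemma compact_cube (z : 'rV[R]_n) r : compact (cube z r).
Proof.
rewrite (_ : cube z r =
    [set v | forall i, `[z ord0 i - r, z ord0 i + r]%classic (v ord0 i)]).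
  apply: (rV_compact (A := fun i => `[z ord0 i - r, z ord0 i + r]%classic)) => i.
  exact: segment_compact.
by apply/seteqP; split => v /= H i; have := H i; rewrite in_itv/= ler_distl.
Qed.

Lemma tensor_out f (r : R) v :
  (forall j x, r < `|x| -> f j x = 0) -> ~ cube 0 r v -> tensor f v = 0.
Proof.
move=> f0 /existsNP[j]; rewrite mxE subr0 => /negP; rewrite -ltNge => vj.
by rewrite /tensor (bigD1 j)//= f0// mul0r.
Qed.

Lemma test_tensor f (r : R) : (forall j, smooth1 (f j)) ->
  (forall j x, r < `|x| -> f j x = 0) -> test_function (tensor f).
Proof.
move=> fs f0; split; first exact: smooth_tensor.
apply: (@subclosed_compact _ _ (cube 0 r)).
- exact: closed_closure.
- exact: compact_cube.
- rewrite [X in _ `<=` X](closure_id _).1; last first.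
    by apply: compact_closed; [exact: norm_hausdorff|exact: compact_cube].
  apply: closure_subset => v /= vn0.
  by apply: contrapT => /(tensor_out f0) v0; rewrite v0 eqxx in vn0.
Qed.

End tensor.

(** * Almost everywhere equality from integrals over boxes *)

Section box_uniqueness.
Context {R : realType} {n : nat}.
Local Notation mu := (lebesgue_rV R n).

Section density.
Variable F : 'rV[R]_n -> \bar R.
Hypotheses (mF : measurable_fun setT F) (F0 : forall v, (0 <= F v)%E).

Definition density_measure (A : set 'rV[R]_n) : \bar R := (\int[mu]_(v in A) F v)%E.

Let density0 : density_measure set0 = 0%E.
Proof. by rewrite /density_measure integral_set0. Qed.

Let density_ge0 A : (0 <= density_measure A)%E.
Proof. exact: integral_ge0. Qed.

Let density_sigma_additive : semi_sigma_additive density_measure.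
Proof.
move=> A mA tA mUA; rewrite /density_measure ge0_integral_bigcup//.
  by apply: is_cvg_nneseries => k _ _; exact: integral_ge0.
exact: measurable_funTS.
Qed.

Definition density : {measure set 'rV[R]_n -> \bar R} :=
  HB.pack density_measure (isMeasure.Build _ _ _ density_measure
    density0 density_ge0 density_sigma_additive).

End density.

(** The measures with densities F1 and F2 agree on boxes, hence on all measurable sets. Finiteness
    on boxes gives almost everywhere equality on each ]-k, k[^n, and the countably many null sets
    are united. *)
Lemma boxes_ae_eq (F1 F2 : 'rV[R]_n -> \bar R) :
  measurable_fun setT F1 -> (forall v, (0 <= F1 v)%E) ->
  measurable_fun setT F2 -> (forall v, (0 <= F2 v)%E) ->
  (forall a b, (\int[mu]_(v in obox a b) F1 v = \int[mu]_(v in obox a b) F2 v)%E) ->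
  (forall a b, (\int[mu]_(v in obox a b) F1 v < +oo)%E) ->
  {ae mu, forall v, F1 v = F2 v}.
Proof.
move=> mF1 F10 mF2 F20 F12 F1oo.
have E A : measurable A -> (\int[mu]_(v in A) F1 v = \int[mu]_(v in A) F2 v)%E.
  exact: (@oboxes_measure_unique _ _ (density mF1 F10) (density mF2 F20)
    (fun a b _ => F12 a b) F1oo A).
pose g (k : nat) : set 'rV[R]_n := obox (fun=> - k%:R) (fun=> k%:R).
have mg k : measurable (g k) by exact: measurable_obox.
have H k : ae_eq mu (g k) F1 F2.
  apply: integral_ae_eq => //.
  - apply/integrableP; split; first exact: measurable_funTS.
    by under eq_integral => v _ do rewrite gee0_abs//; exact: F1oo.
  - exact: measurable_funTS.
  - by move=> A _ mA; exact: E.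
have : forall k, {ae mu, forall v, g k v -> F1 v = F2 v} by exact: H.
move=> /ae_foralln; apply: filterS => v Hv.
have [k Hk] := exists_nat_gt (fun i => `|v ord0 i|).
by apply: (Hv k) => i; have := Hk i; rewrite ltr_norml.
Qed.

End box_uniqueness.

(** * Locally integrable functions against multipliers supported in a cube *)

Section local_integrability.
Context {R : realType} {n : nat}.
Local Notation mu := (lebesgue_rV R n).
Implicit Types (f u w : 'rV[R]_n -> R).

Definition loc_int f := measurable_fun setT f /\
  forall r, (\int[mu]_(v in cube 0 r) `|f v|%:E < +oo)%E.

Lemma locally_integrable_loc_int f : locally_integrable_rV f -> loc_int f.
Proof. by move=> [mf fK]; split=> // r; apply: fK; exact: compact_cube. Qed.

Lemma loc_int_le f u : measurable_fun setT u ->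
  (forall v, `|u v| <= `|f v|) -> loc_int f -> loc_int u.
Proof.
move=> mu_ uf [mf fK]; split => // r; apply: le_lt_trans (fK r).
apply: ge0_le_integral => //; first exact: measurable_cube.
- by apply/measurable_EFinP; apply: measurable_funTS; exact: measurableT_comp.
- by apply/measurable_EFinP; apply: measurable_funTS; exact: measurableT_comp.
- by move=> v _; rewrite lee_fin.
Qed.

Lemma integrable_locM f w (C r : R) : loc_int f ->
  measurable_fun setT w -> (forall v, `|w v| <= C) ->
  (forall v, ~ cube 0 r v -> w v = 0) ->
  mu.-integrable setT (fun v => (f v * w v)%:E).
Proof.
move=> [mf fK] mw wC w0.
have C0 : 0 <= C by exact: le_trans (normr_ge0 _) (wC 0).
have mc : measurable (cube (0 : 'rV[R]_n) r) by exact: measurable_cube.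
have mf' : measurable_fun setT (fun v => `|f v|%:E).
  by apply/measurable_EFinP; exact: measurableT_comp.
apply/integrableP; split.
  by apply/measurable_EFinP; exact: measurable_funM.
apply: (@le_lt_trans _ _ (\int[mu]_v (C%:E * ((fun v => `|f v|%:E) \_ (cube 0 r)) v))%E).
  apply: ge0_le_integral => //.
  - by do 2 apply: measurableT_comp => //; exact: measurable_funM.
  - apply: emeasurable_funM => //.
    by apply/(measurable_restrictT _ _).1 => //; exact: measurable_funTS.
  - move=> v _ /=; rewrite patchE; case: ifPn => [|/negP vr].
      move=> _; rewrite -EFinM lee_fin normrM mulrC ler_wpM2r//.
    by rewrite w0 ?mulr0 ?normr0 ?mule0// => h; apply: vr; rewrite inE.
rewrite ge0_integralZl_EFin//; last first.
- by apply/(measurable_restrictT _ _).1 => //; exact: measurable_funTS.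
- by move=> v _; apply: erestrict_ge0 => ? _; rewrite lee_fin.
by rewrite -integral_mkcond lte_mul_pinfty ?lee_fin.
Qed.

End local_integrability.

Lemma cvg_integral_locM (R : realType) (n : nat) (f : 'rV[R]_n -> R)
    (w_ : nat -> 'rV[R]_n -> R) (w : 'rV[R]_n -> R) (C r : R) : loc_int f ->
  (forall m, measurable_fun setT (w_ m)) -> measurable_fun setT w ->
  (forall m v, `|w_ m v| <= C) -> (forall m v, ~ cube 0 r v -> w_ m v = 0) ->
  (forall v, w_ m v @[m --> \oo] --> w v) ->
  (\int[lebesgue_rV R n]_v (f v * w_ m v)%:E @[m --> \oo] -->
   \int[lebesgue_rV R n]_v (f v * w v)%:E)%E.
Proof.
move=> fl mw_ mw wC w0 ww; have [mf fK] := fl.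
have C0 : 0 <= C by exact: le_trans (normr_ge0 _) (wC 0 0).
have mc : measurable (cube (0 : 'rV[R]_n) r) by exact: measurable_cube.
have fal : loc_int (fun v => `|f v|).
  by apply: (@loc_int_le _ _ f) => // [|v]; [exact: measurableT_comp|rewrite normr_id].
have [] // := @dominated_convergence _ _ _ (lebesgue_rV R n) setT measurableT
    (fun m v => (f v * w_ m v)%:E) (fun v => (f v * w v)%:E)
    (fun v => (`|f v| * (C * \1_(cube 0 r) v))%:E).
- by move=> m; apply/measurable_EFinP; exact: measurable_funM.
- by apply/measurable_EFinP; exact: measurable_funM.
- apply: aeW => v _; apply/fine_cvgP; split; first exact: nearW.
  by apply: cvgMr; exact: ww.
- apply: (@integrable_locM _ _ _ _ C r) => //.
  + by apply: measurable_funM.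
  + move=> v; rewrite ger0_norm ?mulr_ge0//.
    by rewrite ler_piMr// indicE lern1 leq_b1.
  + by move=> v vr; rewrite indicE memNset// mulr0.
- apply: aeW => v m _ /=; rewrite lee_fin normrM ler_wpM2l//.
  rewrite indicE; case: (boolP (v \in cube 0 r)) => vr; first by rewrite mulr1.
  by rewrite w0 ?normr0 ?mulr0// => h; move/negP: vr; apply; rewrite inE.
Qed.

Lemma norm_le_of_itv (R : realType) (K c x a b : R) : 0 < c -> `|a| < K ->
  `|b| < K -> a < x < b + c -> `|x| <= K + c.
Proof.
have H (y : R) : - y <= `|y| by rewrite -normrN ler_norm.
move: (ler_norm b) (H a) => hb ha c0 aK bK /andP[h1 h2].
have [x0|x0] := leP 0 x; first by rewrite ger0_norm//; lra.
by rewrite ltr0_norm//; lra.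
Qed.

Lemma itv_of_shift (R : realType) (c t x a b : R) : 0 <= t <= c ->
  a < x - t < b -> a < x < b + c.
Proof. by move=> /andP[t0 tc] /andP[h1 h2]; apply/andP; split; lra. Qed.

(** * Difference quotients of weakly differentiable functions *)

Section weak_partial_box.
Context {R : realType} {n : nat}.
Local Notation mu := (lebesgue_rV R n).
Variables (i : 'I_n) (c : R).
Hypothesis c0 : 0 < c.
Local Notation e := (delta_mx ord0 i : 'rV[R]_n).

Section fixed_box.
Variables (a b : 'I_n -> R).

Definition box_bump (m : nat) : 'rV[R]_n -> R := tensor (fun j => sbump m (a j) (b j)).

(** The Steklov average of [box_bump m] along e. Only the i-th factor is averaged, so the result is
    still a tensor product of smooth functions, hence a test function. *)
Definition tsteklov (m : nat) : 'rV[R]_n -> R :=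
  tensor (upd (fun j => sbump m (a j) (b j)) i (steklov c (sbump m (a i) (b i)))).

(** The length of the set of t in [0, c] with [v - t *: e] in the box; it is the pointwise limit of
    [tsteklov m v]. *)
Definition box_steklov (v : 'rV[R]_n) : R :=
  fine (\int[lebesgue_measure]_(t in `[0%R, c])
    (\1_(obox a b) (v - t *: e)%R : R)%:E)%E.

Lemma shiftE t (v : 'rV[R]_n) j :
  (v - t *: e) ord0 j = v ord0 j - (if j == i then t else 0).
Proof. by rewrite !mxE eqxx/=; case: eqP; rewrite ?mulr1 ?mulr0. Qed.

Lemma box_bump_shift m t v : box_bump m (v - t *: e) =
  sbump m (a i) (b i) (v ord0 i - t) *
  \prod_(j < n | j != i) sbump m (a j) (b j) (v ord0 j).
Proof.
rewrite /box_bump -[in LHS](updE (fun j => sbump m (a j) (b j)) i) tensor_upd.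
rewrite shiftE eqxx; congr (_ * _).
by apply: eq_bigr => j /negPf ji; rewrite shiftE ji subr0.
Qed.

Lemma box_bump_itv m v : 0 <= box_bump m v <= 1.
Proof.
apply/andP; split; first by apply: prodr_ge0 => j _; have /andP[] := sbump_itv m (a j) (b j) (v ord0 j).
by apply: prodr_ile1 => j _; exact: sbump_itv.
Qed.

Lemma measurable_tensor (f : 'I_n -> R -> R) : (forall j, continuous (f j)) ->
  measurable_fun setT (tensor f).
Proof.
move=> fc; apply: measurable_prod => j _.
exact: (measurableT_comp (continuous_measurable_fun (fc j)) (measurable_coor j)).
Qed.

Lemma measurable_box_bump m : measurable_fun setT (box_bump m).
Proof.
by apply: measurable_tensor => j; exact/smooth1_continuous/smooth1_sbump.
Qed.

Lemma smooth1_tsteklov m j :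
  smooth1 (upd (fun j => sbump m (a j) (b j)) i (steklov c (sbump m (a i) (b i))) j).
Proof.
rewrite /upd; case: eqP => _; last exact: smooth1_sbump.
apply: (@smooth1_steklov _ _ _ (a i) (b i)) => //; first exact: smooth1_sbump.
exact: sbump_out.
Qed.

Lemma measurable_tsteklov m : measurable_fun setT (tsteklov m).
Proof.
by apply: measurable_tensor => j; exact/smooth1_continuous/smooth1_tsteklov.
Qed.

Lemma measurable_shift_line m v :
  measurable_fun [set: measurableTypeR R] (fun t => box_bump m (v - t *: e)).
Proof.
apply: (measurableT_comp (measurable_box_bump m)); apply: measurable_subrV => //.
exact: measurable_scalerV.
Qed.

Lemma tsteklovE m v : ((tsteklov m v)%:E =
  \int[lebesgue_measure]_(t in `[0%R, c]) (box_bump m (v - t *: e)%R)%:E)%E.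
Proof.
under eq_integral => t _ do rewrite box_bump_shift mulrC EFinM.
rewrite ge0_integralZl_EFin//.
- rewrite -steklovE; last exact/smooth1_continuous/smooth1_sbump.
  by rewrite /tsteklov tensor_upd -EFinM mulrC.
- by move=> t _; rewrite lee_fin; have /andP[] := sbump_itv m (a i) (b i) (v ord0 i - t).
- apply/measurable_EFinP; apply: measurable_funTS.
  have bc := smooth1_continuous (smooth1_sbump m (a i) (b i)).
  apply: (measurableT_comp (continuous_measurable_fun bc)).
  by apply: measurable_funB.
- by apply: prodr_ge0 => j _; have /andP[] := sbump_itv m (a j) (b j) (v ord0 j).
Qed.

Lemma tsteklov_itv m v : 0 <= tsteklov m v <= c.
Proof.
rewrite -!lee_fin tsteklovE; apply/andP; split.
  by apply: integral_ge0 => t _; rewrite lee_fin; have /andP[] := box_bump_itv m (v - t *: e).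
have -> : (c%:E = \int[lebesgue_measure]_(t in `[0%R, c]) (cst 1%E) t)%E.
  by rewrite integral_cst//= lebesgue_measure_itv/= lte_fin c0 oppr0 adde0 mul1e.
apply: ge0_le_integral => //.
- by move=> t _; rewrite lee_fin; have /andP[] := box_bump_itv m (v - t *: e).
- by apply/measurable_EFinP; apply: measurable_funTS; exact: measurable_shift_line.
- by move=> t _; rewrite lee_fin; have /andP[] := box_bump_itv m (v - t *: e).
Qed.

Lemma cvg_box_bump v :
  box_bump m v @[m --> \oo] --> (\1_(obox a b) v : R).
Proof.
have -> : \1_(obox a b) v =
    \prod_(j < n) (\1_(`]a j, b j[%classic) (v ord0 j) : R).
  rewrite indicE; case: (boolP (v \in obox a b)) => [|/negP] vab.
    rewrite big1// => j _; rewrite indicE mem_setE in_itv/=.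
    by move: vab; rewrite inE => /(_ j) ->.
  have : ~ obox a b v by move=> h; apply: vab; rewrite inE.
  move=> /existsNP[j /negP vj].
  by rewrite (bigD1 j)//= indicE mem_setE in_itv/= (negPf vj) mul0r.
rewrite /box_bump /tensor.
apply: (@cvg_big _ _ _ _ _ (@mul_continuous R) _ _ _
  (fun j m => sbump m (a j) (b j) (v ord0 j))).
by move=> j _; exact: cvg_sbump.
Qed.

Lemma measurable_indic_shift v : measurable_fun [set: measurableTypeR R]
  (fun t => \1_(obox a b) (v - t *: e) : R).
Proof.
apply: (measurableT_comp (measurable_indic (measurable_obox a b))).
by apply: measurable_subrV => //; exact: measurable_scalerV.
Qed.

Lemma box_steklovE v : ((box_steklov v)%:E = \int[lebesgue_measure]_(t in `[0%R, c])
    (\1_(obox a b) (v - t *: e)%R : R)%:E)%E.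
Proof.
rewrite /box_steklov fineK// ge0_fin_numE; last first.
  by apply: integral_ge0 => t _; rewrite lee_fin.
apply: (@le_lt_trans _ _ (\int[lebesgue_measure]_(t in `[0%R, c]) (cst 1%E) t)%E).
  apply: ge0_le_integral => //.
  - by apply/measurable_EFinP; apply: measurable_funTS; exact: measurable_indic_shift.
  - by move=> t _; rewrite lee_fin indicE lern1 leq_b1.
by rewrite integral_cst//= lebesgue_measure_itv/= lte_fin c0 oppr0 adde0 mul1e ltry.
Qed.

Lemma cvg_tsteklov v : tsteklov m v @[m --> \oo] --> box_steklov v.
Proof.
have H : (\int[lebesgue_measure]_(t in `[0%R, c]) (box_bump m (v - t *: e)%R)%:E)%E
    @[m --> \oo] -->
    (\int[lebesgue_measure]_(t in `[0%R, c]) (\1_(obox a b) (v - t *: e)%R : R)%:E)%E.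
  have [] // := @dominated_convergence _ _ _ (@lebesgue_measure R) `[0, c]%classic
    (measurable_itv _) (fun m t => (box_bump m (v - t *: e))%:E)
    (fun t => (\1_(obox a b) (v - t *: e))%:E) (cst 1%E).
  - by move=> m; apply/measurable_EFinP; apply: measurable_funTS; exact: measurable_shift_line.
  - by apply/measurable_EFinP; apply: measurable_funTS; exact: measurable_indic_shift.
  - by apply: aeW => t _; apply/fine_cvgP; split; [exact: nearW|exact: cvg_box_bump].
  - apply/integrableP; split => //.
    under eq_integral do rewrite /= normr1.
    by rewrite integral_cst//= lebesgue_measure_itv/= lte_fin c0 oppr0 adde0 mul1e ltry.
  - apply: aeW => t m _ /=; have /andP[h1 h2] := box_bump_itv m (v - t *: e).
    by rewrite lee_fin ger0_norm.
have {}H : (tsteklov m v)%:E @[m --> \oo] --> (box_steklov v)%:E.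
  by rewrite box_steklovE; under eq_fun do rewrite tsteklovE.
exact: (fine_cvg H).
Qed.

Lemma measurable_box_steklov : measurable_fun setT box_steklov.
Proof.
apply/measurable_EFinP.
rewrite (_ : EFin \o _ = fun v => \int[lebesgue_measure]_(t in `[0%R, c])
    (\1_(obox a b) (v - t *: e)%R : R)%:E)%E; last first.
  by apply/funext => v; rewrite -box_steklovE.
apply: (@measurable_integral_on _ _ _ _ _ (@lebesgue_measure R) `[0, c]%classic
  (measurable_itv _) (fun z : 'rV[R]_n * measurableTypeR R =>
    (\1_(obox a b) (z.1 - z.2 *: e) : R)%:E)) => //.
  apply/measurable_EFinP.
  apply: (measurableT_comp (measurable_indic (measurable_obox a b))).
  apply: measurable_subrV; first exact: measurable_fst.
  by apply: measurable_scalerV; [exact: measurable_snd|exact: measurable_cst].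
Qed.

(** Dominated convergence needs one cube containing the supports for all m: k bounds the corners of
    the box, and c accounts for the shift and for the averaging window. *)
Lemma box_bump_radius : exists r : R, forall m v, ~ cube 0 r v ->
  [/\ box_bump m v = 0, box_bump m (v - c *: e) = 0 & tsteklov m v = 0].
Proof.
have [k Hk] := exists_nat_gt (fun j => Num.max `|a j| `|b j|).
exists (k%:R + c) => m v /existsNP[j]; rewrite mxE subr0 => /negP; rewrite -ltNge => vj.
have := Hk j; rewrite gt_max => /andP[ak bk].
have out x : ~~ (a j < x < b j + c) -> sbump m (a j) (b j) x = 0.
  move=> h; apply: sbump_out; apply: contra h => /andP[-> /=] /lt_trans; apply.
  by rewrite ltrDl.
have vj' : ~~ (a j < v ord0 j < b j + c).
  apply/negP => /(norm_le_of_itv c0 ak bk); apply/negP; by rewrite -ltNge.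
split.
- by rewrite /box_bump /tensor (bigD1 j)//= out// mul0r.
- rewrite /box_bump /tensor (bigD1 j)//= sbump_out ?mul0r// shiftE.
  apply: contra vj'; apply: itv_of_shift.
  by case: eqP => _; rewrite ?lexx ?(ltW c0).
- rewrite /tsteklov /tensor (bigD1 j)//= {1}/upd; case: eqP => [ji|_].
    by rewrite -ji (steklov_out _ vj') ?mul0r// => x; exact: sbump_out.
  by rewrite out// mul0r.
Qed.

Lemma box_steklov_out r v :
  (forall m v, ~ cube 0 r v -> tsteklov m v = 0) -> ~ cube 0 r v ->
  box_steklov v = 0.
Proof.
move=> H vr; rewrite -(cvg_lim (@Rhausdorff R) (@cvg_tsteklov v)).
by under eq_fun do rewrite H//; exact: lim_cst.
Qed.

Lemma box_steklov_itv v : 0 <= box_steklov v <= c.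
Proof.
have H := @cvg_tsteklov v; rewrite -(cvg_lim (@Rhausdorff R) H).
have cH : cvgn (tsteklov ^~ v) by apply: cvgP H.
apply/andP; split; [apply: limr_ge|apply: limr_le] => //; apply: nearW => m;
  by have /andP[] := tsteklov_itv m v.
Qed.

Lemma partial_tsteklov m v :
  partial i (tsteklov m) v = box_bump m v - box_bump m (v - c *: e).
Proof.
rewrite /tsteklov partial_tensor; last exact: smooth1_tsteklov.
set b0 := sbump m (a i) (b i).
set f := upd (fun j => sbump m (a j) (b j)) i (steklov c b0).
have -> : derive1 (f i) = fun x => b0 x - b0 (x - c).
  apply/funext => x; rewrite /f /upd eqxx derive1E.
  have [_ ->//] := is_derive_steklov c0 (smooth1_sbump m (a i) (b i))
    (@sbump_out _ m (a i) (b i)) x.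
rewrite tensor_upd box_bump_shift mulrBl; congr (_ - _).
  rewrite /box_bump -[in RHS](updE (fun j => sbump m (a j) (b j)) i) tensor_upd.
  by congr (_ * _); apply: eq_bigr => j /negPf ji; rewrite /f /upd ji.
by congr (_ * _); apply: eq_bigr => j /negPf ji; rewrite /f /upd ji.
Qed.

Lemma test_tsteklov m : test_function (tsteklov m).
Proof.
have [k Hk] := exists_nat_gt (fun j => Num.max `|a j| `|b j|).
apply: (@test_tensor _ _ _ (k%:R + c)); first exact: smooth1_tsteklov.
move=> j x xj.
have := Hk j; rewrite gt_max => /andP[ak bk].
have xj' : ~~ (a j < x < b j + c).
  apply/negP => /(norm_le_of_itv c0 ak bk); apply/negP; by rewrite -ltNge.
rewrite /upd; case: eqP => [ji|_].
  by rewrite -ji (steklov_out _ xj')// => y; exact: sbump_out.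
apply: sbump_out; apply: contra xj' => /andP[-> /=] /lt_trans; apply.
by rewrite ltrDl.
Qed.

(** The definition of the weak derivative is applied to [tsteklov m], whose partial derivative is a
    difference of bumps. Letting m tend to infinity on both sides replaces the bumps by indicators,
    which are not test functions themselves. *)
Lemma weak_partial_box (psi h : 'rV[R]_n -> R) : is_weak_partial i psi h ->
  (\int[mu]_v (psi v * (\1_(obox a b) v - \1_(obox a b) (v - c *: e)%R))%:E =
   - \int[mu]_v (h v * box_steklov v)%:E)%E.
Proof.
move=> [/locally_integrable_loc_int psil /locally_integrable_loc_int hl H].
have [r Hr] := box_bump_radius.
have mshift : measurable_fun setT (fun v : 'rV[R]_n => v - c *: e).
  by apply: measurable_subrV => //; exact: measurable_cst.
have cvg1 := @cvg_integral_locM _ _ psi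
  (fun m v => box_bump m v - box_bump m (v - c *: e))
  (fun v => \1_(obox a b) v - \1_(obox a b) (v - c *: e)) 2 r psil.
have cvg2 := @cvg_integral_locM _ _ h tsteklov box_steklov c r hl.
have {}cvg2 : (\int[mu]_v (h v * tsteklov m v)%:E @[m --> \oo] -->
  \int[mu]_v (h v * box_steklov v)%:E)%E.
  apply: cvg2.
  - exact: measurable_tsteklov.
  - exact: measurable_box_steklov.
  - by move=> m v; have /andP[h0 h1] := tsteklov_itv m v; rewrite ger0_norm.
  - by move=> m v /Hr => /(_ m)[].
  - exact: cvg_tsteklov.
have {}cvg1 : (\int[mu]_v (psi v * (box_bump m v - box_bump m (v - c *: e)%R))%:E
   @[m --> \oo] -->
   \int[mu]_v (psi v * (\1_(obox a b) v - \1_(obox a b) (v - c *: e)%R))%:E)%E.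
  apply: cvg1.
  - move=> m; apply: measurable_funB; first exact: measurable_box_bump.
    exact: (measurableT_comp (measurable_box_bump m) mshift).
  - have mi : measurable_fun setT (\1_(obox a b) : 'rV[R]_n -> R).
      exact: measurable_indic (measurable_obox a b).
    apply: measurable_funB; first exact: mi.
    exact: (measurableT_comp mi mshift).
  - move=> m v; have /andP[h0 h1] := box_bump_itv m v.
    have /andP[h2 h3] := box_bump_itv m (v - c *: e).
    by rewrite ler_norml; apply/andP; split; lra.
  - by move=> m v /Hr => /(_ m)[-> -> _]; rewrite subrr.
  - by move=> v; apply: cvgB; exact: cvg_box_bump.
have E m : (\int[mu]_v (psi v * (box_bump m v - box_bump m (v - c *: e)%R))%:E =
    - \int[mu]_v (h v * tsteklov m v)%:E)%E.
  rewrite -(H _ (test_tsteklov m)).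
  by apply: eq_integral => v _; rewrite partial_tsteklov.
move: cvg1; under eq_fun do rewrite E.
move=> cvg1; have cvg3 := cvgeN cvg2.
exact: (cvg_unique (@ereal_hausdorff R) cvg1 (cvg3 _)).
Qed.

End fixed_box.
End weak_partial_box.

(** * From identities over boxes to differences at almost every point *)

Section difference_quotient.
Context {R : realType} {n : nat}.
Local Notation mu := (lebesgue_rV R n).
Variables (i : 'I_n) (c : R).
Hypothesis c0 : 0 < c.
Local Notation e := (delta_mx ord0 i : 'rV[R]_n).

Definition line_int (u : 'rV[R]_n -> R) v : \bar R :=
  (\int[lebesgue_measure]_(t in `[0%R, c]) (u (v + t *: e)%R)%:E)%E.

Lemma measurable_line_pair (u : 'rV[R]_n -> R) : measurable_fun setT u ->
  measurable_fun setT (fun z : 'rV[R]_n * measurableTypeR R =>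
    u (z.1 + z.2 *: e)).
Proof.
move=> mu_; apply: (measurableT_comp mu_); apply: measurable_addrV.
  exact: measurable_fst.
by apply: measurable_scalerV; [exact: measurable_snd|exact: measurable_cst].
Qed.

Lemma measurable_line_int (u : 'rV[R]_n -> R) : measurable_fun setT u -> (forall v, 0 <= u v) ->
  measurable_fun setT (line_int u).
Proof.
move=> mu_ u0; apply: (@measurable_integral_on _ _ _ _ _ (@lebesgue_measure R)
  `[0, c]%classic (measurable_itv _)
  (fun z : 'rV[R]_n * measurableTypeR R => (u (z.1 + z.2 *: e))%:E)) => //.
  by apply/measurable_EFinP; exact: measurable_line_pair.
by move=> z; rewrite lee_fin.
Qed.

Lemma line_int_ge0 (u : 'rV[R]_n -> R) v : (forall v, 0 <= u v) -> (0 <= line_int u v)%E.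
Proof. by move=> u0; apply: integral_ge0 => t _; rewrite lee_fin. Qed.

Lemma integral_indicM (u : 'rV[R]_n -> R) (B : set 'rV[R]_n) :
  (\int[mu]_v (u v * \1_B v)%:E = \int[mu]_(v in B) (u v)%:E)%E.
Proof.
rewrite [RHS]integral_mkcond epatch_indic.
by apply: eq_integral => v _; rewrite EFinM.
Qed.

Lemma integral_indic_shift (u : 'rV[R]_n -> R) a b t : measurable_fun setT u ->
  (forall v, 0 <= u v) ->
  (\int[mu]_v (u v * \1_(obox a b) (v - t *: e)%R)%:E =
   \int[mu]_(v in obox a b) (u (v + t *: e)%R)%:E)%E.
Proof.
move=> mu_ u0; rewrite -(integral_indicM (fun v => u (v + t *: e))).
rewrite -(ge0_integral_translation (t *: e)).
- by apply: eq_integral => v _; rewrite addrK.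
- apply/measurable_EFinP; apply: measurable_funM => //.
  apply: (measurableT_comp (measurable_indic (measurable_obox a b))).
  by apply: measurable_subrV => //; exact: measurable_cst.
- by move=> v; rewrite lee_fin mulr_ge0.
Qed.

(** Tonelli brings the integral over t outside; translating v by [t *: e] then moves the shift from
    the box to u. *)
Lemma integral_box_steklov (u : 'rV[R]_n -> R) a b : measurable_fun setT u ->
  (forall v, 0 <= u v) ->
  (\int[mu]_v (u v * box_steklov i c a b v)%:E =
   \int[mu]_(v in obox a b) line_int u v)%E.
Proof.
move=> mu_ u0.
have mi : measurable_fun setT (\1_(obox a b) : 'rV[R]_n -> R).
  exact: measurable_indic (measurable_obox a b).
have m1 : measurable_fun setT (fun z : 'rV[R]_n * measurableTypeR R =>
    (u z.1 * \1_(obox a b) (z.1 - z.2 *: e))%:E).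
  apply/measurable_EFinP; apply: measurable_funM.
    exact: (measurableT_comp mu_ measurable_fst).
  apply: (measurableT_comp mi); apply: measurable_subrV; first exact: measurable_fst.
  by apply: measurable_scalerV; [exact: measurable_snd|exact: measurable_cst].
have m2 : measurable_fun setT (fun z : 'rV[R]_n * measurableTypeR R =>
    (u (z.1 + z.2 *: e) * \1_(obox a b) z.1)%:E).
  apply/measurable_EFinP; apply: measurable_funM.
    exact: measurable_line_pair.
  exact: (measurableT_comp mi measurable_fst).
transitivity (\int[mu]_v \int[lebesgue_measure]_(t in `[0%R, c])
    (u v * \1_(obox a b) (v - t *: e)%R)%:E)%E.
  apply: eq_integral => v _; rewrite EFinM box_steklovE// -ge0_integralZl_EFin//.
  by apply/measurable_EFinP; apply: measurable_funTS; exact: measurable_indic_shift.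
rewrite (@tonelli_on _ _ _ _ _ mu (@lebesgue_measure R) _ (measurable_itv `[0, c])
  _ m1); last by move=> z; rewrite lee_fin mulr_ge0.
under eq_integral => t _ do rewrite /= integral_indic_shift// -integral_indicM.
rewrite -(@tonelli_on _ _ _ _ _ mu (@lebesgue_measure R) _ (measurable_itv `[0, c])
  _ m2); last by move=> z; rewrite lee_fin mulr_ge0.
rewrite [RHS]integral_mkcond epatch_indic.
apply: eq_integral => v _ /=; rewrite /line_int -ge0_integralZr//.
- apply/measurable_EFinP; apply: measurable_funTS.
  exact: (measurable_fun_pair2 v (measurable_line_pair mu_)).
- by move=> t _; rewrite lee_fin.
Qed.

Variables psi h : 'rV[R]_n -> R.
Hypothesis wd : is_weak_partial i psi h.

Let pp (f : 'rV[R]_n -> R) v := Num.max (f v) 0.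
Let np (f : 'rV[R]_n -> R) v := Num.max (- f v) 0.

Let ppB f v : f v = pp f v - np f v.
Proof.
rewrite /pp /np; have [f0|f0] := leP 0 (f v).
  by rewrite max_r ?subr0// oppr_le0.
by rewrite max_l ?sub0r ?opprK// oppr_ge0 ltW.
Qed.

Let pp0 f v : 0 <= pp f v. Proof. by rewrite le_max lexx orbT. Qed.
Let np0 f v : 0 <= np f v. Proof. by rewrite le_max lexx orbT. Qed.

Let ppD f v : `|f v| = pp f v + np f v.
Proof.
rewrite /pp /np; have [f0|f0] := leP 0 (f v).
  by rewrite max_r ?addr0 ?oppr_le0// ger0_norm.
by rewrite max_l ?add0r ?oppr_ge0 ?(ltW f0)// ltr0_norm.
Qed.

Let loc_pp f : loc_int f -> loc_int (pp f).
Proof.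
move=> fl; apply: (loc_int_le _ _ fl).
  by apply: measurable_maxr => //; case: fl.
by move=> v; rewrite ger0_norm// ppD lerDl.
Qed.

Let loc_np f : loc_int f -> loc_int (np f).
Proof.
move=> fl; apply: (loc_int_le _ _ fl).
  by apply: measurable_maxr => //; apply: measurableT_comp => //; case: fl.
by move=> v; rewrite ger0_norm// ppD lerDr.
Qed.

(* psi (v + c e) - psi v = int_0^c h (v + t e) dt integrated over a box, with
   positive and negative parts (pp and np) moved to opposite sides so that all
   terms are nonnegative. *)
Lemma box_identity a b :
  (\int[mu]_(v in obox a b) ((pp psi v)%:E + (np psi (v + c *: e)%R)%:E + line_int (pp h) v)
   = \int[mu]_(v in obox a b) ((np psi v)%:E + (pp psi (v + c *: e)%R)%:E + line_int (np h) v)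
  /\ \int[mu]_(v in obox a b) ((pp psi v)%:E + (np psi (v + c *: e)%R)%:E + line_int (pp h) v)
   < +oo)%E.
Proof.
have [/locally_integrable_loc_int psil /locally_integrable_loc_int hl _] := wd.
have [r Hr] := box_bump_radius i c0 a b.
have mi : measurable_fun setT (\1_(obox a b) : 'rV[R]_n -> R).
  exact: measurable_indic (measurable_obox a b).
have mshift : measurable_fun setT (fun v : 'rV[R]_n => v + c *: e).
  by apply: measurable_addrV => //; exact: measurable_cst.
have mB := measurable_obox a b.
have ind1 (x : 'rV[R]_n) : `|\1_(obox a b) x : R| <= 1.
  by rewrite ger0_norm// indicE lern1 leq_b1.
have [k Hk] := exists_nat_gt (fun j => Num.max `|a j| `|b j|).
have Bout t v : 0 <= t <= c -> ~ cube 0 (k%:R + c) v ->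
    \1_(obox a b) (v - t *: e) = 0 :> R.
  move=> tc /existsNP[j]; rewrite mxE subr0 => vj.
  rewrite indicE memNset// => /(_ j); rewrite shiftE => vab; apply: vj.
  have := Hk j; rewrite gt_max => /andP[ak bk].
  apply: (norm_le_of_itv c0 ak bk); apply: (itv_of_shift _ vab).
  by case: eqP; rewrite ?lexx ?(ltW c0).
have int0 u t : loc_int u -> 0 <= t <= c ->
    mu.-integrable setT (fun v => (u v * \1_(obox a b) (v - t *: e)%R)%:E).
  move=> ul tc; apply: (@integrable_locM _ _ _ _ 1 (k%:R + c)) => //.
  - apply: (measurableT_comp mi).
    by apply: measurable_subrV => //; exact: measurable_cst.
  - by move=> v; exact: Bout.
have c00 : 0 <= c <= c by rewrite lexx ltW.
have z0 : 0 <= (0 : R) <= c by rewrite lexx ltW.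
have int1 u : loc_int u -> mu.-integrable setT (fun v => (u v * \1_(obox a b) v)%:E).
  by move=> ul; have := int0 _ _ ul z0; under eq_fun do rewrite scale0r subr0.
have int2 u : loc_int u -> mu.-integrable setT (fun v => (u v * box_steklov i c a b v)%:E).
  move=> ul; apply: (@integrable_locM _ _ _ _ c r) => //.
  - exact: measurable_box_steklov.
  - by move=> v; have /andP[h1 h2] := box_steklov_itv i c0 a b v; rewrite ger0_norm.
  - by move=> v; apply: (box_steklov_out c0) => m w /Hr => /(_ m)[].
have [lpp lnp] := (loc_pp psil, loc_np psil).
have [lhp lhn] := (loc_pp hl, loc_np hl).
have mf (u : 'rV[R]_n -> R) : loc_int u -> measurable_fun setT u by case.
have mline u : loc_int u -> (forall v, 0 <= u v) ->
    measurable_fun (obox a b) (line_int u).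
  by move=> ul u0; apply: measurable_funTS; apply: measurable_line_int => //; exact: mf.
have mE u : loc_int u -> measurable_fun (obox a b) (fun v => (u v)%:E).
  by move=> ul; apply: measurable_funTS; apply/measurable_EFinP; exact: mf.
have mEs u : loc_int u -> measurable_fun (obox a b) (fun v => (u (v + c *: e)%R)%:E).
  move=> ul; apply: measurable_funTS; apply/measurable_EFinP.
  exact: (measurableT_comp (mf _ ul) mshift).
have split3 (f1 f2 f3 : 'rV[R]_n -> R) : loc_int f1 -> loc_int f2 -> loc_int f3 ->
    (forall v, 0 <= f1 v) -> (forall v, 0 <= f2 v) -> (forall v, 0 <= f3 v) ->
    (\int[mu]_(v in obox a b) ((f1 v)%:E + (f2 (v + c *: e)%R)%:E + line_int f3 v) =
     \int[mu]_v (f1 v * \1_(obox a b) v)%:E +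
     \int[mu]_v (f2 v * \1_(obox a b) (v - c *: e)%R)%:E +
     \int[mu]_v (f3 v * box_steklov i c a b v)%:E)%E.
  move=> l1 l2 l3 f10 f20 f30.
  rewrite ge0_integralD//; last 4 first.
  - by move=> v _; rewrite adde_ge0// lee_fin.
  - by apply: emeasurable_funD; [exact: mE|exact: mEs].
  - by move=> v _; exact: line_int_ge0.
  - exact: mline.
  rewrite ge0_integralD//; last 4 first.
  - by move=> v _; rewrite lee_fin.
  - exact: mE.
  - by move=> v _; rewrite lee_fin.
  - exact: mEs.
  rewrite integral_indicM integral_indic_shift//; last exact: mf.
  by rewrite integral_box_steklov//; exact: mf.
have fin1 u : loc_int u -> exists x : R, (\int[mu]_v (u v * \1_(obox a b) v)%:E = x%:E)%E.
  move=> ul; eexists; apply/esym/fineK; exact: integrable_fin_num (int1 _ ul).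
have fins u : loc_int u ->
    exists x : R, (\int[mu]_v (u v * \1_(obox a b) (v - c *: e)%R)%:E = x%:E)%E.
  move=> ul; eexists; apply/esym/fineK; exact: integrable_fin_num (int0 _ _ ul c00).
have fin2 u : loc_int u -> exists x : R, (\int[mu]_v (u v * box_steklov i c a b v)%:E = x%:E)%E.
  move=> ul; eexists; apply/esym/fineK; exact: integrable_fin_num (int2 _ ul).
rewrite !split3//.
have := weak_partial_box c0 a b wd.
have -> : (\int[mu]_v (psi v * (\1_(obox a b) v - \1_(obox a b) (v - c *: e)%R))%:E =
    (\int[mu]_v (pp psi v * \1_(obox a b) v)%:E +
     \int[mu]_v (np psi v * \1_(obox a b) (v - c *: e)%R)%:E) -
    (\int[mu]_v (np psi v * \1_(obox a b) v)%:E +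
     \int[mu]_v (pp psi v * \1_(obox a b) (v - c *: e)%R)%:E))%E.
  rewrite -!integralD//; [|exact: int1|exact: int0|exact: int1|exact: int0].
  rewrite -integralB//; [|by apply: integrableD => //; [exact: int1|exact: int0]..].
  apply: eq_integral => v _; rewrite -!EFinD; congr EFin.
  by rewrite {1}(ppB psi v); ring.
have -> : (\int[mu]_v (h v * box_steklov i c a b v)%:E =
    \int[mu]_v (pp h v * box_steklov i c a b v)%:E -
    \int[mu]_v (np h v * box_steklov i c a b v)%:E)%E.
  rewrite -integralB//; [|exact: int2..].
  by apply: eq_integral => v _; rewrite -EFinB -mulrBl -ppB.
(* All six integrals are finite, so the terms can be moved across the equality as real numbers. *)
have [x1 ->] := fin1 _ lpp; have [x2 ->] := fin1 _ lnp.
have [x3 ->] := fins _ lpp; have [x4 ->] := fins _ lnp.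
have [x5 ->] := fin2 _ lhp; have [x6 ->] := fin2 _ lhn.
move=> /(congr1 fine)/= H; split; last exact: ltry.
apply: (congr1 (@EFin R)); move: H.
move: x1 x2 x3 x4 x5 x6 => x1 x2 x3 x4 x5 x6 H; lra.
Qed.

Let lpsi : loc_int psi. Proof. by have [/locally_integrable_loc_int] := wd. Qed.
Let lh : loc_int h. Proof. by have [_ /locally_integrable_loc_int] := wd. Qed.
Let mpsi : measurable_fun setT psi. Proof. by case: lpsi. Qed.
Let mh : measurable_fun setT h. Proof. by case: lh. Qed.

Let mshift (u : 'rV[R]_n -> R) t : measurable_fun setT u ->
  measurable_fun setT (fun v : 'rV[R]_n => u (v + t *: e)).
Proof.
move=> mu_; apply: (measurableT_comp mu_).
by apply: measurable_addrV => //; exact: measurable_cst.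
Qed.

Let mline (u : 'rV[R]_n -> R) v : measurable_fun setT u ->
  measurable_fun `[0, c] (fun t => (u (v + t *: e))%:E).
Proof.
move=> mu_; apply/measurable_EFinP; apply: measurable_funTS.
exact: (measurable_fun_pair2 v (measurable_line_pair mu_)).
Qed.

Local Notation habs := (fun w => `|h w|).
Local Notation h2 := (fun w => h w ^+ 2).

(** The two sides of [box_identity] have equal finite integrals over every box, so their integrands
    agree almost everywhere. Where the line integral of |h| is infinite the inequality is trivial;
    elsewhere both line integrals are finite and the identity can be rearranged. *)
Lemma ae_difference_le : {ae mu, forall v,
  (`|psi (v + c *: e)%R - psi v|%R%:E <= line_int habs v)%E}.
Proof.
have mpp f : loc_int f -> measurable_fun setT (pp f) by move=> /loc_pp[].
have mnp f : loc_int f -> measurable_fun setT (np f) by move=> /loc_np[].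
have F0 (f1 f2 f3 : 'rV[R]_n -> R) v : (forall v, 0 <= f1 v) ->
    (forall v, 0 <= f2 v) -> (forall v, 0 <= f3 v) ->
    (0 <= (f1 v)%:E + (f2 (v + c *: e)%R)%:E + line_int f3 v)%E.
  move=> f10 f20 f30; apply: adde_ge0; last exact: line_int_ge0.
  by apply: adde_ge0; rewrite lee_fin.
have mF (f1 f2 f3 : 'rV[R]_n -> R) : measurable_fun setT f1 ->
    measurable_fun setT f2 -> measurable_fun setT f3 -> (forall v, 0 <= f3 v) ->
    measurable_fun setT (fun v => (f1 v)%:E + (f2 (v + c *: e)%R)%:E + line_int f3 v)%E.
  move=> m1 m2 m3 f30; apply: emeasurable_funD; last exact: measurable_line_int.
  apply: emeasurable_funD; apply/measurable_EFinP => //; exact: mshift.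
have := boxes_ae_eq (mF _ _ _ (mpp _ lpsi) (mnp _ lpsi) (mpp _ lh) (pp0 h))
  (fun v => F0 _ _ _ v (pp0 psi) (np0 psi) (pp0 h))
  (mF _ _ _ (mnp _ lpsi) (mpp _ lpsi) (mnp _ lh) (np0 h))
  (fun v => F0 _ _ _ v (np0 psi) (pp0 psi) (np0 h))
  (fun a b => (box_identity a b).1) (fun a b => (box_identity a b).2).
apply: filterS => v.
have -> : line_int habs v = (line_int (pp h) v + line_int (np h) v)%E.
  rewrite /line_int -ge0_integralD//.
  - by apply: eq_integral => t _; rewrite -EFinD -ppD.
  - by move=> t _; rewrite lee_fin.
  - by apply: mline; exact: mpp.
  - by move=> t _; rewrite lee_fin.
  - by apply: mline; exact: mnp.
have := line_int_ge0 v (pp0 h); have := line_int_ge0 v (np0 h).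
rewrite (ppB psi v) (ppB psi (v + c *: e)).
move: (pp psi v) (np psi v) (pp psi _) (np psi _) => x1 x2 x3 x4.
case: (line_int (pp h) v) => [r| |]; case: (line_int (np h) v) => [s| |] //=;
  rewrite ?addye ?addey ?leey//.
rewrite !lee_fin => s0 r0 /(congr1 fine)/= H.
by rewrite ler_norml; apply/andP; split; lra.
Qed.

(** The Cauchy-Schwarz inequality on [0, c], with the AM-GM weight tuned to D so that half of D is
    absorbed on the left. An infinite integral of h^2 makes the claim trivial. *)
Lemma line_int_sqr (D : R) v : (D%:E <= line_int habs v)%E -> 0 <= D ->
  ((D ^+ 2)%:E <= c%:E * line_int h2 v)%E.
Proof.
move=> DI; rewrite le_eqVlt => /orP[/eqP <-|D0].
  rewrite expr0n/= mule_ge0 ?lee_fin ?(ltW c0)//.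
  by apply: line_int_ge0 => w; exact: sqr_ge0.
have m2 : measurable_fun setT h2 by exact: measurable_funX.
(* AM-GM: |h| <= D / (2 c) + c h^2 / (2 D). *)
have H : (line_int habs v <=
    (D / 2)%:E + (c / (2 * D))%:E * line_int h2 v)%E.
  have -> : ((D / 2)%:E = \int[lebesgue_measure]_(t in `[0%R, c]) (cst (D / c / 2)%:E) t)%E.
    rewrite integral_cst//= lebesgue_measure_itv/= lte_fin c0 oppr0 adde0 -EFinM.
    by congr EFin; field; rewrite gt_eqF.
  rewrite /line_int -ge0_integralZl_EFin//; last 3 first.
  - by move=> t _; rewrite lee_fin sqr_ge0.
  - exact: (mline (u := h2)).
  - by rewrite divr_ge0 ?(ltW c0)// mulr_ge0// ltW.
  rewrite -ge0_integralD//; last 3 first.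
  - by move=> t _; rewrite lee_fin divr_ge0// divr_ge0// ltW.
  - by move=> t _; rewrite mule_ge0 ?lee_fin ?sqr_ge0// divr_ge0 ?(ltW c0)// mulr_ge0// ltW.
  - by apply: emeasurable_funM => //; exact: (mline (u := h2)).
  apply: ge0_le_integral => //.
  - by apply: (mline (u := habs)); exact: measurableT_comp.
  - apply: emeasurable_funD => //; apply: emeasurable_funM => //.
    exact: (mline (u := h2)).
  - move=> t _; rewrite -EFinM -EFinD lee_fin.
    set x := h _; rewrite -[x ^+ 2]real_normK ?num_real//.
    move: (`|x|) => {}x; rewrite -subr_ge0.
    have -> : D / c / 2 + c / (2 * D) * x ^+ 2 - x = c / (2 * D) * (x - D / c) ^+ 2.
      by field; rewrite !gt_eqF.
    by rewrite mulr_ge0 ?sqr_ge0// divr_ge0 ?(ltW c0)// mulr_ge0// ltW.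
have {}DI := le_trans DI H.
have := line_int_ge0 v (fun w => sqr_ge0 (h w)).
move: DI; case: (line_int _ v) => [I| |//].
  move=> DI _.
  have {}DI : D <= D / 2 + c / (2 * D) * I by exact: DI.
  suff : D ^+ 2 <= c * I by exact.
  have : D / 2 <= c / (2 * D) * I by lra.
  rewrite mulrAC ler_pdivlMr ?mulr_gt0// (_ : D / 2 * _ = D ^+ 2)//.
  by field.
by move=> _ _; rewrite gt0_muley ?lte_fin// leey.
Qed.

(** One factor c comes from Cauchy-Schwarz on the segment. The other is the length of [0, c]: after
    Tonelli, every translate of h^2 has the same integral. *)
Lemma difference_L2_pos :
  (\int[mu]_v ((psi (v + c *: e)%R - psi v) ^+ 2)%:E <=
   (c ^+ 2)%:E * \int[mu]_v (h v ^+ 2)%:E)%E.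
Proof.
have m2 : measurable_fun setT h2 by exact: measurable_funX.
have h20 w : 0 <= h w ^+ 2 by exact: sqr_ge0.
have ml := measurable_line_int m2 h20.
apply: (@le_trans _ _ (\int[mu]_v (c%:E * line_int h2 v))%E).
  apply: ae_ge0_le_integral => //.
  - by move=> v _; rewrite lee_fin sqr_ge0.
  - apply/measurable_EFinP; apply: measurable_funX; apply: measurable_funB => //.
    exact: mshift.
  - by move=> v _; rewrite mule_ge0 ?lee_fin ?(ltW c0)// line_int_ge0.
  - exact: emeasurable_funM.
  - move: ae_difference_le; apply: filterS => v H _.
    have := line_int_sqr H (normr_ge0 _).
    by rewrite real_normK ?num_real.
rewrite ge0_integralZl_EFin ?(ltW c0)//; last by move=> v _; exact: line_int_ge0.
rewrite expr2 EFinM -muleA lee_wpmul2l ?lee_fin ?(ltW c0)//.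
rewrite (@tonelli_on _ _ _ _ _ mu (@lebesgue_measure R) _ (measurable_itv `[0, c])
  (fun z : 'rV[R]_n * measurableTypeR R => (h (z.1 + z.2 *: e) ^+ 2)%:E)); last 2 first.
- by apply/measurable_EFinP; exact: (measurable_line_pair m2).
- by move=> z; rewrite lee_fin.
under eq_integral => t _.
  rewrite /= (ge0_integral_translation (t *: e) (f := fun w => (h w ^+ 2)%:E)).
  over.
  exact/measurable_EFinP.
  by move=> w; rewrite lee_fin.
rewrite integral_cst//= lebesgue_measure_itv/= lte_fin c0 oppr0 adde0 muleC.
exact: lexx.
Qed.

End difference_quotient.

(** * Translations in arbitrary directions *)

Section translation_L2.
Context {R : realType} {n : nat}.
Local Notation mu := (lebesgue_rV R n).
Variables (psi : 'rV[R]_n -> R) (h : 'I_n -> 'rV[R]_n -> R).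
Hypothesis wd : forall i, is_weak_partial i psi (h i).
Hypothesis mpsi : measurable_fun setT psi.

Let mshift y : measurable_fun setT (fun v : 'rV[R]_n => psi (v + y)).
Proof.
by apply: (measurableT_comp mpsi); apply: measurable_addrV => //; exact: measurable_cst.
Qed.

Let msqr y z :
  measurable_fun setT (fun v : 'rV[R]_n => ((psi (v + y) - psi (v + z)) ^+ 2)%:E).
Proof.
by apply/measurable_EFinP; apply: measurable_funX; exact: measurable_funB.
Qed.

(** For c < 0, translating the variable by [- c *: e] exchanges the two points of the difference and
    reduces to a positive step. *)
Lemma difference_L2 i (c : R) :
  (\int[mu]_v ((psi (v + c *: delta_mx ord0 i)%R - psi v) ^+ 2)%:E <=
   (c ^+ 2)%:E * \int[mu]_v (h i v ^+ 2)%:E)%E.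
Proof.
have [c0|c0|<-] := ltgtP 0 c; first exact: difference_L2_pos (wd i).
- set e := delta_mx _ _.
  have Nc0 : 0 < - c by rewrite oppr_gt0.
  rewrite -sqrrN; apply: le_trans _ (difference_L2_pos Nc0 (wd i)).
  rewrite -(ge0_integral_translation ((- c) *: e)).
  + rewrite le_eqVlt; apply/orP; left; apply/eqP.
    apply: eq_integral => v _; rewrite -addrA -scalerDl addNr scale0r addr0.
    by rewrite -sqrrN opprB.
  + by have := msqr (c *: e) 0; under eq_fun do rewrite addr0.
  + by move=> v; rewrite lee_fin sqr_ge0.
- rewrite expr0n/= mul0e scale0r.
  by under eq_integral do rewrite addr0 subrr expr0n; rewrite integral0.
Qed.

(** The translation is made one coordinate at a time; each step uses [(a + b)^2 <= 2 a^2 + 2 b^2],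
    whence the power of 2. *)
Lemma translation_L2_seq (y : 'rV[R]_n) (s : seq 'I_n) :
  (\int[mu]_v ((psi (v + \sum_(j <- s) y ord0 j *: delta_mx ord0 j)%R - psi v) ^+ 2)%:E <=
   (2 ^+ size s)%:E * \sum_(j <- s) ((y ord0 j ^+ 2)%:E * \int[mu]_v (h j v ^+ 2)%:E))%E.
Proof.
elim: s => [|i s IH].
  rewrite !big_nil mule0; under eq_integral do rewrite addr0 subrr expr0n.
  by rewrite integral0.
rewrite !big_cons; set z := \sum_(j <- s) _ in IH *; set w := _ *: _.
set S := (\sum_(j <- s) _)%E in IH *.
have S0 : (0 <= S)%E.
  by apply: sume_ge0 => j _; rewrite mule_ge0 ?integral_ge0// => *; rewrite lee_fin sqr_ge0.
have Hi := difference_L2 i (y ord0 i).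
have m1 : measurable_fun setT
    (fun v : 'rV[R]_n => ((psi ((v + z) + w)%R - psi (v + z)%R) ^+ 2)%:E).
  by have := msqr (z + w) z; under eq_fun do rewrite addrA.
have m2 : measurable_fun setT (fun v : 'rV[R]_n => ((psi (v + z)%R - psi v) ^+ 2)%:E).
  by have := msqr z 0; under eq_fun do rewrite addr0.
apply: (@le_trans _ _ (\int[mu]_v (2%:E * ((psi ((v + z) + w)%R - psi (v + z)%R) ^+ 2)%:E +
   2%:E * ((psi (v + z)%R - psi v) ^+ 2)%:E))%E).
  apply: ge0_le_integral => //.
  - by move=> v _; rewrite lee_fin sqr_ge0.
  - by have := msqr (w + z) 0; under eq_fun do rewrite addr0.
  - by apply: emeasurable_funD; exact: emeasurable_funM.
  - move=> v _; rewrite -!EFinM -EFinD lee_fin (addrC w) addrA -subr_ge0.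
    set A := psi _; set B := psi (v + z); set C := psi v.
    by rewrite (_ : _ - _ = (A - B - (B - C)) ^+ 2) ?sqr_ge0//; ring.
rewrite ge0_integralD//; last 4 first.
- by move=> v _; rewrite mule_ge0// lee_fin sqr_ge0.
- exact: emeasurable_funM.
- by move=> v _; rewrite mule_ge0// lee_fin sqr_ge0.
- exact: emeasurable_funM.
rewrite ge0_integralZl_EFin//; last by move=> v _; rewrite lee_fin sqr_ge0.
rewrite ge0_integralZl_EFin//; last by move=> v _; rewrite lee_fin sqr_ge0.
rewrite (ge0_integral_translation z (f := fun v => ((psi (v + w)%R - psi v) ^+ 2)%:E))//; last 2 first.
- by have := msqr w 0; under eq_fun do rewrite addr0.
- by move=> v; rewrite lee_fin sqr_ge0.
rewrite [leRHS]ge0_muleDr//; last first.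
  by rewrite mule_ge0 ?integral_ge0// => *; rewrite lee_fin sqr_ge0.
rewrite /= exprS EFinM leeD//.
  apply: (le_trans (lee_wpmul2l _ Hi)); first by rewrite lee_fin.
  apply: lee_wpmul2r.
    by rewrite mule_ge0 ?integral_ge0// => *; rewrite lee_fin sqr_ge0.
  by rewrite -EFinM lee_fin ler_peMr// exprn_ege1// ler1n.
by rewrite -muleA lee_wpmul2l// lee_fin.
Qed.

Lemma translation_L2 (l : R) (y : 'rV[R]_n) : cube 0 l y ->
  (\int[mu]_v ((psi (v + y)%R - psi v) ^+ 2)%:E <=
   (2 ^+ n * l ^+ 2)%:E * \sum_(j < n) \int[mu]_v (h j v ^+ 2)%:E)%E.
Proof.
move=> yl; have := translation_L2_seq y (index_enum 'I_n).
have -> : \sum_(j <- index_enum 'I_n) y ord0 j *: delta_mx ord0 j = y.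
  by rewrite [RHS]matrix_sum_delta big_ord1.
move=> /le_trans; apply; rewrite /index_enum -enumT size_enum_ord enumT EFinM -muleA.
rewrite lee_wpmul2l// ?lee_fin ?exprn_ge0//.
rewrite ge0_sume_distrr; last first.
  by move=> j _; apply: integral_ge0 => v _; rewrite lee_fin sqr_ge0.
apply: lee_sum => j _; rewrite lee_wpmul2r//.
  by apply: integral_ge0 => v _; rewrite lee_fin sqr_ge0.
have := yl j; rewrite mxE subr0 lee_fin -(real_normK (num_real (y ord0 j))) => h1.
by rewrite lerXn2r// nnegrE (le_trans _ h1).
Qed.

End translation_L2.

(** * Riesz potentials of functions in L^q *)

Section reflection.
Context {R : realType} {n : nat}.
Local Notation mu := (lebesgue_rV R n).

Lemma lebesgue_rV_reflection (x : 'rV[R]_n) (A : set 'rV[R]_n) : measurable A ->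
  pushforward mu (fun v => x - v) A = mu A.
Proof.
move=> mA.
have mt : measurable_fun setT (fun v : 'rV[R]_n => x - v).
  by apply: measurable_subrV => //; exact: measurable_cst.
pose mt_mixin := isMeasurableFun.Build _ _ _ _ _ mt.
pose mt_pack : {mfun _ >-> _} := HB.pack (fun v : 'rV[R]_n => x - v) mt_mixin.
have pE a b : (fun v : 'rV[R]_n => x - v) @^-1` obox a b =
    obox (fun i => x ord0 i - b i) (fun i => x ord0 i - a i).
  by apply/seteqP; split => v /= H i; have /andP[h1 h2] := H i;
     move: h1 h2; rewrite !mxE => h1 h2; apply/andP; split; lra.
apply: (@oboxes_measure_unique _ _ (pushforward mu mt_pack)) => //.
- move=> a b ab; rewrite [LHS](_ : _ = mu (obox (fun i => x ord0 i - b i)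
     (fun i => x ord0 i - a i))) ?pE//; last by rewrite -pE.
  rewrite [RHS]lebesgue_obox// lebesgue_obox.
    by congr EFin; apply: eq_bigr => i _; ring.
  by move=> i; rewrite lerB.
- move=> a b; rewrite [ltLHS](_ : _ = mu (obox (fun i => x ord0 i - b i)
     (fun i => x ord0 i - a i))); last by rewrite -pE.
  set a' := fun _ => _; set b' := fun _ => _.
  apply: (@le_lt_trans _ _ (mu (obox a' (fun i => Num.max (a' i) (b' i))))).
    apply: le_measure; rewrite ?inE; [exact: measurable_obox..|].
    by move=> v /= H i; have := H i; rewrite lt_max => /andP[-> ->]; rewrite orbT.
  by rewrite lebesgue_obox ?ltry// => i; rewrite le_max lexx.
Qed.

Lemma ge0_integral_reflection (x : 'rV[R]_n) (f : 'rV[R]_n -> \bar R) :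
  measurable_fun setT f -> (forall v, 0 <= f v)%E ->
  (\int[mu]_v f (x - v)%R = \int[mu]_v f v)%E.
Proof.
move=> mf f0.
have mt : measurable_fun setT (fun v : 'rV[R]_n => x - v).
  by apply: measurable_subrV => //; exact: measurable_cst.
have := @ge0_integral_pushforward _ _ _ _ _ _ mt mu setT f
  measurableT mf (fun v _ => f0 v).
rewrite preimage_setT => <-.
by apply: eq_measure_integral => A mA _; exact: lebesgue_rV_reflection.
Qed.

Lemma cube_avgE l (V : 'rV[R]_n -> \bar R) x : measurable_fun setT V ->
  (forall v, 0 <= V v)%E ->
  (cube_avg l V x = ((l *+ 2) ^+ n)^-1%:E * \int[mu]_(v in cube x l) V v)%E.
Proof.
move=> mV V0; rewrite /cube_avg; congr (_ * _)%E.
rewrite integral_mkcond [RHS]integral_mkcond.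
rewrite -[RHS](ge0_integral_reflection x).
- apply: eq_integral => y _; rewrite !patchE; congr (if _ then _ else _).
  apply/idP/idP; rewrite !inE => H i; have := H i; rewrite !mxE.
    by rewrite subr0 addrAC subrr add0r normrN.
  by rewrite addrAC subrr add0r normrN subr0.
- apply/(measurable_restrictT _ _).1; first exact: measurable_cube.
  exact: measurable_funTS.
- exact: erestrict_ge0.
Qed.

End reflection.

Section hoelder_cube.
Context {R : realType} {n : nat}.
Local Notation mu := (lebesgue_rV R n).

(** Hoelder's inequality against the indicator of the cube, whose norm in the conjugate exponent is
    the volume to the power [1 - 1/q]. *)
Lemma hoelder_cube (q N r : R) (G : 'rV[R]_n -> R) x : 1 < q -> 0 <= r ->
  measurable_fun setT G -> (forall v, 0 <= G v) ->
  ('N[mu]_(q%:E)[EFin \o G] = N%:E)%E ->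
  (\int[mu]_(v in cube x r) (G v)%:E <=
    (N * ((r *+ 2) ^+ n) `^ (1 - q^-1))%:E)%E.
Proof.
move=> q1 r0 mG G0 NG.
have q0 : 0 < q by exact: lt_trans q1.
have th0 : 0 < 1 - q^-1 by rewrite subr_gt0 invf_lt1.
have mc : measurable (cube x r) by exact: measurable_cube.
have mi : measurable_fun setT (\1_(cube x r) : 'rV[R]_n -> R).
  exact: measurable_indic mc.
have pq : q^-1 + (1 - q^-1)^-1^-1 = 1 by rewrite invrK addrC subrK.
have th0' : 0 < (1 - q^-1)^-1 by rewrite invr_gt0.
have := hoelder mu mG mi q0 th0' pq.
rewrite Lnorm1 NG.
have -> : (\int[mu]_v `|(EFin \o (G \* \1_(cube x r))%R) v| =
    \int[mu]_(v in cube x r) (G v)%:E)%E.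
  rewrite [RHS]integral_mkcond epatch_indic; apply: eq_integral => v _ /=.
  by rewrite ger0_norm ?mulr_ge0// EFinM.
move=> /le_trans; apply; rewrite EFinM lee_wpmul2l//.
  by rewrite -NG Lnorm_ge0.
rewrite unlock /Lnorm invrK.
have -> : (\int[mu]_v (`|(EFin \o (\1_(cube x r) : _ -> R)) v| `^ (1 - q^-1)^-1) =
    ((r *+ 2) ^+ n)%:E)%E.
  rewrite -(lebesgue_cube x r0) -[RHS]mul1e -integral_cst//.
  rewrite [RHS]integral_mkcond epatch_indic; apply: eq_integral => v _ /=.
  rewrite mul1e indicE; case: (_ \in _).
    by rewrite normr1 powR1.
  by rewrite normr0 powR0// gt_eqF// invr_gt0.
by rewrite poweR_EFin.
Qed.

End hoelder_cube.

Section riesz_kernel.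
Context {R : realType} {n : nat}.
Implicit Types (v z : 'rV[R]_n) (l r gamma : R).

Lemma enorm_ge0 v : 0 <= enorm v. Proof. exact: sqrtr_ge0. Qed.

Lemma sqr_enorm v : enorm v ^+ 2 = \sum_i v ord0 i ^+ 2.
Proof. by rewrite sqr_sqrtr// sumr_ge0// => i _; exact: sqr_ge0. Qed.

Lemma enorm_coor v i : `|v ord0 i| <= enorm v.
Proof.
rewrite -(ler_pXn2r (ltn0Sn 1)) ?nnegrE ?enorm_ge0//.
rewrite sqr_enorm real_normK ?num_real// (bigD1 i)//= lerDl sumr_ge0// => j _.
exact: sqr_ge0.
Qed.

Lemma measurable_enorm : measurable_fun setT (@enorm R n).
Proof.
apply: (measurableT_comp (continuous_measurable_fun (@sqrt_continuous R))).
by apply: measurable_sum => i; apply: measurable_funX; exact: measurable_coor.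
Qed.

Lemma enorm_out r z : ~ cube 0 r z -> r < enorm z.
Proof.
move=> /existsNP[i]; rewrite mxE subr0 => /negP; rewrite -ltNge => /lt_le_trans; apply.
exact: enorm_coor.
Qed.

Lemma enorm0_coor z : (forall i, z ord0 i = 0) -> enorm z = 0.
Proof. by move=> z0; rewrite /enorm big1 ?sqrtr0// => i _; rewrite z0 expr0n. Qed.

Lemma powR_le_neg gamma r (t : R) : gamma < 0 -> 0 < r -> r <= t ->
  t `^ gamma <= r `^ gamma.
Proof.
rewrite -(opprK gamma) oppr_lt0; move: (- gamma) => {}gamma g0 r0 rt.
rewrite !powRN lef_pV2 ?posrE ?powR_gt0//.
  by rewrite (ge0_ler_powR _ _ _ rt) ?nnegrE ?(ltW g0) ?(ltW r0)// (le_trans (ltW r0)).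
exact: lt_le_trans rt.
Qed.

(* The first terms majorize the kernel inside cube 0 l, the second ones outside. *)
Definition dyadic_kernel gamma l j z : R :=
  (l / 2 ^+ j.+1) `^ gamma * \1_(cube 0 (l / 2 ^+ j)) z +
  (l * 2 ^+ j) `^ gamma * \1_(cube 0 (l * 2 ^+ j.+1)) z.

Lemma dyadic_kernel_ge0 gamma l j z : 0 <= dyadic_kernel gamma l j z.
Proof. by rewrite addr_ge0// mulr_ge0// powR_ge0. Qed.

Lemma measurable_dyadic_kernel gamma l j :
  measurable_fun setT (dyadic_kernel gamma l j).
Proof.
by apply: measurable_funD; apply: measurable_funM => //;
  apply: measurable_indic; exact: measurable_cube.
Qed.

(** A nonzero z lies in one dyadic shell: between the cubes of half-sides [l / 2^(m+1)] and
    [l / 2^m], or between those of half-sides [l 2^m] and [l 2^(m+1)]; m is the least index for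
    which the smaller cube is left, or the larger one reached. Outside the cube of half-side r the
    Euclidean norm exceeds r, and gamma < 0 bounds the kernel by [r^gamma]. *)
Lemma riesz_kernel_le gamma l z : gamma < 0 -> 0 < l ->
  exists j, enorm z `^ gamma <= dyadic_kernel gamma l j z.
Proof.
move=> g0 l0.
(* At the origin the kernel takes the value 0 by the convention for [powR], so any j serves. *)
have [z0|] := pselect (forall i, z ord0 i = 0).
  by exists 0%N; rewrite enorm0_coor// powR0 ?lt_eqF// dyadic_kernel_ge0.
move=> /existsNP[i /eqP zi].
have [zl|zl] := pselect (cube 0 l z).
  have ex : exists j, `[< ~ cube 0 (l / 2 ^+ j.+1) z >].
    have [k Hk] := @exists_le_expr R 2 (l / `|z ord0 i|) (ltr1n _ _).
    exists k; apply/asboolP => /(_ i); rewrite mxE subr0.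
    apply/negP; rewrite -ltNge ltr_pdivrMr ?exprn_gt0//.
    move: Hk; rewrite ler_pdivrMr ?normr_gt0// mulrC => /le_lt_trans; apply.
    by rewrite exprS mulrCA ltr_pMl ?ltr1n// mulr_gt0 ?normr_gt0// exprn_gt0.
  case: (ex_minnP ex) => m /asboolP zm min_m; exists m.
  have zm' : cube 0 (l / 2 ^+ m) z.
    case: m {zm} min_m => [|m] min_m; first by rewrite expr0 divr1.
    by apply: contrapT => h; have := min_m m (introT (asboolP _) h); rewrite ltnn.
  rewrite /dyadic_kernel indicE mem_set// mulr1 -[leLHS]addr0 lerD//; last first.
    by rewrite mulr_ge0// powR_ge0.
  apply: powR_le_neg => //; first by rewrite divr_gt0// exprn_gt0.
  exact/ltW/enorm_out.
have ex : exists j, `[< cube 0 (l * 2 ^+ j.+1) z >].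
  have [N HN] := exists_nat_gt (fun i => `|z ord0 i|).
  have [k Hk] := @exists_le_expr R 2 (N%:R / l) (ltr1n _ _).
  exists k; apply/asboolP => j; rewrite mxE subr0; apply/ltW/(lt_le_trans (HN j)).
  move: Hk; rewrite ler_pdivrMr// mulrC => /le_trans; apply.
  by rewrite ler_pM2l// exprS ler_peMl ?exprn_ge0// ler1n.
case: (ex_minnP ex) => m /asboolP zm min_m; exists m.
have zm' : ~ cube 0 (l * 2 ^+ m) z.
  case: m {zm} min_m => [|m] min_m; first by rewrite expr0 mulr1.
  by move=> h; have := min_m m (introT (asboolP _) h); rewrite ltnn.
rewrite /dyadic_kernel [X in _ + _ * X]indicE mem_set// mulr1 -[leLHS]add0r lerD//.
  by rewrite mulr_ge0// powR_ge0.
apply: powR_le_neg => //; first by rewrite mulr_gt0// exprn_gt0.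
exact/ltW/enorm_out.
Qed.

End riesz_kernel.

Section riesz_potential.
Context {R : realType} {n : nat}.
Local Notation mu := (lebesgue_rV R n).
Variables (q gamma s N : R) (G : 'rV[R]_n -> R).
Hypotheses (q1 : 1 < q) (g0 : gamma < 0) (gn : - n%:R < gamma) (s0 : 0 < s).
(** The scaling relation that fixes s: kernel exponent plus the exponent of a length in Hoelder's
    inequality on a cube. *)
Hypothesis sE : gamma + n%:R * (1 - q^-1) = - (2 * s).
Hypotheses (mG : measurable_fun setT G) (G0 : forall v, 0 <= G v).
Hypothesis NG : ('N[mu]_(q%:E)[EFin \o G] = N%:E)%E.

Local Notation th := (1 - q^-1).

Let N0 : 0 <= N. Proof. by rewrite -lee_fin -NG Lnorm_ge0. Qed.

Definition riesz_potential (v : 'rV[R]_n) : \bar R :=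
  (\int[mu]_w (enorm (v - w) `^ gamma * G w)%:E)%E.

Let mGE : measurable_fun setT (fun v => (G v)%:E).
Proof. exact/measurable_EFinP. Qed.

Let msub : measurable_fun setT (fun z : 'rV[R]_n * 'rV[R]_n => z.1 - z.2).
Proof. by apply: measurable_subrV; [exact: measurable_fst|exact: measurable_snd]. Qed.

Lemma measurable_riesz_integrand : measurable_fun setT
  (fun z : 'rV[R]_n * 'rV[R]_n => (enorm (z.1 - z.2) `^ gamma * G z.2)%:E).
Proof.
apply/measurable_EFinP; apply: measurable_funM.
  apply: (measurableT_comp (measurable_powR gamma)).
  exact: (measurableT_comp measurable_enorm msub).
exact: (measurableT_comp mG measurable_snd).
Qed.

Lemma measurable_riesz_potential : measurable_fun setT riesz_potential.
Proof.
apply: (measurable_fun_fubini_tonelli_F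
  (fun z : 'rV[R]_n * 'rV[R]_n => (enorm (z.1 - z.2) `^ gamma * G z.2)%:E)).
  exact: measurable_riesz_integrand.
by move=> z; rewrite lee_fin mulr_ge0// powR_ge0.
Qed.

Lemma riesz_potential_ge0 v : (0 <= riesz_potential v)%E.
Proof. by apply: integral_ge0 => w _; rewrite lee_fin mulr_ge0// powR_ge0. Qed.

Let mpart r : measurable_fun setT
  (fun z : 'rV[R]_n * 'rV[R]_n => (\1_(cube 0 r) (z.1 - z.2) * G z.2)%:E).
Proof.
apply/measurable_EFinP; apply: measurable_funM.
  apply: (measurableT_comp _ msub).
  by apply: measurable_indic; exact: measurable_cube.
exact: (measurableT_comp mG measurable_snd).
Qed.

Let part0 r (z : 'rV[R]_n * 'rV[R]_n) : (0 <= (\1_(cube 0 r) (z.1 - z.2) * G z.2)%:E)%E.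
Proof. by rewrite lee_fin mulr_ge0. Qed.

Lemma cube_sub (v w : 'rV[R]_n) r : cube 0 r (v - w) <-> cube v r w.
Proof.
by split => H i; have := H i; rewrite !mxE subr0 distrC.
Qed.

(** For each v, Hoelder's inequality on [cube v r] bounds the inner integral uniformly; the outer
    one contributes the volume of [cube x l]. After multiplication by [r^gamma] the dependence on r
    is [r^(-2s)], which sums over large r. *)
Lemma integral_large_cube l r x : 0 <= l -> 0 <= r ->
  (\int[mu]_(v in cube x l) \int[mu]_w (\1_(cube 0 r) (v - w)%R * G w)%:E <=
   ((l *+ 2) ^+ n * (N * ((r *+ 2) ^+ n) `^ th))%:E)%E.
Proof.
move=> l0 r0.
have mc : measurable (cube x l) by exact: measurable_cube.
rewrite mulrC EFinM -(lebesgue_cube x l0) -integral_cst//.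
apply: ge0_le_integral => //.
- by move=> v _; apply: integral_ge0 => w _; exact: (part0 r (v, w)).
- apply: measurable_funTS.
  exact: (measurable_fun_fubini_tonelli_F _ (mpart r) (part0 r)).
- move=> v _ /=; apply: le_trans (hoelder_cube v q1 r0 mG G0 NG).
  rewrite [leRHS]integral_mkcond epatch_indic le_eqVlt; apply/orP; left; apply/eqP.
  apply: eq_integral => w _; rewrite /= mulrC EFinM; congr (_ * _%:E)%E.
  rewrite !indicE; congr (_ %:R); congr nat_of_bool.
  by apply/idP/idP; rewrite !inE => /cube_sub.
Qed.

(** Applying Hoelder's inequality at each v would again leave [r^(-2s)], which is not summable as r
    tends to 0. Integrating in v first gives the volume of a cube of half-side r, so [r^(gamma + n)]
    appears instead, summable since gamma > - n. Only w in [cube x (l *+ 2)] contributes, whose side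
    is [l *+ 4]. *)
Lemma integral_small_cube l r x : 0 <= r <= l ->
  (\int[mu]_(v in cube x l) \int[mu]_w (\1_(cube 0 r) (v - w)%R * G w)%:E <=
   ((r *+ 2) ^+ n * (N * ((l *+ 4) ^+ n) `^ th))%:E)%E.
Proof.
move=> /andP[r0 rl]; have l0 := le_trans r0 rl.
have mc y t : measurable (cube (y : 'rV[R]_n) t) by exact: measurable_cube.
rewrite (@tonelli_on2 _ _ _ _ _ mu mu _ setT
  (fun z : 'rV[R]_n * 'rV[R]_n => (\1_(cube 0 r) (z.1 - z.2) * G z.2)%:E))//=.
apply: (@le_trans _ _ (\int[mu]_w (((r *+ 2) ^+ n)%:E *
    ((G w)%:E * (\1_(cube x (l *+ 2)) w)%:E)))%E).
  apply: ge0_le_integral => //.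
  - by move=> w _; apply: integral_ge0 => v _; exact: (part0 r (v, w)).
  - apply: (@measurable_integral_on _ _ _ _ _ mu _ (mc x l)
      (fun p : 'rV[R]_n * 'rV[R]_n => (\1_(cube 0 r) (p.2 - p.1) * G p.1)%:E)) => //.
      apply/measurable_EFinP; apply: measurable_funM.
        apply: (measurableT_comp (measurable_indic (mc 0 r))).
        by apply: measurable_subrV; [exact: measurable_snd|exact: measurable_fst].
      exact: (measurableT_comp mG measurable_fst).
    by move=> p; rewrite lee_fin mulr_ge0.
  - apply: emeasurable_funM => //; apply: emeasurable_funM => //.
    by apply/measurable_EFinP; exact: measurable_indic.
  - move=> w _.
    have [wx|wx] := pselect (cube x (l *+ 2) w).
      have -> : \1_(cube x (l *+ 2)) w = 1 :> R by rewrite indicE mem_set.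
      rewrite mule1 muleC -(lebesgue_cube w r0).
      have -> : mu (cube w r) = (\int[mu]_v (\1_(cube w r) v : R)%:E)%E.
        by rewrite integral_indic// setIT.
      rewrite -ge0_integralZl_EFin//; last first.
        by apply/measurable_EFinP; exact: measurable_indic.
      apply: (@le_trans _ _ (\int[mu]_v (\1_(cube 0 r) (v - w)%R * G w)%:E)%E).
        apply: ge0_subset_integral => //.
          exact: (measurable_fun_pair1 w (mpart r)).
        by move=> v _; exact: (part0 r (v, w)).
      rewrite le_eqVlt; apply/orP; left; apply/eqP.
      apply: eq_integral => v _; rewrite mulrC EFinM; apply: (congr1 (fun t : R => _ * t%:E)%E).
      rewrite !indicE; congr (_ %:R); congr nat_of_bool.
      by apply/idP/idP; rewrite !inE => H i; have := H i; rewrite !mxE subr0.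
    rewrite integral0_eq; last first.
      move=> v vx; rewrite indicE memNset ?mul0r// => vw; apply: wx => i.
      have := vw i; rewrite !mxE subr0 => h1; have h2 := vx i.
      rewrite -[w ord0 i](subrK (v ord0 i)) -addrA.
      apply: (le_trans (ler_normD _ _)); rewrite mulr2n.
      by apply: lerD => //; rewrite distrC (le_trans h1).
    by rewrite !mule_ge0// lee_fin// exprn_ge0// mulrn_wge0.
rewrite ge0_integralZl_EFin//; last 3 first.
- by move=> w _; rewrite mule_ge0// lee_fin.
- apply: emeasurable_funM => //.
  by apply/measurable_EFinP; exact: measurable_indic.
- by rewrite exprn_ge0// mulrn_wge0.
rewrite EFinM lee_wpmul2l ?lee_fin ?exprn_ge0 ?mulrn_wge0//.
have H := hoelder_cube x q1 (mulrn_wge0 2 l0) mG G0 NG.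
move: H; rewrite -mulrnA; apply: le_trans.
by rewrite [leRHS]integral_mkcond epatch_indic.
Qed.

(** The ratios of the geometric series over small scales, [r^(gamma + n)], and over large ones,
    [r^(-2s)]. *)
Let alpha : R := 2 `^ (- (gamma + n%:R)).
Let beta : R := 2 `^ (- (2 * s)).
(** The power of 4 comes from Hoelder's inequality on cubes of side 4 l at small scales and 4 l 2^j
    at large ones. The factor [2^(- gamma)] appears because a small shell has outer half-side
    [l / 2^j] while the kernel is bounded at the inner one, half as large. *)
Definition riesz_const : R :=
  4 `^ (n%:R * th) * (2 `^ (- gamma) / (1 - alpha) + (1 - beta)^-1).

Let alpha01 : 0 <= alpha < 1.
Proof.
rewrite powR_ge0/= /alpha powRN invf_lt1 ?powR_gt0// powR2_gt1//.
by rewrite -ltrBlDr sub0r.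
Qed.

Let beta01 : 0 <= beta < 1.
Proof. by rewrite powR_ge0/= /beta powRN invf_lt1 ?powR_gt0// powR2_gt1// mulr_gt0. Qed.

Let powRX (x : R) : 0 <= x -> (x ^+ n) `^ th = x `^ (n%:R * th).
Proof. by move=> x0; rewrite powRrM powR_mulrn. Qed.

Lemma riesz_term_small l j : 0 < l ->
  (l / 2 ^+ j.+1) `^ gamma * (((l / 2 ^+ j) *+ 2) ^+ n * (N * ((l *+ 4) ^+ n) `^ th)) =
  (l *+ 2) ^+ n * N * l `^ (- (2 * s)) * 4 `^ (n%:R * th) * (2 `^ (- gamma) * alpha ^+ j).
Proof.
move=> l0; have l0' := ltW l0.
have -> : l *+ 4 = 4 * l by rewrite mulr_natl.
rewrite powRX ?mulr_ge0// [(4 * l) `^ _]powRM// -sE powRD_gt0//.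
rewrite [(l / _) `^ _]powRM ?invr_ge0 ?exprn_ge0//.
rewrite -mulrnAl exprMn exprVn.
have -> : (2 ^+ j.+1)^-1 `^ gamma = 2 `^ (- gamma) * 2 `^ (- (j%:R * gamma)) :> R.
  rewrite -powR_inv1 ?exprn_ge0// -powR_mulrn// -!powRrM -powRD_gt0//.
  by congr (_ `^ _); rewrite mulrSr; ring.
have -> : ((2 ^+ j) ^+ n)^-1 = 2 `^ (- (j%:R * n%:R)) :> R.
  by rewrite -exprM -powR_invn// natrM.
have -> : alpha ^+ j = 2 `^ (- (j%:R * gamma)) * 2 `^ (- (j%:R * n%:R)).
  rewrite /alpha -powR_mulrn ?powR_ge0// -powRrM -powRD_gt0//.
  by congr (_ `^ _); ring.
ring.
Qed.

Lemma riesz_term_large l j : 0 < l ->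
  (l * 2 ^+ j) `^ gamma * ((l *+ 2) ^+ n * (N * (((l * 2 ^+ j.+1) *+ 2) ^+ n) `^ th)) =
  (l *+ 2) ^+ n * N * l `^ (- (2 * s)) * 4 `^ (n%:R * th) * beta ^+ j.
Proof.
move=> l0; have l0' := ltW l0.
have -> : (l * 2 ^+ j.+1) *+ 2 = 4 * (l * 2 ^+ j) by rewrite exprS -mulr_natl; ring.
have h0 : 0 <= l * 2 ^+ j by rewrite mulr_ge0// exprn_ge0.
rewrite powRX ?mulr_ge0// [(4 * _) `^ _]powRM// !(powRM _ l0') ?exprn_ge0//.
have -> : l `^ (- (2 * s)) = l `^ gamma * l `^ (n%:R * th).
  by rewrite -sE powRD_gt0.
have -> : beta ^+ j = (2 ^+ j) `^ gamma * (2 ^+ j) `^ (n%:R * th).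
  rewrite -powRD_gt0 ?exprn_gt0//.
  by rewrite sE /beta -!powR_mulrn ?powR_ge0// -!powRrM mulrC.
ring.
Qed.

Lemma integral_dyadic l j x : 0 < l ->
  (\int[mu]_(v in cube x l) \int[mu]_w (dyadic_kernel gamma l j (v - w)%R * G w)%:E <=
   ((l *+ 2) ^+ n * N * l `^ (- (2 * s)) * 4 `^ (n%:R * th) *
     (2 `^ (- gamma) * alpha ^+ j + beta ^+ j))%:E)%E.
Proof.
move=> l0; have l0' := ltW l0.
have mc y t : measurable (cube (y : 'rV[R]_n) t) by exact: measurable_cube.
rewrite mulrDr -riesz_term_small// -riesz_term_large//.
set A := (l / 2 ^+ j.+1) `^ gamma; set B := (l * 2 ^+ j) `^ gamma.
set r1 := l / 2 ^+ j; set r2 := l * 2 ^+ j.+1.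
have r10 : 0 <= r1 by rewrite divr_ge0// exprn_ge0.
have r1l : r1 <= l by rewrite ler_pdivrMr ?exprn_gt0// ler_peMr// exprn_ege1// ler1n.
have r20 : 0 <= r2 by rewrite mulr_ge0// exprn_ge0.
have A0 : 0 <= A by exact: powR_ge0.
have B0 : 0 <= B by exact: powR_ge0.
pose P r v := (\int[mu]_w (\1_(cube 0 r) (v - w)%R * G w)%:E)%E.
have mP r : measurable_fun (cube x l) (P r).
  apply: measurable_funTS.
  exact: (measurable_fun_fubini_tonelli_F _ (mpart r) (part0 r)).
have P0 r v : (0 <= P r v)%E by apply: integral_ge0 => w _; exact: (part0 r (v, w)).
have mp v r : measurable_fun setT (fun w : 'rV[R]_n => (\1_(cube 0 r) (v - w)%R * G w)%:E).
  exact: (measurable_fun_pair2 v (mpart r)).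
have E v : (\int[mu]_w (dyadic_kernel gamma l j (v - w)%R * G w)%:E =
    A%:E * P r1 v + B%:E * P r2 v)%E.
  rewrite /P -!ge0_integralZl_EFin//; last 2 first.
  - by move=> w _; exact: (part0 r2 (v, w)).
  - by move=> w _; exact: (part0 r1 (v, w)).
  rewrite -ge0_integralD//; last 4 first.
  - by move=> w _; apply: mule_ge0; [rewrite lee_fin|exact: (part0 r1 (v, w))].
  - exact: emeasurable_funM.
  - by move=> w _; apply: mule_ge0; [rewrite lee_fin|exact: (part0 r2 (v, w))].
  - exact: emeasurable_funM.
  apply: eq_integral => w _; rewrite -!EFinM -EFinD; apply: (congr1 (@EFin R)).
  by rewrite /dyadic_kernel mulrDl !mulrA.
under eq_integral => v _ do rewrite E.
rewrite ge0_integralD//; last 4 first.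
- by move=> v _; apply: mule_ge0; rewrite ?lee_fin.
- by apply: emeasurable_funM => //; exact: mP.
- by move=> v _; apply: mule_ge0; rewrite ?lee_fin.
- by apply: emeasurable_funM => //; exact: mP.
rewrite !ge0_integralZl_EFin// EFinD; apply: leeD; rewrite EFinM; apply: lee_wpmul2l.
- by rewrite lee_fin.
- by apply: integral_small_cube; rewrite r10.
- by rewrite lee_fin.
- exact: integral_large_cube.
Qed.

Lemma integral_riesz_le l x : 0 < l ->
  (\int[mu]_(v in cube x l) riesz_potential v <=
   ((l *+ 2) ^+ n * (riesz_const * N * l `^ (- (2 * s))))%:E)%E.
Proof.
move=> l0; have l0' := ltW l0.
have mc y t : measurable (cube (y : 'rV[R]_n) t) by exact: measurable_cube.
pose k j (z : 'rV[R]_n * 'rV[R]_n) : \bar R :=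
  (dyadic_kernel gamma l j (z.1 - z.2) * G z.2)%:E.
have k0 j z : (0 <= k j z)%E by rewrite lee_fin mulr_ge0// dyadic_kernel_ge0.
have mk j : measurable_fun setT (k j).
  apply/measurable_EFinP; apply: measurable_funM.
    exact: (measurableT_comp (measurable_dyadic_kernel gamma l j) msub).
  exact: (measurableT_comp mG measurable_snd).
have mF j : measurable_fun setT (fun v => \int[mu]_w k j (v, w))%E.
  exact: (measurable_fun_fubini_tonelli_F _ (mk j) (k0 j)).
have F0 j v : (0 <= \int[mu]_w k j (v, w))%E by exact: integral_ge0.
(* At each point a single j suffices; summing over all j avoids selecting it measurably and lets the
   sum leave both integrals. *)
apply: (@le_trans _ _ (\int[mu]_(v in cube x l)
    (\sum_(j <oo) \int[mu]_w k j (v, w)))%E).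
  apply: ge0_le_integral => //.
  - by move=> v _; exact: riesz_potential_ge0.
  - by apply: measurable_funTS; exact: measurable_riesz_potential.
  - by apply: ge0_emeasurable_sum => // j _; exact: measurable_funTS.
  - move=> v _; rewrite -integral_nneseries//; last first.
      by move=> j; exact: (measurable_fun_pair2 v (mk j)).
    apply: ge0_le_integral => //.
    + by move=> w _; rewrite lee_fin mulr_ge0// powR_ge0.
    + exact: (measurable_fun_pair2 v measurable_riesz_integrand).
    + by apply: ge0_emeasurable_sum => // j _; exact: (measurable_fun_pair2 v (mk j)).
    + move=> w _; have [j Hj] := riesz_kernel_le (v - w) g0 l0.
      apply: (@le_trans _ _ (k j (v, w))).
        by rewrite lee_fin ler_wpM2r.
      apply: le_trans (nneseries_lim_ge (u_ := fun j => k j (v, w)) (P := xpredT)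
        (m := 0%N) j.+1 (fun i _ _ => k0 i (v, w))).
      by rewrite big_nat_recr//= leeDr// sume_ge0.
rewrite integral_nneseries//; last by move=> j; exact: measurable_funTS.
pose D := (l *+ 2) ^+ n * N * l `^ (- (2 * s)) * 4 `^ (n%:R * th).
have D0 : 0 <= D by rewrite !mulr_ge0 ?powR_ge0// exprn_ge0// mulrn_wge0.
have [a0 _] := andP alpha01; have [b0 _] := andP beta01.
apply: (@le_trans _ _ (\sum_(j <oo) (D * (2 `^ (- gamma) * alpha ^+ j + beta ^+ j))%:E)%E).
  apply: lee_nneseries => [j _ _|j _]; last exact: integral_dyadic.
  by apply: integral_ge0 => v _.
apply: nneseries_le => j.
  by rewrite mulr_ge0// addr_ge0 ?mulr_ge0 ?powR_ge0 ?exprn_ge0.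
rewrite -mulr_sumr big_split/= -mulr_sumr.
rewrite (_ : (l *+ 2) ^+ n * _ = D * (2 `^ (- gamma) / (1 - alpha) + (1 - beta)^-1)).
  rewrite ler_wpM2l// lerD// ?geometric_partial_le//.
  by rewrite ler_wpM2l ?powR_ge0// geometric_partial_le.
by rewrite /D /riesz_const; ring.
Qed.

Lemma morrey_riesz : morrey (riesz_const * N) s riesz_potential.
Proof.
split; [exact: measurable_riesz_potential|exact: riesz_potential_ge0|].
move=> l x l0; rewrite cube_avgE; last 2 first.
- exact: measurable_riesz_potential.
- exact: riesz_potential_ge0.
have c0 : 0 < (l *+ 2) ^+ n by rewrite exprn_gt0// mulrn_wgt0.
rewrite lee_pdivrMl// -EFinM; exact: integral_riesz_le.
Qed.

Lemma riesz_const_ge0 : 0 <= riesz_const.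
Proof.
have [_ a1] := andP alpha01; have [_ b1] := andP beta01.
by rewrite mulr_ge0 ?powR_ge0// addr_ge0// ?divr_ge0 ?powR_ge0// ?invr_ge0 subr_ge0 ltW.
Qed.

End riesz_potential.

(** * The interpolation inequality *)

Section bracket_lemmas.
Context {R : realType} {n : nat}.
Implicit Types (v w : 'rV[R]_n).

Lemma bracket_ge1 v : 1 <= bracket v.
Proof. by rewrite /bracket -[leLHS]sqrtr1 ler_wsqrtr// lerDl sqr_ge0. Qed.

Lemma bracket_gt0 v : 0 < bracket v.
Proof. exact: lt_le_trans (bracket_ge1 v). Qed.

Lemma measurable_bracket : measurable_fun setT (@bracket R n).
Proof.
apply: (measurableT_comp (continuous_measurable_fun (@sqrt_continuous R))).
by apply: measurable_funD => //; apply: measurable_funX; exact: measurable_enorm.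
Qed.

Lemma sqr_bracket v : bracket v ^+ 2 = 1 + \sum_i v ord0 i ^+ 2.
Proof. by rewrite sqr_sqrtr ?sqr_enorm// addr_ge0// sumr_ge0// => i _; exact: sqr_ge0. Qed.

(** From [<v>^2 <= 2 <w>^2 + 2 |v - w|^2]; coordinate by coordinate the difference is the square of
    [v - 2 w]. *)
Lemma bracket_le_max v w : bracket v <= 2 * Num.max (bracket w) (enorm (v - w)).
Proof.
set m := Num.max _ _.
have m1 : bracket w <= m by rewrite le_max lexx.
have m2 : enorm (v - w) <= m by rewrite le_max lexx orbT.
have m0 : 0 <= m by exact: le_trans (enorm_ge0 _) m2.
rewrite -(ler_pXn2r (ltn0Sn 1)) ?nnegrE ?mulr_ge0 ?(ltW (bracket_gt0 _))//.
have h1 : bracket w ^+ 2 <= m ^+ 2 by rewrite lerXn2r ?nnegrE// ltW// bracket_gt0.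
have h2 : enorm (v - w) ^+ 2 <= m ^+ 2 by rewrite lerXn2r ?nnegrE ?enorm_ge0.
have h3 : bracket v ^+ 2 <= 2 * bracket w ^+ 2 + 2 * enorm (v - w) ^+ 2.
  rewrite !sqr_bracket sqr_enorm mulrDr -addrA mulr1 lerD//; first by lra.
  rewrite !mulr_sumr -big_split/= ler_sum// => i _.
  rewrite !mxE -subr_ge0 [X in 0 <= X](_ : _ = (v ord0 i - 2 * w ord0 i) ^+ 2) ?sqr_ge0//.
  by ring.
apply: (le_trans h3); rewrite exprMn.
move: (m ^+ 2) (bracket w ^+ 2) (enorm _ ^+ 2) h1 h2 => x y z h1 h2; lra.
Qed.

(** If [<w> <= |v - w|] then [<v> <= 2 |v - w|] and the negative power cancels the weight; otherwise
    [<v> <= 2 <w>]. For v = w the left side is 0, since [powR] gives 0 at 0. *)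
Lemma bracket_riesz_le (gamma : R) v w : gamma < 0 ->
  bracket v `^ `|gamma| * enorm (v - w) `^ gamma <=
  2 `^ `|gamma| * (1 + enorm (v - w) `^ gamma * bracket w `^ `|gamma|).
Proof.
move=> g0; set a := `|gamma|.
have a0 : 0 <= a by exact: normr_ge0.
have gE : gamma = - a by rewrite /a ltr0_norm// opprK.
have [e0|e0] := eqVneq (enorm (v - w)) 0.
  by rewrite e0 powR0 ?lt_eqF// mulr0 mul0r addr0 mulr1 powR_ge0.
have {}e0 : 0 < enorm (v - w) by rewrite lt_neqAle eq_sym e0 enorm_ge0.
have bv0 := ltW (bracket_gt0 v); have bw0 := ltW (bracket_gt0 w).
have := bracket_le_max v w; have [le|lt] := leP (bracket w) (enorm (v - w)).
- move=> H; rewrite mulrDr mulr1 -[leLHS]addr0 lerD//; last first.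
    by rewrite !mulr_ge0 ?powR_ge0.
  rewrite gE powRN ler_pdivrMr ?powR_gt0// -powRM ?(ltW e0)//.
  by apply: ge0_ler_powR H; rewrite ?nnegrE ?mulr_ge0 ?(ltW e0).
- move=> H; rewrite mulrDr mulr1 -[leLHS]add0r lerD ?powR_ge0//.
  rewrite [leRHS]mulrCA [leLHS]mulrC ler_wpM2l ?powR_ge0//.
  rewrite -powRM//.
  by apply: ge0_ler_powR H; rewrite ?nnegrE ?mulr_ge0.
Qed.

End bracket_lemmas.

Section sphere.
Context {R : realType} {n : nat}.

Lemma enormZ (r : R) (u : 'rV[R]_n) : 0 <= r -> enorm (r *: u) = r * enorm u.
Proof.
move=> r0; rewrite /enorm -[r in RHS](ger0_norm r0) -sqrtr_sqr -sqrtrM ?sqr_ge0//.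
by congr Num.sqrt; rewrite mulr_sumr; apply: eq_bigr => i _; rewrite mxE exprMn.
Qed.

(** The cone over the sphere is the punctured unit ball, which lies in [cube 0 1]. The value itself
    is absorbed in the final constant. *)
Lemma sphere_measure_fin : exists2 x : R, 0 <= x &
  sphere_measure (@unit_sphere R n) = x%:E.
Proof.
rewrite /sphere_measure.
have -> : [set v | exists r u, [/\ 0 < r <= 1, @unit_sphere R n u & v = r *: u]] =
    [set v : 'rV[R]_n | 0 < enorm v <= 1].
  apply/seteqP; split => [v [r [u [/andP[r0 r1] u1 ->]]]|v /= /andP[v0 v1]] /=.
    by rewrite (enormZ _ (ltW r0)) u1 mulr1 r0.
  exists (enorm v), ((enorm v)^-1 *: v); split; first by rewrite v0.
    by rewrite /unit_sphere/= enormZ ?invr_ge0 ?(ltW v0)// mulVf// gt_eqF.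
  by rewrite scalerA mulfV ?scale1r// gt_eqF.
set B := [set v : 'rV[R]_n | _].
have mB : measurable B.
  rewrite (_ : B = enorm @^-1` `]0, 1]%classic).
    by rewrite -[X in measurable X]setTI; apply: measurable_enorm => //; exact: measurable_itv.
  by apply/seteqP; split => v /=; rewrite in_itv.
have BE : lebesgue_rV R n B \is a fin_num.
  rewrite ge0_fin_numE//; apply: (@le_lt_trans _ _ (lebesgue_rV R n (cube 0 1))).
    apply: le_measure; rewrite ?inE//; first exact: measurable_cube.
    move=> v /= /andP[_ v1] i; rewrite mxE subr0.
    exact: le_trans (enorm_coor v i) v1.
  by rewrite lebesgue_cube// ltry.
exists (n%:R * fine (lebesgue_rV R n B)); first by rewrite mulr_ge0// fine_ge0.
by rewrite EFinM fineK.
Qed.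

End sphere.

(** * Choice of the scale *)

Section optimization.
Context {R : realType}.

(** The scale solves [B l^(2 - 2 s) = eps], so the coefficient of I is exactly eps. *)
Lemma optimize_scale (s eps B F I : R) : 0 < s < 1 -> 0 < eps -> 0 < B ->
  exists2 l, 0 < l & B * (l `^ (- (2 * s)) * F + l `^ (2 - 2 * s) * I) =
    eps * I + eps `^ (- (s / (1 - s))) * B `^ (1 / (1 - s)) * F.
Proof.
move=> /andP[s0 s1] e0 B0.
have s10 : 1 - s != 0 by rewrite subr_eq0 eq_sym lt_eqF.
have eB : 0 < eps / B by rewrite divr_gt0.
exists ((eps / B) `^ (2 * (1 - s))^-1); first exact: powR_gt0.
rewrite -!powRrM.
have -> : (2 * (1 - s))^-1 * (2 - 2 * s) = 1 by field.
have -> : (2 * (1 - s))^-1 * - (2 * s) = - (s / (1 - s)) by field.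
rewrite powRr1 ?(ltW eB)//.
have -> : (eps / B) `^ (- (s / (1 - s))) = eps `^ (- (s / (1 - s))) * B `^ (s / (1 - s)).
  rewrite powRM ?invr_ge0 ?(ltW e0) ?(ltW B0)//; congr (_ * _).
  by rewrite -powR_inv1 ?(ltW B0)// -powRrM mulrNN mul1r.
have -> : B `^ (1 / (1 - s)) = B * B `^ (s / (1 - s)).
  rewrite -[B in RHS]powRr1 ?(ltW B0)// -powRrM mul1r -powRD_gt0//.
  by congr (_ `^ _); field.
by field; rewrite gt_eqF.
Qed.

(** The single constant dominates K1, needed for g, and [K2^(1/(1-s))], which the optimal scale
    produces for N. *)
Lemma interpolation_bound (s eps K1 K2 g N F I : R) (X : \bar R) :
  0 < s < 1 -> 0 < eps -> 0 <= K1 -> 0 <= K2 -> 0 <= g -> 0 <= N -> 0 <= F -> 0 <= I ->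
  (forall l, 0 < l -> (X <= (K1 * g * F + K2 * N *
     (l `^ (- (2 * s)) * F + l `^ (2 - 2 * s) * I))%:E)%E) ->
  (X <= (eps * I + (1 + K1 + K2 `^ (1 / (1 - s))) *
     (g + eps `^ (- (s / (1 - s))) * N `^ (1 / (1 - s))) * F)%:E)%E.
Proof.
move=> s01 e0 K10 K20 g0 N0 F0 I0 H.
have p0 (x y : R) : 0 <= x `^ y by exact: powR_ge0.
(* Here the equation for the scale has no solution, but the term depending on l vanishes and l = 1
   serves. *)
have [B0|B0] := eqVneq (K2 * N) 0.
  apply: (le_trans (H 1 ltr01)); rewrite lee_fin B0 mul0r addr0.
  rewrite -[leLHS]add0r lerD ?mulr_ge0 ?(ltW e0)//.
  rewrite ler_wpM2r// ler_pM//.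
    by rewrite [1 + K1]addrC -addrA lerDl addr_ge0.
  by rewrite lerDl mulr_ge0.
have {}B0 : 0 < K2 * N by rewrite lt_neqAle eq_sym B0 mulr_ge0.
have [l l0 E] := optimize_scale F I s01 e0 B0.
apply: (le_trans (H l l0)); rewrite lee_fin E powRM//.
set a := K2 `^ _; set b := N `^ _; set c := eps `^ _.
have a0 : 0 <= a by exact: p0. have b0 : 0 <= b by exact: p0. have c0 : 0 <= c by exact: p0.
rewrite addrCA lerD2l -subr_ge0.
rewrite (_ : _ - _ = ((1 + a) * g + (1 + K1) * (c * b)) * F); last by ring.
by rewrite mulr_ge0// addr_ge0// mulr_ge0// ?addr_ge0// mulr_ge0.
Qed.

End optimization.

(** * From Morrey potentials and H^1 functions to the inequality *)

Section sobolev.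
Context {R : realType} {n : nat}.
Local Notation mu := (lebesgue_rV R n).

Lemma sobolev_weak_partial (psi : 'rV[R]_n -> R) i : sobolev_H1 psi ->
  is_weak_partial i psi (weak_partial i psi).
Proof.
by move=> [_ /(_ i)[h hd _]]; apply: xgetPex; exists h.
Qed.

Lemma integral_sqr_weak_grad (psi : 'rV[R]_n -> R) : sobolev_H1 psi ->
  (\int[mu]_v (enorm (weak_grad psi v) ^+ 2)%:E =
   \sum_(i < n) \int[mu]_v (weak_partial i psi v ^+ 2)%:E)%E.
Proof.
move=> H.
have mh i : measurable_fun setT (weak_partial i psi).
  by have [_ []] := sobolev_weak_partial i H.
rewrite -ge0_integral_sum//; last 2 first.
- by move=> i; apply/measurable_EFinP; exact: measurable_funX.
- by move=> i v _; rewrite lee_fin sqr_ge0.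
apply: eq_integral => v _; rewrite sqr_enorm sumEFin; apply: (congr1 (@EFin R)).
by apply: eq_bigr => i _; rewrite mxE.
Qed.

(** The translation estimate provides Gamma = 2^n I. The factor 2^n is granted to F as well, and
    joins the 2 of [form_morrey] in a single [2 ^+ n.+1]. *)
Lemma form_morrey_H1 (psi : 'rV[R]_n -> R) (M s F I l : R) V :
  0 <= M -> 0 < s < 1 -> 0 < l -> sobolev_H1 psi -> measurable_fun setT psi ->
  (\int[mu]_v (psi v ^+ 2)%:E = F%:E)%E ->
  (\int[mu]_v (enorm (weak_grad psi v) ^+ 2)%:E = I%:E)%E ->
  morrey M s V ->
  (\int[mu]_v ((psi v ^+ 2)%:E * V v) <=
   (2 ^+ n.+1 * (1 + 2 `^ s / (1 - 2 `^ (- (1 - s)))) ^+ 2 * M *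
    (l `^ (- (2 * s)) * F + l `^ (2 - 2 * s) * I))%:E)%E.
Proof.
move=> M0 s01 l0 H mpsi FE IE HV.
have F0 : 0 <= F.
  by rewrite -lee_fin -FE; apply: integral_ge0 => x _; rewrite lee_fin sqr_ge0.
have I0 : 0 <= I.
  by rewrite -lee_fin -IE; apply: integral_ge0 => x _; rewrite lee_fin sqr_ge0.
have G0 : 0 <= 2 ^+ n * I by rewrite mulr_ge0// exprn_ge0.
have trans (r : R) (y : 'rV[R]_n) : 0 < r -> cube 0 r y ->
    (\int[mu]_x ((psi (x + y)%R - psi x) ^+ 2)%:E <= (r ^+ 2 * (2 ^+ n * I))%:E)%E.
  move=> r0 yr.
  apply: le_trans (translation_L2 (fun i => sobolev_weak_partial i H) mpsi yr) _.
  by rewrite -integral_sqr_weak_grad// IE -EFinM lee_fin [_ * r ^+ 2]mulrC mulrA.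
apply: le_trans (form_morrey mpsi G0 FE trans M0 s01 l0 HV) _.
rewrite lee_fin.
set a := _ ^+ 2; set b := l `^ _; set c := l `^ _.
have a0 : 0 <= a by exact: sqr_ge0.
have b0 : 0 <= b by exact: powR_ge0.
have t1 : 1 <= 2 ^+ n :> R by rewrite exprn_ege1// ler1n.
rewrite exprS -subr_ge0.
rewrite (_ : _ - _ = 2 * a * M * (b * F) * (2 ^+ n - 1)); last by ring.
apply: mulr_ge0; last by rewrite subr_ge0.
by apply: mulr_ge0; apply: mulr_ge0 => //; apply: mulr_ge0.
Qed.

(** Hoelder's inequality on a cube of side 2 l, divided by the volume, gives [N (2 l)^(-2s)]. The
    hypothesis on s is the scaling relation for gamma = - n. *)
Lemma morrey_Lq (q s N : R) (G : 'rV[R]_n -> R) : 1 < q -> 0 < s ->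
  n%:R * (1 - q^-1) - n%:R = - (2 * s) -> measurable_fun setT G ->
  (forall v, 0 <= G v) -> ('N[mu]_(q%:E)[EFin \o G] = N%:E)%E ->
  morrey N s (EFin \o G).
Proof.
move=> q1 s0 sE mG G0 NG.
have N0 : 0 <= N by rewrite -lee_fin -NG Lnorm_ge0.
split; [exact/measurable_EFinP|by move=> v; rewrite lee_fin|].
move=> l x l0; rewrite cube_avgE; last 2 first.
- exact/measurable_EFinP.
- by move=> v; rewrite lee_fin.
have c0 : 0 < (l *+ 2) ^+ n by rewrite exprn_gt0// mulrn_wgt0.
rewrite lee_pdivrMl//; apply: le_trans (hoelder_cube x q1 (ltW l0) mG G0 NG) _.
rewrite -EFinM lee_fin mulrCA ler_wpM2l//.
have l20 : 0 < l *+ 2 by rewrite mulrn_wgt0.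
have -> : ((l *+ 2) ^+ n) `^ (1 - q^-1) = (l *+ 2) ^+ n * (l *+ 2) `^ (- (2 * s)).
  rewrite -powR_mulrn ?(ltW l20)// -powRrM -powRD_gt0//.
  by congr (_ `^ _); rewrite -sE; ring.
rewrite ler_wpM2l ?(ltW c0)//; apply: powR_le_neg => //.
  by rewrite oppr_lt0 mulr_gt0.
by rewrite mulr2n lerDl ltW.
Qed.

(** Common end of the two cases of the theorem: W stands for [phi^2 c_gamma[g]], gn for the L^1 norm
    of g, N for the weighted L^q norm, and k for the Morrey constant per unit of N. *)
Lemma form_bound_of_pointwise (s eps K1 K2 k gn N : R) (psi : 'rV[R]_n -> R)
    (W V : 'rV[R]_n -> \bar R) :
  0 < s < 1 -> 0 < eps -> 0 <= K1 -> 0 <= K2 -> 0 <= k -> 0 <= gn -> 0 <= N ->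
  measurable_fun setT psi -> sobolev_H1 psi -> morrey (k * N) s V ->
  measurable_fun setT W -> (forall v, (0 <= W v)%E) ->
  (forall v, (W v <= (K1 * gn)%:E * (psi v ^+ 2)%:E +
                     K2%:E * ((psi v ^+ 2)%:E * V v))%E) ->
  (\int[mu]_v W v <=
   eps%:E * \int[mu]_v (enorm (weak_grad psi v) ^+ 2)%:E +
   (1 + K1 + (K2 * (2 ^+ n.+1 * (1 + 2 `^ s / (1 - 2 `^ (- (1 - s)))) ^+ 2) * k)
      `^ (1 / (1 - s)))%:E *
   (gn%:E + (eps `^ (- (s / (1 - s))))%:E * N%:E `^ (1 / (1 - s))) *
   \int[mu]_v (psi v ^+ 2)%:E)%E.
Proof.
move=> s01 e0 K10 K20 k0 gn0 N0 mpsi H HV mW W0 WV.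
have [mV V0 _] := HV.
have mp2 : measurable_fun setT (fun v : 'rV[R]_n => (psi v ^+ 2)%:E).
  by apply/measurable_EFinP; exact: measurable_funX.
have p20 v : (0 <= (psi v ^+ 2)%:E)%E by rewrite lee_fin sqr_ge0.
have [F FE] : exists F, (\int[mu]_v (psi v ^+ 2)%:E = F%:E)%E.
  have [/Lfun2_integrable_sqr/integrable_fin_num Ffin _] := H.
  by exists (fine (\int[mu]_v (psi v ^+ 2)%:E)); rewrite fineK//; exact: Ffin.
have F0 : 0 <= F by rewrite -lee_fin -FE; exact: integral_ge0.
rewrite FE poweR_EFin.
set A := 2 ^+ _ * _; set C := 1 + K1 + _.
have A0 : 0 <= A by apply: mulr_ge0; [exact: exprn_ge0|exact: sqr_ge0].
have C0 : 0 <= C by rewrite addr_ge0 ?powR_ge0// addr_ge0.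
set D := (C%:E * _ * _)%E.
have DE : D = (C * (gn + eps `^ (- (s / (1 - s))) * N `^ (1 / (1 - s))) * F)%:E by [].
have I0 : (0 <= \int[mu]_v (enorm (weak_grad psi v) ^+ 2)%:E)%E.
  by apply: integral_ge0 => v _; rewrite lee_fin sqr_ge0.
(* [weak_partial] is some chosen weak derivative, not visibly the square integrable one; if its
   integral is infinite, so is the right side, because eps > 0. *)
case IE : (\int[mu]_v (enorm (weak_grad psi v) ^+ 2)%:E)%E => [I| |]; last 2 first.
- by rewrite mulry gtr0_sg// mul1e DE addye// leey.
- by rewrite IE in I0.
rewrite IE lee_fin in I0.
rewrite DE -EFinM -EFinD.
apply: interpolation_bound => //; first by do 2![apply: mulr_ge0 => //].
move=> l l0.
have VB := form_morrey_H1 (mulr_ge0 k0 N0) s01 l0 H mpsi FE IE HV.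
have mpV : measurable_fun setT (fun v : 'rV[R]_n => ((psi v ^+ 2)%:E * V v)%E).
  exact: emeasurable_funM.
have pV0 v : (0 <= (psi v ^+ 2)%:E * V v)%E by exact: mule_ge0.
have c1 : (0 <= (K1 * gn)%:E)%E by rewrite lee_fin mulr_ge0.
have c2 : (0 <= K2%:E)%E by rewrite lee_fin.
apply: (@le_trans _ _ (\int[mu]_v ((K1 * gn)%:E * (psi v ^+ 2)%:E +
    K2%:E * ((psi v ^+ 2)%:E * V v)))%E).
  apply: ge0_le_integral => //.
  by apply: emeasurable_funD; apply: emeasurable_funM.
rewrite ge0_integralD//; last 4 first.
- by move=> v _; exact: mule_ge0.
- exact: emeasurable_funM.
- by move=> v _; exact: mule_ge0.
- exact: emeasurable_funM.
rewrite ge0_integralZl// ge0_integralZl// FE.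
rewrite EFinD -EFinM; apply: leeD => //.
apply: (le_trans (lee_wpmul2l c2 VB)).
rewrite -EFinM lee_fin.
by rewrite -/A !mulrA.
Qed.

Lemma bracket_riesz_potential_le (gamma a : R) (g : 'rV[R]_n -> R) v :
  gamma < 0 -> measurable_fun setT g -> (forall w, 0 <= g w) ->
  (\int[mu]_w (g w)%:E = a%:E)%E ->
  ((bracket v `^ `|gamma|)%:E * riesz_potential gamma g v <=
   (2 `^ `|gamma|)%:E *
   (a%:E + riesz_potential gamma (fun w => bracket w `^ `|gamma| * g w)%R v))%E.
Proof.
move=> g0 mg gp <-; rewrite /riesz_potential.
have mbg : measurable_fun setT (fun w : 'rV[R]_n => bracket w `^ `|gamma| * g w).
  by apply: measurable_funM => //; exact: (measurableT_comp (measurable_powR _) measurable_bracket).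
have bg0 w : 0 <= bracket w `^ `|gamma| * g w by rewrite mulr_ge0 ?powR_ge0.
have mr G : measurable_fun setT G ->
    measurable_fun setT (fun w : 'rV[R]_n => (enorm (v - w)%R `^ gamma * G w)%:E).
  by move=> mG; exact: (measurableT_comp (measurable_riesz_integrand gamma mG) (pair1_measurable v)).
have mgE : measurable_fun setT (fun w : 'rV[R]_n => (g w)%:E) by exact/measurable_EFinP.
have r0 G w : 0 <= G w -> (0 <= (enorm (v - w)%R `^ gamma * G w)%:E)%E.
  by move=> Gw; rewrite lee_fin mulr_ge0 ?powR_ge0.
have p0 : (0 <= (2 `^ `|gamma|)%:E :> \bar R)%E by rewrite lee_fin powR_ge0.
have q0 : (0 <= (bracket v `^ `|gamma|)%:E)%E by rewrite lee_fin powR_ge0.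
have m1 := mr _ mg; have m2 := mr _ mbg.
have n0 w : (0 <= (enorm (v - w)%R `^ gamma * g w)%:E)%E by exact: r0.
have n1 w : (0 <= (g w)%:E)%E by rewrite lee_fin.
have n2 w := r0 (fun w => bracket w `^ `|gamma| * g w) w (bg0 w).
rewrite -ge0_integralD// -ge0_integralZl//; last 2 first.
- exact: emeasurable_funD.
- by move=> w _; exact: adde_ge0.
have <- : (\int[mu]_w ((bracket v `^ `|gamma|)%:E * (enorm (v - w)%R `^ gamma * g w)%:E) =
    (bracket v `^ `|gamma|)%:E * \int[mu]_w (enorm (v - w)%R `^ gamma * g w)%:E)%E.
  exact: ge0_integralZl.
apply: ge0_le_integral => //.
- by move=> w _; exact: mule_ge0.
- exact: emeasurable_funM.
- by apply: emeasurable_funM => //; exact: emeasurable_funD.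
move=> w _; rewrite -EFinM -EFinD -EFinM lee_fin.
have := ler_wpM2r (gp w) (bracket_riesz_le v w g0).
by rewrite -!mulrA mulrDl mul1r -mulrA.
Qed.

End sobolev.

Theorem proposition1p7 (R : realType) (d : nat) (gamma q : R) :
  (3 <= d)%N ->
  - d%:R <= gamma < 0 ->
  Num.max 1 (d%:R / (d%:R + 2 + gamma)) < q ->
  (q%:E < if gamma == (- d%:R)%R then +oo else (d%:R / (d%:R + gamma))%:E)%E ->
  let mu := lebesgue_rV R d in
  let s := (d%:R - q * (d%:R + gamma)) / (2 * q) in
  0 < s < 1 /\
  exists2 C0 : R, 0 < C0 &
  forall (eps : R) (phi g : 'rV[R]_d -> R),
  0 < eps ->
  measurable_fun [set: 'rV[R]_d] phi ->
  sobolev_H1 (fun v => bracket v `^ (gamma / 2) * phi v) ->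
  measurable_fun [set: 'rV[R]_d] g ->
  (forall v, 0 <= g v) ->
  g \in Lfun mu 1%:E ->
  (fun v => bracket v `^ `|gamma| * g v) \in Lfun mu q%:E ->
  ((\int[mu]_v ((phi v ^+ 2)%:E * c_gamma gamma g v))
   <= eps%:E * (\int[mu]_v
        (enorm (weak_grad (fun w => bracket w `^ (gamma / 2) * phi w)%R v)
         ^+ 2)%:E)
      + C0%:E *
        ('N[mu]_1[EFin \o g]
         + (eps `^ (- (s / (1 - s))))%:E
           * 'N[mu]_(q%:E)[EFin \o (fun v => (bracket v `^ `|gamma| * g v)%R)]
             `^ (1 / (1 - s)))
        * (\int[mu]_v (phi v ^+ 2 * bracket v `^ gamma)%:E))%E.
Proof.
move=> d3 /andP[dg g0]; rewrite gt_max => /andP[q1 dq] qd mu s.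
have q0 : 0 < q by exact: lt_trans q1.
have d2g : 0 < d%:R + 2 + gamma by rewrite -addrA; move: (d%:R : R) dg => D; lra.
(* Both forms of the upper bound on q become [q (d + gamma) < d], that is s > 0; the lower bound is
   [d < q (d + 2 + gamma)], that is s < 1. *)
have dgq : q * (d%:R + gamma) < d%:R.
  move: qd; have [->|gn] := eqVneq gamma (- d%:R).
    by rewrite subrr mulr0 ltr0n (leq_trans _ d3).
  have gd : 0 < d%:R + gamma.
    by rewrite -ltrBlDl sub0r lt_neqAle eq_sym gn.
  by rewrite lte_fin ltr_pdivlMr.
have s01 : 0 < s < 1.
  rewrite /s divr_gt0 ?subr_gt0 ?mulr_gt0//= ltr_pdivrMr ?mulr_gt0// mul1r.
  by move: dq; rewrite ltr_pdivrMr// -subr_gt0 => h; rewrite -subr_gt0; lra.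
have sE : gamma + d%:R * (1 - q^-1) = - (2 * s).
  by rewrite /s; field; rewrite gt_eqF.
split=> //.
have [s0 s1] := andP s01.
have d0 : 0 < d%:R :> R by rewrite ltr0n (leq_trans _ d3).
have d1 : 0 <= d%:R - 1 :> R by rewrite subr_ge0 ler1n (leq_trans _ d3).
have d2 : 0 <= d%:R - 2 :> R by rewrite subr_ge0 ler_nat (leq_trans _ d3).
have c0 (K1 K2 r : R) : 0 <= K1 -> 0 < 1 + K1 + K2 `^ r.
  by move=> K10; rewrite ltr_wpDr ?powR_ge0// ltr_pwDl.
have mbr (a : R) : measurable_fun setT (fun v : 'rV[R]_d => bracket v `^ a).
  exact: measurableT_comp (measurable_powR a) measurable_bracket.
have gE : gamma = - `|gamma| by rewrite ltr0_norm ?opprK.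
have psi2 (phi : 'rV[R]_d -> R) v :
    (bracket v `^ (gamma / 2) * phi v) ^+ 2 = phi v ^+ 2 * bracket v `^ gamma.
  rewrite exprMn mulrC; congr (_ * _).
  by rewrite -powR_mulrn ?powR_ge0// -powRrM; congr (_ `^ _); field.
(* The weight gained in passing from phi to psi is what multiplies [c_gamma[g]] and has to be
   absorbed by the potential. *)
have phi2 (phi : 'rV[R]_d -> R) v :
    phi v ^+ 2 = (bracket v `^ (gamma / 2) * phi v) ^+ 2 * bracket v `^ `|gamma|.
  by rewrite psi2 -mulrA -powRD_gt0 ?bracket_gt0// {1}gE addNr powRr0 mulr1.
have Nfin (G : 'rV[R]_d -> R) (p : \bar R) : G \in Lfun mu p ->
    exists2 N : R, 0 <= N & ('N[mu]_p[EFin \o G] = N%:E)%E.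
  move=> /sub_Lfun_finLfun; rewrite inE /finite_norm/= => h.
  have h0 := Lnorm_ge0 mu p (EFin \o G).
  by exists (fine 'N[mu]_p[EFin \o G]); rewrite ?fine_ge0// fineK// ge0_fin_numE.
have [gd|gd] := eqVneq gamma (- d%:R).
- have [sig sig0 sigE] := @sphere_measure_fin R d.
  pose kap := (d%:R - 1) * (d%:R - 2) * sig.
  have kap0 : 0 <= kap by rewrite !mulr_ge0.
  (* K1 = 0 because [phi^2 c_gamma[g]] equals [kap psi^2 G] exactly, and the factor 1 is the Morrey
     constant of [morrey_Lq]. *)
  exists (1 + 0 + (kap * (2 ^+ d.+1 * (1 + 2 `^ s / (1 - 2 `^ (- (1 - s)))) ^+ 2) * 1)
    `^ (1 / (1 - s))); first exact: c0.
  move=> eps phi g e0 mphi H mg g0' L1 Lq.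
  have [gn gn0 ->] := Nfin _ _ L1; have [N N0 NE] := Nfin _ _ Lq.
  rewrite NE.
  under [X in (_ <= _ + _ * X)%E]eq_integral do rewrite -psi2.
  have mG : measurable_fun setT (fun v : 'rV[R]_d => bracket v `^ `|gamma| * g v).
    exact: measurable_funM.
  have G0 v : 0 <= bracket v `^ `|gamma| * g v by rewrite mulr_ge0// powR_ge0.
  have cE v : c_gamma gamma g v = (kap * g v)%:E.
    by rewrite /c_gamma gd eqxx sigE.
  apply: (@form_bound_of_pointwise _ _ _ _ 0 kap 1 gn N _ _
    (EFin \o (fun v => bracket v `^ `|gamma| * g v))) => //.
  + exact: measurable_funM.
  + rewrite mul1r; apply: morrey_Lq NE => //.
    by rewrite -sE gd addrC.
  + apply: emeasurable_funM; first by apply/measurable_EFinP; exact: measurable_funX.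
    rewrite (funext cE).
    by apply/measurable_EFinP; exact: measurable_funM.
  + by move=> v; rewrite cE -EFinM lee_fin mulr_ge0 ?sqr_ge0// mulr_ge0.
  + move=> v; rewrite cE mul0r mul0e add0e /= -!EFinM lee_fin (phi2 phi).
    by rewrite le_eqVlt; apply/orP; left; apply/eqP; ring.
- have gd0 : - d%:R < gamma by rewrite lt_neqAle eq_sym gd.
  have gd1 : 0 <= gamma + d%:R by rewrite -lerBlDr sub0r.
  (* The factor [2^|gamma|] comes from splitting the weighted kernel; both resulting terms carry it,
     so K1 = K2 = kap. *)
  pose kap := (d%:R - 1) * (gamma + d%:R) * 2 `^ `|gamma|.
  have kap0 : 0 <= kap by rewrite !mulr_ge0 ?powR_ge0.
  pose rho := @riesz_const R d q gamma s.
  have rho0 : 0 <= rho by exact: riesz_const_ge0.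
  exists (1 + kap + (kap * (2 ^+ d.+1 * (1 + 2 `^ s / (1 - 2 `^ (- (1 - s)))) ^+ 2) * rho)
    `^ (1 / (1 - s))); first exact: c0.
  move=> eps phi g e0 mphi H mg g0' L1 Lq.
  have [gn gn0 gnE] := Nfin _ _ L1; have [N N0 NE] := Nfin _ _ Lq.
  rewrite gnE NE.
  under [X in (_ <= _ + _ * X)%E]eq_integral do rewrite -psi2.
  have mG : measurable_fun setT (fun v : 'rV[R]_d => bracket v `^ `|gamma| * g v).
    exact: measurable_funM.
  have G0 v : 0 <= bracket v `^ `|gamma| * g v by rewrite mulr_ge0// powR_ge0.
  have cE v : c_gamma gamma g v =
      (((d%:R - 1) * (gamma + d%:R))%:E * riesz_potential gamma g v)%E.
    by rewrite /c_gamma (negbTE gd).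
  have ker_ge0 : (0 <= ((d%:R - 1) * (gamma + d%:R))%:E)%E by rewrite lee_fin mulr_ge0.
  apply: (@form_bound_of_pointwise _ _ _ _ kap kap rho gn N _ _
    (riesz_potential gamma (fun v => bracket v `^ `|gamma| * g v))) => //.
  + exact: measurable_funM.
  + exact: morrey_riesz.
  + apply: emeasurable_funM; first by apply/measurable_EFinP; exact: measurable_funX.
    rewrite (funext cE).
    by apply: emeasurable_funM => //; exact: measurable_riesz_potential.
  + move=> v; rewrite cE mule_ge0 ?lee_fin ?sqr_ge0// mule_ge0//.
    exact: riesz_potential_ge0.
  + have gE1 : (\int[mu]_w (g w)%:E = gn%:E)%E.
      by rewrite -gnE Lnorm1; apply: eq_integral => w _; rewrite gee0_abs// lee_fin.
    move=> v; rewrite cE (phi2 phi) EFinM.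
    set P := (_ ^+ 2)%:E; have P0 : (0 <= P)%E by rewrite lee_fin sqr_ge0.
    set k0 := (_ * _)%:E.
    have -> : (P * (bracket v `^ `|gamma|)%:E * (k0 * riesz_potential gamma g v) =
        (P * k0) * ((bracket v `^ `|gamma|)%:E * riesz_potential gamma g v))%E.
      by rewrite -!muleA; congr (_ * _)%E; rewrite muleCA.
    have Pk0 : (0 <= P * k0)%E by exact: mule_ge0.
    apply: (le_trans (lee_wpmul2l Pk0 (bracket_riesz_potential_le v g0 mg g0' gE1))).
    rewrite muleA (_ : (P * k0 * (2 `^ `|gamma|)%:E = kap%:E * P)%E); last first.
      by rewrite -muleA muleC.
    by rewrite ge0_muleDr ?lee_fin ?riesz_potential_ge0// [(kap * gn)%:E]EFinM muleAC muleA.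
Qed.
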